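(* Let $n\ge2$, let $\mu$ be the normalized volume measure on the torus $\mathbb T^n$, and let $k,\ell\in\mathbb Z^n\setminus\{0\}$ with $k_p\ell_p=0$ for all $p=1,\dots,n$. Then $$\mathsf{Sec}_\mu(e_k,e_\ell)=-\frac{|k|^2|\ell|^2}{(4+|k|^2)(4+|\ell|^2)}\in\Big(-1,-\frac1{25}\Big].$$
   Context: $M=\mathbb T^n=(\mathbb R/2\pi\mathbb Z)^n$ with the flat metric and distance $d$, $d\mu=(2\pi)^{-n}dx$. Fourier basis: $e_k(x)=\prod_{p=1}^n e_{k_p}(x_p)$ for $k\in\mathbb Z^n$, where for $j\in\mathbb Z$: $e_j(y)=\sqrt2\cos(jy)$ if $j>0$, $\sqrt2\sin(jy)$ if $j<0$, $1$ if $j=0$. $|k|$ is the Euclidean norm. $\mathcal M_0(M)$ is the set of finite Borel measures on $M$. Cone: $C=(M\times[0,\infty))/\!\sim$, where $(x,r)\sim(x',r')$ iff they are equal or $r=r'=0$, with metric $d_C((x,r),(x',r'))^2=r^2+r'^2-2rr'\cos(\min(d(x,x'),\pi))$. $\mathcal M_2(C)$ (resp. $\mathcal M_2(C\times C)$) is the set of Borel measures integrating $1+$ squared distance to a fixed point. For $\nu\in\mathcal M_2(C)$: $\Pr(\nu)(A)=\int_{A\times[0,\infty)}r^2\,d\nu(x,r)$. With $\pi_0,\pi_1$ the projections of $C\times C$, $\mathsf{HK}(\mu_0,\mu_1)=\inf\{\int d_C^2\,dq: q\in\mathcal M_2(C\times C),\ \Pr((\pi_i)_*q)=\mu_i,\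 i=0,1\}^{1/2}$. For $r>0$, $s>-r$, $|v|<(1+s/r)\pi/2$: $\exp^C_{(x,r)}(v,s)=\big(\exp^M_x(\arctan(\tfrac{r|v|}{r+s})\tfrac{v}{|v|}),\sqrt{(r+s)^2+r^2|v|^2}\big)$ (first component $x$ if $v=0$). $r_\mu=\sqrt{\mu(M)}$, $\hat\mu=\frac1{r_\mu^2}\mu\otimes\delta_{r_\mu}$, $\exp_\mu(\varphi)=\Pr(\exp^C((\nabla\varphi,2r\varphi))_*\hat\mu)$. $\|\varphi\|^2_{H^1(\mu)}=\int(|\nabla\varphi|^2+4\varphi^2)d\mu$ with corresponding inner product; $\Lambda=\|\varphi\|^2_{H^1(\mu)}\|\psi\|^2_{H^1(\mu)}-\langle\varphi,\psi\rangle^2_{H^1(\mu)}$. $\lim^{*}_{s,t\to0}G(s,t)=L$ means $G(s_j,t_j)\to L$ whenever $s_j,t_j\to0$ in $(0,\infty)$ with $\sup_j(s_j/t_j+t_j/s_j)<\infty$. $$\mathsf{Sec}_\mu(\varphi,\psi)=\lim^{*}_{s,t\to0}\tfrac{3}{\Lambda s^2t^2}\big[\|s\varphi-t\psi\|^2_{H^1(\mu)}-\mathsf{HK}^2(\exp_\mu(s\varphi),\exp_\mu(t\psi))\big].$$ *)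

(* Defs.v *)
From HB Require Import structures.
From mathcomp Require Import all_boot all_order all_algebra generic_quotient.
From mathcomp Require Import all_classical all_reals all_analysis.
From mathcomp Require Import measurable_realfun.

Set Implicit Arguments.
Unset Strict Implicit.
Unset Printing Implicit Defensive.

Import Order.TTheory GRing.Theory Num.Theory.
Import numFieldNormedType.Exports.

Local Open Scope classical_set_scope.
Local Open Scope ring_scope.
Local Open Scope quotient_scope.

(* The open sets of a distance; they generate the Borel sigma-algebra of the
   circle and of the cone below. *)
Definition dist_open (R : realType) (T : Type) (dist : T -> T -> R) :
    set (set T) :=
  [set U | forall x, U x ->
     exists2 e : R, 0 < e & forall y, dist x y < e -> U y].

Section circle.
Context (R : realType).

Definition circle_rel (a b : R) : bool :=
  `[< exists z : int, a - b = z%:~R * (2 * pi) >].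

Lemma circle_rel_refl : reflexive circle_rel.
Proof. by move=> a; apply/asboolP; exists 0; rewrite subrr mul0r. Qed.

Lemma circle_rel_sym : symmetric circle_rel.
Proof.
suff h a b : circle_rel a b -> circle_rel b a by move=> a b; apply/idP/idP => /h.
move=> /asboolP[z abz]; apply/asboolP; exists (- z).
by rewrite -(opprB a) abz rmorphN mulNr.
Qed.

Lemma circle_rel_trans : transitive circle_rel.
Proof.
move=> b a c /asboolP[z abz] /asboolP[y bcy]; apply/asboolP; exists (z + y).
by rewrite rmorphD mulrDl -abz -bcy addrA subrK.
Qed.

Canonical circle_equiv :=
  EquivRel circle_rel circle_rel_refl circle_rel_sym circle_rel_trans.

Definition circle := {eq_quot circle_equiv}.

HB.instance Definition _ := Choice.on circle.
HB.instance Definition _ :=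
  isPointed.Build circle (\pi_{eq_quot circle_equiv} 0).

Definition to_circle (a : R) : circle := \pi_{eq_quot circle_equiv} a.

(* An arbitrary real representative; it is only ever fed to expressions that are
   2 pi-periodic in each coordinate. *)
Definition circle_lift (y : circle) : R := repr (y : {eq_quot circle_equiv}).

(* The quotient distance on R / 2 pi Z, i.e. the length of a shortest arc. *)
Definition circle_dist (y y' : circle) : R :=
  inf [set r | exists a b : R,
         [/\ to_circle a = y, to_circle b = y' & r = `|a - b|]].

HB.instance Definition _ :=
  Measurable.copy circle (g_sigma_algebraType (dist_open circle_dist)).

End circle.

Section probability_power.
Context d (T : measurableType d) (R : realType).

Definition tuple_cons n (x : T * n.-tuple T) : n.+1.-tuple T :=
  [tuple of x.1 :: x.2].

Lemma measurable_tuple_cons n :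
  measurable_fun [set: T * n.-tuple T] (@tuple_cons n).
Proof.
by apply: measurable_cons; [exact: measurable_fst|exact: measurable_snd].
Qed.

HB.instance Definition _ n :=
  isMeasurableFun.Build _ _ _ _ (@tuple_cons n) (@measurable_tuple_cons n).

(* The n-fold product measure P x ... x P on T^n. *)
Fixpoint probability_power (P : probability T R) n :
    probability (n.-tuple T) R :=
  if n is m.+1 then distribution (P \x probability_power P m)%E (@tuple_cons m)
  else \d_[tuple].

End probability_power.

Section circle_measure.
Context (R : realType).

Lemma circle_distE (a b : R) :
  circle_dist (to_circle a) (to_circle b) <= `|a - b|.
Proof.
apply: ge_inf; last by exists a, b.
by exists 0 => _ [? [? [_ _ ->]]].
Qed.

Lemma measurable_to_circle :
  measurable_fun [set: measurableTypeR R] (@to_circle R).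
Proof.
apply: (@measurability _ _ _ _ _ _ (dist_open (@circle_dist R))) => //.
move=> _ [U oU <-]; rewrite setTI.
apply: open_measurable; rewrite openE => a /= /oU[e e0 eU].
apply/nbhs_ballP; exists e => // b ab; apply: eU.
exact: le_lt_trans (circle_distE _ _) ab.
Qed.

Definition to_circle_mfun : {mfun measurableTypeR R >-> circle R} :=
  HB.pack (@to_circle R) (isMeasurableFun.Build _ _ _ _ _ measurable_to_circle).

Lemma two_pi_gt0 : 0 < 2 * pi :> R.
Proof. by rewrite mulr_gt0 ?pi_gt0. Qed.

(* dx / (2 pi) on R / 2 pi Z. *)
Definition circle_prob : probability (circle R) R :=
  distribution (uniform_prob two_pi_gt0) to_circle_mfun.

End circle_measure.

Section torus.
Context (R : realType) (n : nat).

(* Tuples carry the product sigma-algebra, which is the Borel one because the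
   circle is separable. *)
Definition torus := n.-tuple (circle R).

HB.instance Definition _ := Choice.on torus.
HB.instance Definition _ := Measurable.on torus.

Definition to_torus (v : 'rV[R]_n) : torus := [tuple to_circle (v 0 i) | i < n].

Definition torus_lift (x : torus) : 'rV[R]_n := \row_i circle_lift (tnth x i).

Definition torus_dist (x y : torus) : R :=
  Num.sqrt (\sum_(i < n) circle_dist (tnth x i) (tnth y i) ^+ 2).

(* The normalized volume (2 pi)^-n dx. *)
Definition torus_volume : probability torus R :=
  probability_power (circle_prob R) n.

Definition dotv (v w : 'rV[R]_n) : R := \sum_(i < n) v 0 i * w 0 i.

Definition normv (v : 'rV[R]_n) : R := Num.sqrt (dotv v v).

(* Partial derivatives of the lift of phi to R^n. *)
Definition grad (phi : torus -> R) (x : torus) : 'rV[R]_n :=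
  \row_i 'D_(delta_mx 0 i) (phi \o to_torus) (torus_lift x).

Definition torus_exp (x : torus) (v : 'rV[R]_n) : torus :=
  to_torus (torus_lift x + v).

End torus.

Section cone.
Context (R : realType) (n : nat).
Local Notation M := (torus R n).
Local Notation pre_cone := (M * {nonneg R})%type.

Definition cone_rel (p q : pre_cone) : bool :=
  (p == q) || ((p.2%:num == 0) && (q.2%:num == 0)).

Lemma cone_rel_refl : reflexive cone_rel.
Proof. by move=> p; rewrite /cone_rel eqxx. Qed.

Lemma cone_rel_sym : symmetric cone_rel.
Proof. by move=> p q; rewrite /cone_rel eq_sym andbC. Qed.

Lemma cone_rel_trans : transitive cone_rel.
Proof.
move=> q p s /orP[/eqP->//|/andP[p0 q0]] /orP[/eqP<-|/andP[_ s0]];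
by apply/orP; right; apply/andP.
Qed.

Canonical cone_equiv :=
  EquivRel cone_rel cone_rel_refl cone_rel_sym cone_rel_trans.

Definition cone := {eq_quot cone_equiv}.

HB.instance Definition _ := Choice.on cone.
HB.instance Definition _ :=
  isPointed.Build cone (\pi_{eq_quot cone_equiv} (point, 0%:nng)).

(* Only meant for 0 <= r; taking r real makes it composable with a measure on
   M x R. *)
Definition to_cone (x : M) (r : R) : cone :=
  \pi_{eq_quot cone_equiv} (x, `|r|%:nng).

(* At the apex this is an arbitrary point of M. It does not matter: there the
   base point always comes with the radius 0. *)
Definition cone_base (c : cone) : M := (repr (c : {eq_quot cone_equiv})).1.

Definition cone_radius (c : cone) : R := (repr (c : {eq_quot cone_equiv})).2%:num.

Definition cone_dist (c c' : cone) : R :=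
  let r := cone_radius c in let r' := cone_radius c' in
  Num.sqrt (r ^+ 2 + r' ^+ 2 - 2 * r * r'
    * cos (Num.min (torus_dist (cone_base c) (cone_base c')) pi)).

HB.instance Definition _ :=
  Measurable.copy cone (g_sigma_algebraType (dist_open cone_dist)).

(* Meaningful for 0 < r, - r < s and |v| < (1 + s / r) pi / 2, junk otherwise.
   In the limits below, phi is bounded with bounded gradient, so that the
   condition eventually holds. *)
Definition cone_exp (c : cone) (v : 'rV[R]_n) (s : R) : cone :=
  let x := cone_base c in let r := cone_radius c in
  to_cone
    (if v == 0 then x
     else torus_exp x ((atan (r * normv v / (r + s)) / normv v) *: v))
    (Num.sqrt ((r + s) ^+ 2 + r ^+ 2 * normv v ^+ 2)).

End cone.

Section hellinger_kantorovich.
Context (R : realType) (n : nat).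
Local Notation M := (torus R n).
Local Notation C := (cone R n).

(* Pushforwards and Pr are plain set functions, so that no measurability proof
   is needed to form them; the product sigma-algebra on C * C is the Borel one,
   C being separable. *)
Definition in_M2 d (T : measurableType d) (dist : T -> T -> R)
    (nu : set T -> \bar R) : Prop :=
  exists z0, (\int[nu]_z (1 + dist z z0 ^+ 2)%:E < +oo)%E.

Definition cone2_dist (z w : C * C) : R :=
  Num.sqrt (cone_dist z.1 w.1 ^+ 2 + cone_dist z.2 w.2 ^+ 2).

Definition Pr (nu : set C -> \bar R) (A : set M) : \bar R :=
  (\int[nu]_(c in @cone_base R n @^-1` A) (cone_radius c ^+ 2)%:E)%E.

Definition HK_plan (mu0 mu1 : set M -> \bar R)
    (q : {measure set (C * C) -> \bar R}) : Prop :=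
  in_M2 cone2_dist q /\
  forall A, measurable A ->
    Pr (pushforward q fst) A = mu0 A /\ Pr (pushforward q snd) A = mu1 A.

Definition HK (mu0 mu1 : set M -> \bar R) : \bar R :=
  sqrte (ereal_inf [set (\int[q]_z (cone_dist z.1 z.2 ^+ 2)%:E)%E
                   | q in HK_plan mu0 mu1]).

Section fixed_measure.
Variable mu : {finite_measure set M -> \bar R}.

Definition total_radius : R := Num.sqrt (fine (mu setT)).

(* mu (x) delta_r / r^2 for r = r_mu, carried by the image of M x {r} in C. *)
Definition hat_measure (A : set C) : \bar R :=
  ((total_radius ^- 2)%:E *
   pushforward (mu \x \d_(total_radius : measurableTypeR R))
     (fun xr => to_cone xr.1 xr.2) A)%E.

Definition exp_measure (phi : M -> R) : set M -> \bar R :=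
  Pr (pushforward hat_measure (fun c =>
    cone_exp c (grad phi (cone_base c))
      (2 * cone_radius c * phi (cone_base c)))).

Definition H1_dot (phi psi : M -> R) : R :=
  \int[mu]_x (dotv (grad phi x) (grad psi x) + 4 * phi x * psi x).

Definition H1_norm (phi : M -> R) : R :=
  Num.sqrt (\int[mu]_x (normv (grad phi x) ^+ 2 + 4 * phi x ^+ 2)).

Definition H1_gram (phi psi : M -> R) : R :=
  H1_norm phi ^+ 2 * H1_norm psi ^+ 2 - H1_dot phi psi ^+ 2.

(* HK is finite on finite measures, whence the harmless use of fine. *)
Definition Sec_quotient (phi psi : M -> R) (s t : R) : R :=
  3 / (H1_gram phi psi * s ^+ 2 * t ^+ 2) *
  (H1_norm (fun x => s * phi x - t * psi x) ^+ 2
   - fine (HK (exp_measure (fun x => s * phi x))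
              (exp_measure (fun x => t * psi x))) ^+ 2).

End fixed_measure.

End hellinger_kantorovich.

Definition lim_star (R : realType) (G : R -> R -> R) (L : R) : Prop :=
  forall s t : nat -> R,
    (forall j, 0 < s j) -> (forall j, 0 < t j) ->
    s @ \oo --> 0 -> t @ \oo --> 0 ->
    (exists K, forall j, s j / t j + t j / s j <= K) ->
    (fun j => G (s j) (t j)) @ \oo --> L.

(* The limit defining Sec exists and equals L. *)
Definition is_Sec (R : realType) (n : nat)
    (mu : {finite_measure set (torus R n) -> \bar R})
    (phi psi : torus R n -> R) (L : R) : Prop :=
  lim_star (Sec_quotient mu phi psi) L.

Section fourier.
Context (R : realType) (n : nat).

Definition circle_basis (j : int) (y : circle R) : R :=
  if 0 < j then Num.sqrt 2 * cos (j%:~R * circle_lift y)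
  else if j < 0 then Num.sqrt 2 * sin (j%:~R * circle_lift y)
  else 1.

Definition fourier_basis (k : 'rV[int]_n) (x : torus R n) : R :=
  \prod_(p < n) circle_basis (k 0 p) (tnth x p).

Definition int_norm (k : 'rV[int]_n) : R := normv (map_mx intr k).

End fourier.

Arguments int_norm R {n} k.

(* Main.v *)
(* Write [phi = e_k], [psi = e_l]. As [k] and [l] have disjoint supports, the
   gradients of [phi] and [psi] are orthogonal at every point, and
   [D^2 phi . grad psi = 0]. The measure [exp_mu (s phi)] comes from an explicit
   map [x |-> (x + a, r)] of the torus into the cone, and [exp_mu (t psi)] from
   [x |-> (x + b, r')].

   Upper bound for [HK^2]: the joint law of the two maps is an admissible plan.
   Lower bound: weak duality with [f1 = exp g] and
   [f0 v = sup_u exp (- |u - v|^2 - |u - v|^4 / 6 - g u)], where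
   [g = 2 s phi - 2 s^2 phi^2 - 2 t psi + 2 t^2 psi^2 + t^2 |grad psi|^2]. The
   pair is admissible because [cos d <= exp (- d^2 / 2 - d^4 / 12)] on [[0, pi]].

   At [v = x + a] the expression under the supremum has a gradient of third
   order in [s + t] at [u = x + b], so that replacing the supremum by the value
   there costs a term of sixth order only. Hence both bounds equal the integral of
     [4 (s phi - t psi)^2 + s^2 |grad phi|^2 + t^2 |grad psi|^2
      + s^2 t^2 |grad phi|^2 |grad psi|^2 / 3]
   up to [O((s + t)^5)]. The first three terms give the [H^1] norm, and the last
   one has mean [s^2 t^2 |k|^2 |l|^2 / 3]. *)

Require Import Defs.
From HB Require Import structures.
From mathcomp Require Import all_boot all_order all_algebra generic_quotient.
From mathcomp Require Import all_classical all_reals all_analysis.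
From mathcomp Require Import measurable_realfun.
From mathcomp Require Import ring lra.

Set Implicit Arguments.
Unset Strict Implicit.
Unset Printing Implicit Defensive.

Import Order.TTheory GRing.Theory Num.Theory.
Import numFieldNormedType.Exports.

Local Open Scope classical_set_scope.
Local Open Scope ring_scope.

(** * Elementary inequalities and uniform big-O estimates *)

(** The quotient divides by [s^2 t^2], so the two bounds must agree through fourth order, uniformly
    in the base point. Neither an optimal plan nor an optimal potential is computed; approximate
    ones suffice because both errors enter squared. At an approximate critical point the loss is the
    square of the gradient, and by AM-GM the dual value depends quadratically on how far the two
    dual terms are from being equal.

    The potential [g] comes from the equality case of that AM-GM inequality: [r^2 f0] and [r'^2 f1]
    should both equal [r r' cos d]. As [r cos |a| = 1 + 2 s phi] and [r' cos |b| = 1 + 2 t psi],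
    this asks, to second order, that [g (x + b)] be [log (1 + 2 s phi) - log (1 + 2 t psi) - t^2
    |grad psi|^2] taken at [x]. Expressing the right-hand side at [x + b] leaves the [phi] terms
    alone, because [b] is orthogonal to [grad phi], whereas [psi] grows by about [t |grad psi|^2].
    This turns the last coefficient from [-1] into [+1]. *)

Section elementary_bounds.
Context (R : realType).
Implicit Types x y : R.

Lemma derive_ge0_ge (f f' : R -> R) b :
    (forall x, is_derive x 1 f (f' x)) ->
    (forall x, 0 < x < b -> 0 <= f' x) ->
  forall x, 0 <= x <= b -> f 0 <= f x.
Proof.
move=> df f'0 x /andP[]; rewrite le_eqVlt => /predU1P[<-//|x0 xb].
have [|c /[!in_itv]/= /andP[c0 cx] fc] := @MVT R f f' 0 x x0 (fun y _ => df y).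
  by apply: derivable_within_continuous => y _; have [] := df y.
rewrite -subr_ge0 fc; apply: mulr_ge0; last by rewrite subr_ge0 ltW.
by apply: f'0; rewrite c0/=; exact: lt_le_trans xb.
Qed.

(** In the polynomial bounds for sine and cosine below, each bound is the sign of the derivative in
    the next one, so that repeated use of this lemma climbs the Taylor series degree by degree. *)
Lemma derive_ge0_ge0 (f f' : R -> R) x :
    f 0 = 0 -> (forall x, is_derive x 1 f (f' x)) ->
    (forall y, 0 < y < x -> 0 <= f' y) -> 0 <= x -> 0 <= f x.
Proof.
by move=> f0 df f'0 x0; rewrite -f0; apply: (derive_ge0_ge df f'0); rewrite x0/=.
Qed.

(* [x ^+ n] also unifies with a product, which makes instance resolution for
   [is_derive] exponential in the degree; hence a rigid name for monomials. *)
Definition monomial (a : R) (n : nat) (x : R) : R := a * x ^+ n.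

Lemma is_derive_monomial a n x :
  is_derive x 1 (monomial a n.+1) (n.+1%:R * a * x ^+ n).
Proof.
have -> : monomial a n.+1 = a \*: (@id R ^+ n.+1).
  by apply/funext => y; rewrite /monomial/= exprfctE.
by apply: is_derive_eq; rewrite /GRing.scale/= mulr1; ring.
Qed.

Lemma sin_le_id x : 0 <= x -> sin x <= x.
Proof.
move=> x0; rewrite -subr_ge0.
apply: (@derive_ge0_ge0 (fun y => y - sin y) (fun y => 1 - cos y)) => //.
by rewrite sin0 subrr.
Qed.

Lemma cos_ge2 x : 1 - x ^+ 2 / 2 <= cos x.
Proof.
wlog x0 : x / 0 <= x => [h|].
  have [|x0] := leP 0 x; first exact: h.
  by rewrite -cosN -sqrrN; apply: h; rewrite oppr_ge0 ltW.
suff : 0 <= cos x - 1 + monomial 2^-1 2 x by rewrite /monomial; lra.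
apply: (@derive_ge0_ge0 (fun y => cos y - 1 + monomial 2^-1 2 y) (fun y => y - sin y)) x0.
- by rewrite /monomial cos0 expr0n /= mulr0 addr0 subrr.
- move=> y; have ? := is_derive_monomial 2^-1 1 y.
  by apply: is_derive_eq; field.
- by move=> y /andP[y0 _]; rewrite subr_ge0 sin_le_id// ltW.
Qed.

Lemma sin_ge3 x : 0 <= x -> x - x ^+ 3 / 6 <= sin x.
Proof.
move=> x0; suff : 0 <= sin x - x + monomial 6^-1 3 x by rewrite /monomial; lra.
apply: (@derive_ge0_ge0 (fun y => sin y - y + monomial 6^-1 3 y)
  (fun y => cos y - (1 - y ^+ 2 / 2))) x0.
- by rewrite /monomial sin0 expr0n /= mulr0 addr0 subrr.
- move=> y; have ? := is_derive_monomial 6^-1 2 y.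
  by apply: is_derive_eq; field.
- by move=> y _; rewrite subr_ge0 cos_ge2.
Qed.

Lemma cos_le4 x : cos x <= 1 - x ^+ 2 / 2 + x ^+ 4 / 24.
Proof.
wlog x0 : x / 0 <= x => [h|].
  have [|x0] := leP 0 x; first exact: h.
  have -> : x ^+ 2 = (- x) ^+ 2 by ring.
  have -> : x ^+ 4 = (- x) ^+ 4 by ring.
  by rewrite -cosN; apply: h; rewrite oppr_ge0 ltW.
suff : 0 <= 1 - cos x - monomial 2^-1 2 x + monomial 24^-1 4 x.
  by rewrite /monomial; lra.
apply: (@derive_ge0_ge0 (fun y => 1 - cos y - monomial 2^-1 2 y + monomial 24^-1 4 y)
  (fun y => sin y - (y - y ^+ 3 / 6))) x0.
- by rewrite /monomial cos0 !expr0n /= !mulr0 addr0 subr0 subrr.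
- move=> y; have ? := is_derive_monomial 2^-1 1 y.
  have ? := is_derive_monomial 24^-1 3 y.
  by apply: is_derive_eq; field.
- by move=> y /andP[y0 _]; rewrite subr_ge0 sin_ge3// ltW.
Qed.

Lemma sin_le5 x : 0 <= x -> sin x <= x - x ^+ 3 / 6 + x ^+ 5 / 120.
Proof.
move=> x0.
suff : 0 <= x - sin x - monomial 6^-1 3 x + monomial 120^-1 5 x.
  by rewrite /monomial; lra.
apply: (@derive_ge0_ge0 (fun y => y - sin y - monomial 6^-1 3 y + monomial 120^-1 5 y)
  (fun y => 1 - y ^+ 2 / 2 + y ^+ 4 / 24 - cos y)) x0.
- by rewrite /monomial sin0 !expr0n /= !mulr0 addr0 !subr0.
- move=> y; have ? := is_derive_monomial 6^-1 2 y.
  have ? := is_derive_monomial 120^-1 4 y.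
  by apply: is_derive_eq; field.
- by move=> y _; rewrite subr_ge0 cos_le4.
Qed.

Lemma cos_ge6 x : 0 <= x -> 1 - x ^+ 2 / 2 + x ^+ 4 / 24 - x ^+ 6 / 720 <= cos x.
Proof.
move=> x0.
suff : 0 <= cos x - 1 + monomial 2^-1 2 x - monomial 24^-1 4 x + monomial 720^-1 6 x.
  by rewrite /monomial; lra.
apply: (@derive_ge0_ge0 (fun y => cos y - 1 + monomial 2^-1 2 y
   - monomial 24^-1 4 y + monomial 720^-1 6 y)
  (fun y => y - y ^+ 3 / 6 + y ^+ 5 / 120 - sin y)) x0.
- by rewrite /monomial cos0 !expr0n /= !mulr0 !addr0 subr0 subrr.
- move=> y; have ? := is_derive_monomial 2^-1 1 y.
  have ? := is_derive_monomial 24^-1 3 y.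
  have ? := is_derive_monomial 720^-1 5 y.
  by apply: is_derive_eq; field.
- by move=> y /andP[y0 _]; rewrite subr_ge0 sin_le5// ltW.
Qed.

Lemma sin_lip x : `|sin x| <= `|x|.
Proof.
wlog x0 : x / 0 <= x => [h|].
  have [|x0] := leP 0 x; first exact: h.
  by rewrite -normrN -sinN -(normrN x); apply: h; rewrite oppr_ge0 ltW.
rewrite (ger0_norm x0) ler_norml sin_le_id// andbT.
rewrite -subr_ge0 opprK.
apply: (@derive_ge0_ge0 (fun y => sin y + y) (fun y => cos y + 1)) => //.
by rewrite sin0 addr0.
Qed.

Lemma cosB1_norm x : `|cos x - 1| <= x ^+ 2 / 2.
Proof. by rewrite ler_norml; have := cos_ge2 x; have := cos_le1 x; lra. Qed.

Lemma sinBid_norm x : `|sin x - x| <= 2 * x ^+ 2.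
Proof.
have [x1|x1] := leP `|x| 1; last first.
  have : `|x| <= x ^+ 2 by rewrite -real_normK ?num_real//; nra.
  by have := sin_lip x; have := ler_normB (sin x) x; lra.
wlog x0 : x x1 / 0 <= x => [h|].
  have [|x0] := leP 0 x; first exact: h.
  have := h (- x); rewrite sinN -opprD !normrN sqrrN; apply => //.
  by rewrite oppr_ge0 ltW.
have := sin_ge3 x0; have := sin_le_id x0; rewrite ger0_norm// in x1.
by rewrite ler_norml => h1 h2; apply/andP; split; nra.
Qed.

Lemma cos_taylor x h : `|cos (x + h) - cos x + sin x * h| <= 3 * h ^+ 2.
Proof.
rewrite cosD.
have -> : cos x * cos h - sin x * sin h - cos x + sin x * h =
  cos x * (cos h - 1) - sin x * (sin h - h) by ring.
apply: (le_trans (ler_normB _ _)); rewrite !normrM.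
have := cosB1_norm h; have := sinBid_norm h; have := cos_max x; have := sin_max x.
have := normr_ge0 (cos h - 1); have := normr_ge0 (sin h - h).
have := normr_ge0 (cos x); have := normr_ge0 (sin x).
have := sqr_ge0 h; nra.
Qed.

Lemma sin_taylor x h : `|sin (x + h) - sin x - cos x * h| <= 3 * h ^+ 2.
Proof.
have := cos_taylor (x - pi / 2) h.
by rewrite (addrAC x) !cosBpihalf sinBpihalf mulNr.
Qed.

(** The exponent is the Taylor polynomial of degree 4 of [log cos], whose derivative is [- tan]. So
    the claim comes from [tan y >= y + y^3 / 3], itself obtained from [tan y >= y]. Both are
    multiplied by [cos y], in which form they persist beyond [pi / 2]. *)
Lemma cos_le_expR (d : R) : 0 <= d <= pi -> cos d <= expR (- (d ^+ 2 / 2 + d ^+ 4 / 12)).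
Proof.
move=> /andP[d0 dpi].
have sinc (y : R) : 0 <= y <= pi -> 0 <= sin y - y * cos y.
  move=> /andP[y0 ypi].
  apply: (@derive_ge0_ge0 (fun y => sin y - y * cos y) (fun y => y * sin y)) => //.
  - by rewrite sin0 mul0r subrr.
  - by move=> z; apply: is_derive_eq => /=; rewrite /GRing.scale/=; ring.
  - move=> z /andP[z0 zy]; rewrite mulr_ge0 ?sin_ge0_pi// ltW//=.
    exact: ltW (lt_le_trans zy ypi).
have tanc (y : R) : 0 <= y <= pi -> 0 <= sin y - (y + y ^+ 3 / 3) * cos y.
  move=> /andP[y0 ypi].
  have -> : (y + y ^+ 3 / 3) = y + monomial 3^-1 3 y by rewrite /monomial mulrC.
  apply: (@derive_ge0_ge0 (fun y => sin y - (y + monomial 3^-1 3 y) * cos y)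
    (fun y => y * (sin y - y * cos y) + y ^+ 3 / 3 * sin y)) y0.
  - by rewrite /monomial sin0 expr0n/= mulr0 addr0 mul0r subrr.
  - move=> z; have ? := is_derive_monomial 3^-1 2 z.
    by apply: is_derive_eq; rewrite /monomial /GRing.scale/=; field.
  - move=> z /andP[z0 zy].
    have zpi : 0 <= z <= pi by rewrite (ltW z0) (ltW (lt_le_trans zy ypi)).
    have z0' := ltW z0; apply: addr_ge0; first by rewrite mulr_ge0 ?sinc.
    by rewrite mulr_ge0 ?sin_ge0_pi// divr_ge0// exprn_ge0.
have e (y : R) : y ^+ 2 / 2 + y ^+ 4 / 12 = (monomial 2^-1 2 \+ monomial 12^-1 4) y.
  by rewrite /monomial/=; ring.
have : 0 <= 1 - cos d * expR (d ^+ 2 / 2 + d ^+ 4 / 12).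
  rewrite e.
  apply: (@derive_ge0_ge0 (fun y => 1 - cos y * expR ((monomial 2^-1 2 \+ monomial 12^-1 4) y))
    (fun y => expR (y ^+ 2 / 2 + y ^+ 4 / 12) * (sin y - (y + y ^+ 3 / 3) * cos y))) d0.
  - by rewrite -e cos0 !expr0n/= !mul0r addr0 expR0 mul1r subrr.
  - move=> z; rewrite e.
    have ? := is_derive_monomial 2^-1 1 z.
    have ? := is_derive_monomial 12^-1 3 z.
    have ? := @is_derive1_comp _ expR (monomial 2^-1 2 \+ monomial 12^-1 4) z _ _ _ _.
    by apply: is_derive_eq; rewrite -e /GRing.scale/=; field.
  - move=> z /andP[z0 zy].
    by rewrite mulr_ge0 ?expR_ge0// tanc// (ltW z0) (ltW (lt_le_trans zy dpi)).
by rewrite expRN subr_ge0 -ler_pdivlMr ?expR_gt0// mul1r.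
Qed.

Lemma expR_le4 y : y <= 1 -> expR y <= 4.
Proof.
move=> y1; apply: (@le_trans _ _ (expR (1 / 2 + 1 / 2))); first by rewrite ler_expR; lra.
rewrite expRD; have h : 1 / 2 <= expR (- (1 / 2) : R).
  by apply: le_trans (expR_ge1Dx _); lra.
have := expRxMexpNx_1 (1 / 2 : R); have := expR_ge0 (1 / 2 : R).
have : expR (1 / 2 : R) * (1 / 2) <= expR (1 / 2 : R) * expR (- (1 / 2) : R).
  by rewrite ler_wpM2l// expR_ge0.
nra.
Qed.

Lemma expR_taylor_pos y : 0 <= y <= 1 ->
  0 <= expR y - 1 - y - y ^+ 2 / 2 <= y ^+ 3.
Proof.
move=> /andP[y0 y1].
have h1 (z : R) : 0 <= z <= 1 -> expR z - 1 <= 4 * z.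
  move=> /andP[z0 z1]; rewrite -subr_ge0.
  apply: (@derive_ge0_ge0 (fun z => 4 * z - (expR z - 1)) (fun z => 4 - expR z)) z0.
  - by rewrite mulr0 expR0 subrr subr0.
  - by move=> x; apply: is_derive_eq; rewrite /GRing.scale/=; ring.
  - by move=> x /andP[x0 xz]; rewrite subr_ge0 expR_le4// ltW// (lt_le_trans xz).
have h2 (z : R) : 0 <= z <= 1 -> expR z - 1 - z <= 2 * z ^+ 2.
  move=> /andP[z0 z1]; rewrite -subr_ge0.
  apply: (@derive_ge0_ge0 (fun z => monomial 2 2 z - (expR z - 1 - z))
      (fun z => 4 * z - (expR z - 1))) z0.
  - by rewrite /monomial expr0n/= mulr0 expR0 subrr !subr0.
  - move=> x; have ? := is_derive_monomial 2 1 x.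
    by apply: is_derive_eq; rewrite /GRing.scale/=; ring.
  - by move=> x /andP[x0 xz]; rewrite subr_ge0 h1// (ltW x0)/= ltW// (lt_le_trans xz).
have h3 (z : R) : 0 <= z -> 0 <= expR z - 1 - z - monomial 2^-1 2 z.
  move=> z0; apply: (@derive_ge0_ge0 (fun z => expR z - 1 - z - monomial 2^-1 2 z)
      (fun z => expR z - (1 + z))) z0.
  - by rewrite /monomial expr0n/= mulr0 expR0 subrr !subr0.
  - move=> x; have ? := is_derive_monomial 2^-1 1 x.
    by apply: is_derive_eq; rewrite /GRing.scale/=; field.
  - by move=> x _; rewrite subr_ge0 expR_ge1Dx.
have := h3 _ y0; rewrite /monomial (mulrC 2^-1) => -> /=.
apply: (@le_trans _ _ (2 / 3 * y ^+ 3)); last first.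
  by have : 0 <= y ^+ 3 := exprn_ge0 _ y0; lra.
suff : 0 <= monomial (2 / 3) 3 y - (expR y - 1 - y - monomial 2^-1 2 y) by rewrite /monomial; lra.
apply: (@derive_ge0_ge0 (fun y => monomial (2 / 3) 3 y - (expR y - 1 - y - monomial 2^-1 2 y))
   (fun z => 2 * z ^+ 2 - (expR z - 1 - z))) y0.
- by rewrite /monomial !expr0n/= !mulr0 expR0 subrr !subr0.
- move=> x; have ? := is_derive_monomial 2^-1 1 x.
  have ? := is_derive_monomial (2 / 3) 2 x.
  by apply: is_derive_eq; rewrite /GRing.scale/=; field.
- by move=> x /andP[x0 xz]; rewrite subr_ge0 h2// (ltW x0)/= ltW// (lt_le_trans xz).
Qed.

Lemma expR_taylor_neg y : 0 <= y ->
  0 <= 1 - y + y ^+ 2 / 2 - expR (- y) <= y ^+ 3.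
Proof.
move=> y0.
have d (z : R) : is_derive z 1 (fun x => expR (- x)) (- expR (- z)).
  by apply: is_derive_eq; rewrite /GRing.scale/= mulrN1.
have h1 (z : R) : 0 <= z -> 0 <= 1 - z + monomial 2^-1 2 z - expR (- z).
  move=> z0; apply: (@derive_ge0_ge0 (fun z => 1 - z + monomial 2^-1 2 z - expR (- z))
      (fun z => expR (- z) - (1 + - z))) z0.
  - by rewrite /monomial expr0n/= mulr0 oppr0 expR0 !addr0 subrr.
  - move=> x; have ? := is_derive_monomial 2^-1 1 x.
    by apply: is_derive_eq; rewrite /GRing.scale/=; field.
  - by move=> x _; rewrite subr_ge0 expR_ge1Dx.
have := h1 _ y0; rewrite /monomial (mulrC 2^-1) => -> /=.
apply: (@le_trans _ _ (1 / 6 * y ^+ 3)); last first.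
  by have : 0 <= y ^+ 3 := exprn_ge0 _ y0; lra.
suff : 0 <= monomial 6^-1 3 y - (1 - y + monomial 2^-1 2 y - expR (- y)) by rewrite /monomial; lra.
apply: (@derive_ge0_ge0 (fun y => monomial 6^-1 3 y - (1 - y + monomial 2^-1 2 y - expR (- y)))
   (fun z => 1 - z + monomial 2^-1 2 z - expR (- z))) y0.
- by rewrite /monomial !expr0n/= !mulr0 oppr0 expR0 !addr0 !subrr.
- move=> x; have ? := is_derive_monomial 2^-1 1 x.
  have ? := is_derive_monomial 6^-1 2 x.
  by apply: is_derive_eq; rewrite /monomial /GRing.scale/=; field.
- by move=> x /andP[x0 _]; rewrite h1// ltW.
Qed.

Lemma expR_taylor y : `|y| <= 1 -> `|expR y - (1 + y + y ^+ 2 / 2)| <= `|y| ^+ 3.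
Proof.
have [y0|y0] := leP 0 y.
  rewrite ger0_norm// => y1.
  have /expR_taylor_pos/andP[h1 h2] : 0 <= y <= 1 by rewrite y0.
  by rewrite ler_norml; lra.
have /expR_taylor_neg/andP[] : 0 <= - y by rewrite oppr_ge0 ltW.
by rewrite (ltr0_norm y0) opprK sqrrN ler_norml => h1 h2; lra.
Qed.

(** Both functions are [1 - d^2 / 2 + d^4 / 24] up to sixth order; for the exponential the quartic
    coefficient is [1 / 8 - 1 / 12]. With [x = d^2] the rest is an inequality between polynomials on
    [0 <= x <= 1]. *)
Lemma cosBexpR_norm (d : R) : `|d| <= 1 ->
  `|cos d - expR (- (d ^+ 2 / 2 + d ^+ 4 / 12))| <= d ^+ 6.
Proof.
wlog d0 : d / 0 <= d => [h|].
  have [|d0 d1] := leP 0 d; first exact: h.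
  have := h (- d); rewrite cosN normrN.
  have -> : (- d) ^+ 2 = d ^+ 2 by ring.
  have -> : (- d) ^+ 4 = d ^+ 4 by ring.
  have -> : (- d) ^+ 6 = d ^+ 6 by ring.
  by apply => //; rewrite oppr_ge0 ltW.
rewrite ger0_norm// => d1.
have y0 : 0 <= d ^+ 2 / 2 + d ^+ 4 / 12.
  by rewrite addr_ge0// divr_ge0// exprn_ge0.
have /andP[h1 h2] := expR_taylor_neg y0.
have h3 := cos_ge6 d0; have h4 := cos_le4 d.
have d2 : d ^+ 2 <= 1 by rewrite exprn_ile1.
have e4 : d ^+ 4 = d ^+ 2 * d ^+ 2 by ring.
have e6 : d ^+ 6 = d ^+ 2 * d ^+ 2 * d ^+ 2 by ring.
have := sqr_ge0 d.
rewrite ler_norml; move: h1 h2 h3 h4 d2; rewrite e4 e6; set x := d ^+ 2.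
set E := expR _; set c := cos d => h1 h2 h3 h4 d2 x0.
have x3 : 0 <= x * x * x by rewrite !mulr_ge0.
have x4 : x * x * x * x <= x * x * x by rewrite ler_piMr.
have x40 : 0 <= x * x * x * x by rewrite !mulr_ge0.
have x5 : x * x * x * x * x <= x * x * x * x by rewrite ler_piMr.
have x50 : 0 <= x * x * x * x * x by rewrite !mulr_ge0.
have x6 : x * x * x * x * x * x <= x * x * x * x * x by rewrite ler_piMr.
have e3 : (x / 2 + x * x / 12) ^+ 3 = x * x * x / 8 + x * x * x * x / 16 + x * x * x * x * x / 96
    + x * x * x * x * x * x / 1728 by field.
have e2 : (x / 2 + x * x / 12) ^+ 2 = x * x / 4 + x * x * x / 12 + x * x * x * x / 144 by field.
rewrite e3 e2 in h2; rewrite e2 in h1.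
by apply/andP; split; lra.
Qed.

Lemma atan_norm (x : R) : `|atan x - x| <= `|x| ^+ 3.
Proof.
wlog x0 : x / 0 <= x => [h|].
  have [|x0] := leP 0 x; first exact: h.
  have := h (- x); rewrite atanN -opprD !normrN; apply.
  by rewrite oppr_ge0 ltW.
have h1 : 0 <= x - atan x.
  apply: (@derive_ge0_ge0 (fun x => x - atan x) (fun x => 1 - (1 + x ^+ 2)^-1)) x0.
  - by rewrite atan0 subrr.
  - move=> y _; rewrite subr_ge0 invf_le1; last by rewrite ltr_wpDr ?sqr_ge0.
    by rewrite lerDl sqr_ge0.
have h2 : 0 <= atan x - x + monomial 3^-1 3 x.
  apply: (@derive_ge0_ge0 (fun x => atan x - x + monomial 3^-1 3 x)
     (fun x => (1 + x ^+ 2)^-1 - (1 - x ^+ 2))) x0.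
  - by rewrite atan0 /monomial expr0n/= mulr0 subrr addr0.
  - move=> y; have ? := is_derive_monomial 3^-1 2 y.
    by apply: is_derive_eq; field; rewrite gt_eqF// ltr_wpDr ?sqr_ge0.
  - move=> y _; have y2 := sqr_ge0 y.
    have p : 0 < 1 + y ^+ 2 by rewrite ltr_wpDr.
    rewrite subr_ge0 -[leRHS]mul1r ler_pdivlMr//; nra.
have : 0 <= x ^+ 3 by rewrite exprn_ge0.
move: h2; rewrite /monomial (ger0_norm x0) ler_norml => h2 h3.
by apply/andP; split; lra.
Qed.

End elementary_bounds.

(** * Big-O estimates uniform in a parameter *)

Section uniform_bigO.
Context (R : realType) (P : Type) (eps : P -> R) (eps_ge0 : forall p, 0 <= eps p).
Implicit Types (f g : P -> R) (k : nat).

(** [C] and [d] do not depend on [p]. As [P] will carry the base point besides [s] and [t], the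
    estimates are uniform in the base point and can be integrated over the torus. *)
Definition isO k f := exists C d : R, [/\ 0 <= C, 0 < d &
  forall p, eps p <= d -> `|f p| <= C * eps p ^+ k].

Lemma isO_ext k f g : f =1 g -> isO k f -> isO k g.
Proof. by move=> /funext ->. Qed.

Lemma isO_weaken k k' f : isO k f -> (k' <= k)%N -> isO k' f.
Proof.
move=> [C [d [C0 d0 fC]]] k'k; exists C, (Num.min d 1); split => //.
  by rewrite lt_min d0 ltr01.
move=> p; rewrite le_min => /andP[pd p1]; apply: (le_trans (fC p pd)).
by rewrite ler_wpM2l// ler_wiXn2l.
Qed.

Lemma isO_bounded f C : (forall p, `|f p| <= C) -> isO 0 f.
Proof.
move=> fC; exists `|C|, 1; split => // p _.
by rewrite expr0 mulr1; exact: le_trans (fC p) (ler_norm _).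
Qed.

Lemma isO_cst c : isO 0 (fun=> c).
Proof. exact: (@isO_bounded _ `|c|). Qed.

Lemma isO_eps f : (forall p, 0 <= f p <= eps p) -> isO 1 f.
Proof.
move=> fe; exists 1, 1; split => // p _; have /andP[f0 fp] := fe p.
by rewrite mul1r expr1 ger0_norm.
Qed.

Lemma isO_dominated k f g C d : 0 < d ->
  (forall p, eps p <= d -> `|f p| <= C * `|g p|) -> isO k g -> isO k f.
Proof.
move=> d0 fg [C' [d' [C'0 d'0 gC]]]; exists (`|C| * C'), (Num.min d d'); split => //.
- by rewrite mulr_ge0.
- by rewrite lt_min d0.
- move=> p; rewrite le_min => /andP[pd pd']; apply: (le_trans (fg p pd)).
  rewrite -mulrA; apply: (@le_trans _ _ (`|C| * `|g p|)).
    by rewrite ler_wpM2r// ler_norm.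
  by rewrite ler_wpM2l// gC.
Qed.

Lemma isO_N k f : isO k f -> isO k (fun p => - f p).
Proof. by apply: (@isO_dominated _ _ _ 1 1) => // p _; rewrite normrN mul1r. Qed.

Lemma isO_D k k' f g : isO k f -> isO k' g -> isO (minn k k') (fun p => f p + g p).
Proof.
move=> /isO_weaken/(_ (geq_minl k k'))[C [d [C0 d0 fC]]].
move=> /isO_weaken/(_ (geq_minr k k'))[C' [d' [C'0 d'0 gC]]].
exists (C + C'), (Num.min d d'); split; [exact: addr_ge0|by rewrite lt_min d0|].
move=> p; rewrite le_min => /andP[pd pd']; apply: (le_trans (ler_normD _ _)).
by rewrite mulrDl lerD ?fC ?gC.
Qed.

Lemma isO_M k k' f g : isO k f -> isO k' g -> isO (k + k') (fun p => f p * g p).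
Proof.
move=> [C [d [C0 d0 fC]]] [C' [d' [C'0 d'0 gC]]].
exists (C * C'), (Num.min d d'); split; [exact: mulr_ge0|by rewrite lt_min d0|].
move=> p; rewrite le_min => /andP[pd pd'].
by rewrite normrM exprD mulrACA ler_pM ?fC ?gC.
Qed.

Lemma isO_X k f m : isO k f -> isO (k * m) (fun p => f p ^+ m).
Proof.
move=> [C [d [C0 d0 fC]]]; exists (C ^+ m), d; split => //; first exact: exprn_ge0.
move=> p pd; rewrite normrX exprM -exprMn.
by apply: lerXn2r; rewrite ?nnegrE ?mulr_ge0 ?exprn_ge0// fC.
Qed.

Lemma isO_sum k (I : finType) (F : I -> P -> R) :
  (forall i, isO k (F i)) -> isO k (fun p => \sum_i F i p).
Proof.
move=> OF.
suff H (r : seq I) : isO k (fun p => \sum_(i <- r) F i p) by exact: H.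
elim: r => [|i r ih].
  apply: (isO_ext (f := fun=> 0)) => [p|]; first by rewrite big_nil.
  by exists 0, 1; split => // p _; rewrite mul0r normr0.
apply: (isO_ext (f := fun p => F i p + \sum_(j <- r) F j p)) => [p|].
  by rewrite big_cons.
by rewrite -[k]minnn; apply: isO_D.
Qed.

Lemma isO_sqr k f : isO (k * 2) (fun p => f p ^+ 2) -> isO k f.
Proof.
move=> [C [d [C0 d0 fC]]]; exists (Num.sqrt C), d; split => // p pd.
have h0 : 0 <= Num.sqrt C * eps p ^+ k by rewrite mulr_ge0 ?sqrtr_ge0 ?exprn_ge0.
rewrite -ler_sqr ?nnegrE// real_normK ?num_real//.
by have := fC p pd; rewrite exprMn sqr_sqrtr// exprM normrX real_normK ?num_real.
Qed.

Lemma isO_small k f c : isO k.+1 f -> 0 < c ->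
  exists2 d : R, 0 < d & forall p, eps p <= d -> `|f p| <= c.
Proof.
move=> /isO_weaken/(_ (ltn0Sn k))[C [d [C0 d0 fC]]] c0.
exists (Num.min d (c / (C + 1))).
  by rewrite lt_min d0 divr_gt0// ltr_wpDl.
move=> p; rewrite le_min => /andP[pd]; rewrite ler_pdivlMr ?ltr_wpDl// => pc.
apply: (le_trans (fC p pd)); rewrite expr1; apply: le_trans pc.
by rewrite mulrC ler_wpM2l// lerDl.
Qed.

(** In the [congO] lemmas, [isO k] of a difference acts as a congruence modulo terms of order [k].
    Products respect it once [x] and [y'] are bounded. *)
Lemma congO_M k (x x' y y' : P -> R) : isO k (fun p => x p - x' p) ->
    isO k (fun p => y p - y' p) -> isO 0 x -> isO 0 y' ->
  isO k (fun p => x p * y p - x' p * y' p).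
Proof.
move=> xx yy x0 y0.
apply: (isO_ext (f := fun p => x p * (y p - y' p) + (x p - x' p) * y' p)) => [p|].
  by ring.
have := isO_D (isO_M x0 yy) (isO_M xx y0).
by rewrite add0n addn0 minnn.
Qed.

Lemma congO_trans k (x y z : P -> R) : isO k (fun p => x p - y p) ->
  isO k (fun p => y p - z p) -> isO k (fun p => x p - z p).
Proof.
move=> xy yz; apply: (isO_ext (f := fun p => (x p - y p) + (y p - z p))) => [p|].
  by ring.
by rewrite -[k]minnn; exact: isO_D.
Qed.

Lemma isO_of_congO k (x y : P -> R) : isO k (fun p => x p - y p) -> isO k y -> isO k x.
Proof.
move=> xy y0; apply: (isO_ext (f := fun p => (x p - y p) + y p)) => [p|].
  by rewrite subrK.
by rewrite -[k]minnn; exact: isO_D.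
Qed.

Lemma congO_expR k f : isO k.+1 f ->
  isO (k.+1 * 3) (fun p => expR (f p) - (1 + f p + f p ^+ 2 / 2)).
Proof.
move=> Of; have [d d0 fd] := isO_small Of (@ltr01 R).
apply: (isO_dominated (C := 1) d0); last exact: isO_X Of.
by move=> p pd; rewrite mul1r normrX expR_taylor// fd.
Qed.

Lemma congO_inv f : isO 1 f ->
  isO 2 (fun p => (1 + f p)^-1 - (1 - f p)) /\ isO 0 (fun p => (1 + f p)^-1).
Proof.
move=> Of; have [d d0 fd] := isO_small Of (@ltr01 R).
have {fd d d0} [d d0 fd] : exists2 d : R, 0 < d & forall p, eps p <= d -> 1 / 2 <= 1 + f p.
  have h : 0 < 1 / 2 :> R by lra.
  have [d' d'0 fd'] := isO_small Of h.
  by exists d' => // p /fd'; rewrite ler_norml => /andP[]; lra.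
have O0 : isO 0 (fun p => (1 + f p)^-1).
  apply: (isO_dominated (C := 2) d0 _ (isO_cst 1)) => p /fd h.
  have p0 : 0 < 1 + f p by lra.
  rewrite normr1 mulr1 gtr0_norm ?invr_gt0//.
  by rewrite invf_ple ?posrE//; lra.
split => //.
apply: (isO_dominated (C := 1) d0 (g := fun p => f p ^+ 2 * (1 + f p)^-1)); last first.
  exact: (isO_M (isO_X 2 Of) O0).
move=> p /fd h; rewrite mul1r le_eqVlt; apply/orP; left; apply/eqP; congr `|_|.
by field; lra.
Qed.

End uniform_bigO.

(** [bigO] reads the order of an expression off its syntax, takes the orders of the atoms from the
    context, and compares the result with the order asked for. It sees no cancellation: an
    expression that is small by cancellation must first be rewritten as a sum of visibly small
    pieces, which is the purpose of most [isO_ext] steps. *)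
Ltac bigO_hyp := match goal with
  | H : isO _ _ ?f |- isO _ _ ?g => constr_eq f g; exact H
  | H : isO _ _ ?f |- isO _ _ (fun p => ?f p) => exact H
  end.
Ltac bigO_atom := first [ eassumption | apply isO_cst |
  match goal with H : forall i, @isO _ _ _ _ _ |- _ => eapply H end |
  match goal with H : forall i j, @isO _ _ _ _ _ |- _ => eapply H end ].
Ltac bigO_rec := first [ bigO_hyp | lazymatch goal with
  | |- isO _ _ (fun p => - @?f p) => eapply isO_N; bigO_rec
  | |- isO _ _ (fun p => @?f p + @?g p) => eapply isO_D; [eassumption|bigO_rec|bigO_rec]
  | |- isO _ _ (fun p => @?f p * @?g p) => eapply isO_M; bigO_rec
  | |- isO _ _ (fun p => @?f p ^+ _) => eapply isO_X; [eassumption|bigO_rec]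
  | |- isO _ _ (fun p => \sum_i _) => eapply isO_sum; [ eassumption | move=> ?; bigO_rec]
  | _ => bigO_atom end ].
Ltac bigO := eapply isO_weaken; [eassumption | bigO_rec | by []].

(** * The displacement of the cone exponential *)

Section dotv_theory.
Context (R : realType) (n : nat).
Implicit Types u v w : 'rV[R]_n.

Lemma dotvC u v : dotv u v = dotv v u.
Proof. by apply: eq_bigr => i _; rewrite mulrC. Qed.

Lemma dotvDl u v w : dotv (u + v) w = dotv u w + dotv v w.
Proof. by rewrite -big_split; apply: eq_bigr => i _; rewrite mxE mulrDl. Qed.

Lemma dotvZl c u w : dotv (c *: u) w = c * dotv u w.
Proof. by rewrite mulr_sumr; apply: eq_bigr => i _; rewrite mxE mulrA. Qed.

Lemma dotvDr u v w : dotv w (u + v) = dotv w u + dotv w v.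
Proof. by rewrite !(dotvC w) dotvDl. Qed.

Lemma dotvZr c u w : dotv w (c *: u) = c * dotv w u.
Proof. by rewrite !(dotvC w) dotvZl. Qed.

Lemma dotvNl u w : dotv (- u) w = - dotv u w.
Proof. by rewrite -scaleN1r dotvZl mulN1r. Qed.

Lemma dotvNr u w : dotv w (- u) = - dotv w u.
Proof. by rewrite !(dotvC w) dotvNl. Qed.

Lemma dotvv_ge0 u : 0 <= dotv u u.
Proof. by apply: sumr_ge0 => i _; rewrite -expr2 sqr_ge0. Qed.

Lemma normv_sqr u : normv u ^+ 2 = dotv u u.
Proof. by rewrite sqr_sqrtr// dotvv_ge0. Qed.

Lemma normv_ge0 u : 0 <= normv u.
Proof. exact: sqrtr_ge0. Qed.

Lemma normv_eq0 u : normv u = 0 -> u = 0.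
Proof.
move=> u0; have := normv_sqr u; rewrite u0 expr0n/= => /esym/psumr_eq0P h.
apply/rowP => i; rewrite mxE; apply/eqP; rewrite -sqrf_eq0 expr2; apply/eqP.
by apply: h => // j _; rewrite -expr2 sqr_ge0.
Qed.

Lemma sqr_coord_le u i : u 0 i ^+ 2 <= dotv u u.
Proof.
rewrite /dotv (bigD1 i)//= -expr2 lerDl; apply: sumr_ge0 => j _.
by rewrite -expr2 sqr_ge0.
Qed.

End dotv_theory.

Section displacement.
Context (R : realType) (n : nat).
Implicit Types (A : R) (w : 'rV[R]_n).

(** The motion of the base point under [cone_exp] from radius 1, with [A = 1 + 2 s f] and [w] the
    gradient of [s f]. For [w = 0] the value is [0], so the case distinction of [cone_exp]
    disappears. *)
Definition disp A w : 'rV[R]_n := (atan (normv w / A) / normv w) *: w.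

Lemma dotv_disp A w : dotv (disp A w) (disp A w) = atan (normv w / A) ^+ 2.
Proof.
rewrite dotvZl dotvZr -normv_sqr; have [w0|w0] := eqVneq (normv w) 0.
  by rewrite w0 !mul0r atan0 expr0n/= !mulr0.
by field.
Qed.

Lemma disp_approx A w i : 0 < A ->
  `|disp A w 0 i - w 0 i / A| <= `|w 0 i / A| * (normv w / A) ^+ 2.
Proof.
move=> A0; rewrite mxE; have [w0|w0] := eqVneq (normv w) 0.
  by rewrite (normv_eq0 w0) !mxE !(mulr0,mul0r) subrr normr0 mul0r.
have -> : atan (normv w / A) / normv w * w 0 i - w 0 i / A =
    (atan (normv w / A) - normv w / A) * (w 0 i / normv w).
  by field; rewrite w0 gt_eqF.
have wA : 0 <= normv w / A by rewrite divr_ge0 ?normv_ge0// ltW.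
rewrite normrM; apply: le_trans (_ : (normv w / A) ^+ 3 * `|w 0 i / normv w| <= _).
  by rewrite ler_wpM2r// (le_trans (atan_norm _))// ger0_norm.
rewrite !normrM !normfV (ger0_norm (normv_ge0 w)) (gtr0_norm A0) le_eqVlt.
by apply/orP; left; apply/eqP; field; rewrite w0 gt_eqF.
Qed.

(** In the plane, the point with Cartesian coordinates [(A, |w|)] has radius [sqrt (A^2 + |w|^2)]
    and angle [atan (|w| / A)]; its abscissa is [A]. *)
Lemma sqrt_cos_disp A w : 0 < A ->
  Num.sqrt (A ^+ 2 + dotv w w) * cos (atan (normv w / A)) = A.
Proof.
move=> A0; rewrite cos_atan.
have -> : A ^+ 2 + dotv w w = A ^+ 2 * (1 + (normv w / A) ^+ 2).
  by rewrite -normv_sqr; field; rewrite gt_eqF.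
rewrite sqrtrM ?sqr_ge0// sqrtr_sqr gtr0_norm// mulfK// gt_eqF// sqrtr_gt0.
by rewrite ltr_wpDr// sqr_ge0.
Qed.

End displacement.

Section displacement_bigO.
Context (R : realType) (n : nat) (P : Type) (eps : P -> R)
  (eps_ge0 : forall p, 0 <= eps p).
Context (s f : P -> R) (g : P -> 'rV[R]_n) (sO : isO eps 1 s) (fO : isO eps 0 f)
  (gO : forall i, isO eps 0 (fun p => g p 0 i)).

Let A p := 1 + 2 * (s p * f p).
Let d p := disp (A p) (s p *: g p).
Let G p := dotv (g p) (g p).

Lemma isO_dotvg : isO eps 0 G.
Proof. by rewrite /G /dotv; bigO. Qed.
Let GO := isO_dotvg.

Lemma mass_factor_near1 : exists2 e : R, 0 < e & forall p, eps p <= e -> 1 / 2 <= A p <= 2.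
Proof.
have h : isO eps 1 (fun p => 2 * (s p * f p)) by bigO.
have h0 : 0 < 1 / 2 :> R by lra.
have [e e0 he] := isO_small eps_ge0 h h0.
by exists e => // p /he; rewrite /A ler_norml => /andP[h1 h2]; apply/andP; split; lra.
Qed.

(** The arctangent differs from its argument at third order, and [1 / (1 + 2 s f)] from [1 - 2 s f]
    at second order, which the prefactor [s] raises to third. *)
Lemma congO_disp i : isO eps 3 (fun p => d p 0 i - s p * (1 - 2 * (s p * f p)) * g p 0 i).
Proof.
have h : isO eps 1 (fun p => 2 * (s p * f p)) by bigO.
have [h1 h2] := congO_inv eps_ge0 h.
have [e e0 he] := mass_factor_near1.
apply: (@congO_trans _ _ _ eps_ge0 3 (fun p => d p 0 i) (fun p => s p * g p 0 i / A p)
    (fun p => s p * (1 - 2 * (s p * f p)) * g p 0 i)).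
  apply: (isO_dominated (C := 1) e0 (g := fun p => (s p * g p 0 i / A p) * (s p ^+ 2 * G p / A p ^+ 2))).
    move=> p pe; have /andP[A1 A2] := he _ pe.
    have A0 : 0 < A p by lra.
    have nn : 0 <= s p ^+ 2 * G p / A p ^+ 2.
      by apply: divr_ge0; rewrite ?sqr_ge0// mulr_ge0 ?sqr_ge0 ?dotvv_ge0.
    have := @disp_approx _ _ (A p) (s p *: g p) i A0.
    rewrite mul1r expr_div_n normv_sqr dotvZl dotvZr mulrA -expr2.
    have -> : (s p *: g p) 0 i = s p * g p 0 i by rewrite mxE.
    by rewrite (normrM (s p * g p 0 i / A p)) (ger0_norm nn).
  rewrite /A; apply: (isO_ext (f := fun p => s p * g p 0 i * (1 + 2 * (s p * f p))^-1 * (s p ^+ 2 * G p * (1 + 2 * (s p * f p))^-1 ^+ 2))).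
    by move=> p; rewrite exprVn.
  by bigO.
rewrite /A; apply: (isO_ext (f := fun p => s p * g p 0 i * ((1 + 2 * (s p * f p))^-1 - (1 - 2 * (s p * f p))))).
  by move=> p; ring.
by bigO.
Qed.

Lemma isO_disp i : isO eps 1 (fun p => d p 0 i).
Proof.
apply: (isO_of_congO eps_ge0); first exact: (isO_weaken eps_ge0 (congO_disp i)).
by bigO.
Qed.

Lemma congO_dotv_disp : isO eps 3 (fun p => dotv (d p) (d p) - s p ^+ 2 * G p).
Proof.
apply: (isO_ext (f := fun p => \sum_i (d p 0 i - s p * g p 0 i) * (d p 0 i + s p * g p 0 i))).
  move=> p; rewrite /G /dotv mulr_sumr -sumrB; apply: eq_bigr => i _; ring.
have h i : isO eps 2 (fun p => d p 0 i - s p * g p 0 i).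
  apply: (isO_ext (f := fun p => (d p 0 i - s p * (1 - 2 * (s p * f p)) * g p 0 i) - 2 * s p ^+ 2 * f p * g p 0 i)).
    by move=> p; ring.
  by have h := congO_disp i; bigO.
by apply: (isO_sum eps_ge0) => i; have h1 := h i; have h2 := isO_disp i; bigO.
Qed.

Lemma isO_dotv_disp : isO eps 2 (fun p => dotv (d p) (d p)).
Proof.
by apply: (isO_of_congO eps_ge0); [exact: (isO_weaken eps_ge0 congO_dotv_disp)|bigO].
Qed.

Let r p := Num.sqrt (A p ^+ 2 + s p ^+ 2 * G p).

Lemma sqr_mass_radius p : r p ^+ 2 = A p ^+ 2 + s p ^+ 2 * G p.
Proof. by rewrite sqr_sqrtr// addr_ge0 ?sqr_ge0// mulr_ge0 ?sqr_ge0 ?dotvv_ge0. Qed.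

Lemma isO_mass_radius : isO eps 0 r.
Proof.
apply: (isO_sqr eps_ge0); apply: (isO_ext (f := fun p => A p ^+ 2 + s p ^+ 2 * G p)).
  by move=> p; rewrite sqr_mass_radius.
by rewrite /A; bigO.
Qed.

(** With the cosine of [|d|] in place of the exponential this is an exact identity, [sqrt_cos_disp];
    exchanging the two costs [|d|^6]. Thus a radius times its own exponential factor is affine in
    [s] up to sixth order. *)
Lemma congO_mass_radius : isO eps 6 (fun p =>
  r p * expR (- (dotv (d p) (d p) / 2 + dotv (d p) (d p) ^+ 2 / 12)) - A p).
Proof.
have [e e0 he] := mass_factor_near1.
have [e' e'0 he'] := isO_small eps_ge0 isO_dotv_disp (@ltr01 R).
have rO := isO_mass_radius; have dO := isO_dotv_disp.
apply: (isO_dominated (C := 1) (d := Num.min e e') _ (g := fun p => r p * dotv (d p) (d p) ^+ 3)).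
- by rewrite lt_min e0.
- move=> p; rewrite le_min => /andP[/he /andP[A1 A2] /he'].
  have A0 : 0 < A p by lra.
  have r0 : 0 <= r p by exact: sqrtr_ge0.
  have := @sqrt_cos_disp _ _ (A p) (s p *: g p) A0.
  rewrite dotvZl dotvZr mulrA -expr2 -/(G p) -/(r p) => rA.
  rewrite dotv_disp; set a := atan _ in rA *.
  rewrite normrX expr_le1// => a1'.
  rewrite -rA -mulrBr !(normrM (r p)) (ger0_norm r0) mul1r ler_wpM2l// distrC.
  have a6 : 0 <= a ^+ 6 by rewrite -[6%N]/(3 * 2)%N exprM sqr_ge0.
  by rewrite -!exprM (ger0_norm a6) cosBexpR_norm.
- by bigO.
Qed.

End displacement_bigO.

(** * Functions with a uniform first-order Taylor expansion *)

Section taylor.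
Context (R : realType) (n : nat).
Implicit Types (f : 'rV[R]_n -> R) (g : 'I_n -> 'rV[R]_n -> R) (u v : 'rV[R]_n).

Definition taylor_rem f g v u := f (v + u) - f v - \sum_i g i v * u 0 i.

(** The constant serves all [u], not only small ones, because the supremum in the dual pair runs
    over all of [R^n]. The last clause is a Lipschitz bound in squared form; it controls the product
    of two increments, which is the extra term in the remainder of a product. *)
Definition T2 f g := exists2 C : R, 0 <= C & forall v,
  [/\ `|f v| <= C, (forall i, `|g i v| <= C),
      (forall u, `|taylor_rem f g v u| <= C * dotv u u) &
      (forall u, (f (v + u) - f v) ^+ 2 <= C * dotv u u)].

Lemma T2_M f1 f2 g1 g2 : T2 f1 g1 -> T2 f2 g2 ->
  T2 (fun v => f1 v * f2 v) (fun i v => f1 v * g2 i v + f2 v * g1 i v).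
Proof.
move=> [C1 C10 h1] [C2 C20 h2].
have C12 : 0 <= C1 * C2 by rewrite mulr_ge0.
have C112 : 0 <= C1 ^+ 2 * C2 by rewrite mulr_ge0 ?sqr_ge0.
have C122 : 0 <= C1 * C2 ^+ 2 by rewrite mulr_ge0 ?sqr_ge0.
set C := 2 * (C1 * C2) + C1 + C2 + 2 * (C1 ^+ 2 * C2) + 2 * (C1 * C2 ^+ 2).
have CC : [/\ C1 * C2 <= C, 2 * (C1 * C2) <= C, 2 * (C1 * C2) + C1 + C2 <= C &
    2 * (C1 ^+ 2 * C2) + 2 * (C1 * C2 ^+ 2) <= C] by rewrite /C; split; lra.
case: CC => CC1 CC2 CC3 CC4.
exists C; first by lra.
move=> v; have [f1v g1v r1 l1] := h1 v; have [f2v g2v r2 l2] := h2 v.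
split.
- by rewrite normrM; apply: le_trans CC1; rewrite ler_pM.
- move=> i; apply: le_trans CC2; apply: (le_trans (ler_normD _ _)).
  rewrite !normrM mulr_natl mulr2n; apply: lerD; first by rewrite ler_pM.
  by rewrite mulrC ler_pM.
- move=> u; have -> : taylor_rem (fun v => f1 v * f2 v) (fun i v => f1 v * g2 i v + f2 v * g1 i v) v u =
    f1 v * taylor_rem f2 g2 v u + f2 v * taylor_rem f1 g1 v u
    + (f1 (v + u) - f1 v) * (f2 (v + u) - f2 v).
    rewrite /taylor_rem.
    have -> : \sum_i (f1 v * g2 i v + f2 v * g1 i v) * u 0 i =
        f1 v * (\sum_i g2 i v * u 0 i) + f2 v * (\sum_i g1 i v * u 0 i) .
      by rewrite !mulr_sumr -big_split; apply: eq_bigr => i _ /=; ring.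
    by ring.
  have N0 := dotvv_ge0 u.
  apply: le_trans (ler_wpM2r N0 CC3).
  have -> : (2 * (C1 * C2) + C1 + C2) * dotv u u =
    C1 * (C2 * dotv u u) + C2 * (C1 * dotv u u) + (C1 * dotv u u + C2 * dotv u u) by ring.
  apply: (le_trans (ler_normD _ _)); apply: lerD.
    apply: (le_trans (ler_normD _ _)); rewrite !normrM.
    by apply: lerD; rewrite ler_pM.
  rewrite normrM; have := l1 u; have := l2 u.
  rewrite -(real_normK (num_real (f1 (v + u) - f1 v))) -(real_normK (num_real (f2 (v + u) - f2 v))).
  set x := `|_|; set y := `|_| => hx hy; have : 0 <= (x - y) ^+ 2 by rewrite sqr_ge0.
  by have := sqr_ge0 x; have := sqr_ge0 y; rewrite sqrrB; nra.
- move=> u; have N0 := dotvv_ge0 u; apply: le_trans (ler_wpM2r N0 CC4).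
  have -> : f1 (v + u) * f2 (v + u) - f1 v * f2 v =
    f1 (v + u) * (f2 (v + u) - f2 v) + f2 v * (f1 (v + u) - f1 v) by ring.
  set x := f1 (v + u) * _; set y := f2 v * _.
  have sqr_le (z c : R) : `|z| <= c -> z ^+ 2 <= c ^+ 2.
    move=> zc; rewrite -real_normK ?num_real// lerXn2r// nnegrE//.
    exact: le_trans zc.
  have hx : x ^+ 2 <= C1 ^+ 2 * C2 * dotv u u.
    have -> : C1 ^+ 2 * C2 * dotv u u = C1 ^+ 2 * (C2 * dotv u u) by ring.
    rewrite exprMn; apply: ler_pM; rewrite ?sqr_ge0//.
    by apply: sqr_le; case: (h1 (v + u)).
  have hy : y ^+ 2 <= C1 * C2 ^+ 2 * dotv u u.
    have -> : C1 * C2 ^+ 2 * dotv u u = C2 ^+ 2 * (C1 * dotv u u) by ring.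
    by rewrite exprMn; apply: ler_pM; rewrite ?sqr_ge0// sqr_le.
  have := sqr_ge0 (x - y); rewrite sqrrB sqrrD; lra.
Qed.

Lemma T2_cst c : T2 (fun=> c) (fun _ _ => 0).
Proof.
exists `|c| => // v; split => // [i|u|u].
- by rewrite normr0.
- rewrite /taylor_rem subrr sub0r normrN big1 ?normr0 ?mulr_ge0 ?dotvv_ge0//.
  by move=> i _; rewrite mul0r.
- by rewrite subrr expr0n/= mulr_ge0// dotvv_ge0.
Qed.

Lemma T2_coord (h h' : R -> R) C (p : 'I_n) : 
  (forall y, `|h y| <= C) -> (forall y, `|h' y| <= C) ->
  (forall y x, `|h (y + x) - h y - h' y * x| <= C * x ^+ 2) ->
  (forall y x, (h (y + x) - h y) ^+ 2 <= C * x ^+ 2) ->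
  T2 (fun v => h (v 0 p)) (fun i v => if i == p then h' (v 0 p) else 0).
Proof.
move=> hC h'C hr hl; have C0 : 0 <= C by exact: le_trans (normr_ge0 _) (hC 0).
exists C => // v; split => // [i|u|u].
- by case: ifP => // _; rewrite normr0.
- have -> : taylor_rem (fun v => h (v 0 p)) (fun i v => if i == p then h' (v 0 p) else 0) v u =
      h (v 0 p + u 0 p) - h (v 0 p) - h' (v 0 p) * u 0 p.
    rewrite /taylor_rem mxE (bigD1 p)//= eqxx big1 ?addr0// => i /negbTE ->.
    by rewrite mul0r.
  by apply: (le_trans (hr _ _)); rewrite ler_wpM2l// sqr_coord_le.
- by rewrite mxE; apply: (le_trans (hl _ _)); rewrite ler_wpM2l// sqr_coord_le.
Qed.

Lemma T2_eqg f g g' : (forall i v, g i v = g' i v) -> T2 f g -> T2 f g'.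
Proof. by move=> gg'; have -> : g' = g by apply/funext=> i; apply/funext=> v. Qed.

Section at_point.
Context (P : Type) (eps : P -> R) (eps_ge0 : forall p, 0 <= eps p).
Context (v b : P -> 'rV[R]_n) (bO : forall i, isO eps 1 (fun p => b p 0 i)).
Context f g (fg : T2 f g).

Lemma T2_isO (w : P -> 'rV[R]_n) : isO eps 0 (fun p => f (w p)).
Proof. by have [C C0 h] := fg; apply: (@isO_bounded _ _ _ _ C) => p; case: (h (w p)). Qed.

Lemma T2_isO_grad (w : P -> 'rV[R]_n) i : isO eps 0 (fun p => g i (w p)).
Proof.
by have [C C0 h] := fg; apply: (@isO_bounded _ _ _ _ C) => p; case: (h (w p)) => _.
Qed.

Lemma T2_congO1 : isO eps 1 (fun p => f (v p + b p) - f (v p)).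
Proof.
apply: (isO_sqr eps_ge0); have [C C0 h] := fg.
apply: (isO_dominated (C := C) (d := 1) _ (g := fun p => dotv (b p) (b p))) => //.
  move=> p _; have [_ _ _ l] := h (v p).
  by rewrite (ger0_norm (sqr_ge0 _)) (ger0_norm (dotvv_ge0 _)); exact: l.
by rewrite /dotv; bigO.
Qed.

Lemma T2_congO2 :
  isO eps 2 (fun p => f (v p + b p) - (f (v p) + \sum_i g i (v p) * b p 0 i)).
Proof.
have [C C0 h] := fg.
apply: (isO_dominated (C := C) (d := 1) _ (g := fun p => dotv (b p) (b p))) => //.
  move=> p _; have [_ _ r _] := h (v p).
  by rewrite opprD addrA (ger0_norm (dotvv_ge0 _)); exact: r.
by rewrite /dotv; bigO.
Qed.
End at_point.
End taylor.

(** * Expansion of the transport and dual costs *)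

(* The arguments in which the estimates below are uniform. *)
Record param (R : realType) (n : nat) := Param {
  par_s : R; par_t : R; par_v : 'rV[R]_n; par_s_gt0 : 0 < par_s; par_t_gt0 : 0 < par_t }.

Section expansion.
Context (R : realType) (n : nat).
Local Notation V := 'rV[R]_n.
Implicit Types u v : V.
Context (phi : V -> R) (phi1 : 'I_n -> V -> R) (phi2 : 'I_n -> 'I_n -> V -> R).
Context (psi : V -> R) (psi1 : 'I_n -> V -> R) (psi2 : 'I_n -> 'I_n -> V -> R).
Context (psi3 : 'I_n -> 'I_n -> 'I_n -> V -> R).
Context (Tphi : T2 phi phi1) (Tphi1 : forall i, T2 (phi1 i) (phi2 i))
  (Tpsi : T2 psi psi1) (Tpsi1 : forall i, T2 (psi1 i) (psi2 i))
  (Tpsi2 : forall i j, T2 (psi2 i j) (psi3 i j)).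
Context (orth1 : forall i v, phi1 i v * psi1 i v = 0)
  (orth2 : forall i j v, phi2 i j v * psi1 j v = 0)
  (sym2 : forall i j v, psi2 i j v = psi2 j i v).

Definition gradrow (f1 : 'I_n -> V -> R) v : V := \row_i f1 i v.

Definition potential s t v : R :=
  2 * s * phi v - 2 * s ^+ 2 * phi v ^+ 2 - 2 * t * psi v + 2 * t ^+ 2 * psi v ^+ 2
  + t ^+ 2 * \sum_i psi1 i v ^+ 2.

Definition potential_grad s t j v : R :=
  2 * s * phi1 j v - 4 * s ^+ 2 * (phi v * phi1 j v) - 2 * t * psi1 j v
  + 4 * t ^+ 2 * (psi v * psi1 j v) + 2 * t ^+ 2 * \sum_i psi1 i v * psi2 i j v.

Definition dual_cost s t v u : R :=
  dotv (u - v) (u - v) + dotv (u - v) (u - v) ^+ 2 / 6 + potential s t u.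

(** The squared radius that [cone_exp] reaches from radius 1 over [v]. *)
Definition mass f (f1 : 'I_n -> V -> R) s v : R :=
  (1 + 2 * (s * f v)) ^+ 2 + s ^+ 2 * dotv (gradrow f1 v) (gradrow f1 v).

Definition exp_shift f (f1 : 'I_n -> V -> R) s v : V :=
  disp (1 + 2 * (s * f v)) (s *: gradrow f1 v).

Definition HK_density s t v : R :=
  4 * (s * phi v - t * psi v) ^+ 2 + s ^+ 2 * dotv (gradrow phi1 v) (gradrow phi1 v)
  + t ^+ 2 * dotv (gradrow psi1 v) (gradrow psi1 v)
  + s ^+ 2 * t ^+ 2 * dotv (gradrow phi1 v) (gradrow phi1 v)
     * dotv (gradrow psi1 v) (gradrow psi1 v) / 3.

(** The potential is semiconvex with a constant of order [s + t]. For small [s + t] the quadratic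
    part of the transport cost therefore dominates, and one approximate critical point controls the
    cost at every [u], however far away. *)
Lemma potential_taylor : exists2 C : R, 0 <= C & forall s t v u, 0 <= s -> 0 <= t ->
  s + t <= 1 ->
  - (C * (s + t) * dotv u u) <= taylor_rem (potential s t) (potential_grad s t) v u.
Proof.
have cs (s t : R) : 0 <= s -> 0 <= t -> s + t <= 1 ->
  [/\ 0 <= 2 * s /\ 2 * s <= 2 * (s + t), 0 <= 2 * t /\ 2 * t <= 2 * (s + t),
      0 <= 2 * s ^+ 2 /\ 2 * s ^+ 2 <= 2 * (s + t),
      0 <= 2 * t ^+ 2 /\ 2 * t ^+ 2 <= 2 * (s + t) & t ^+ 2 <= 1 * (s + t)].
  by move=> s0 t0 st; rewrite !expr2; split; [split|split|split|split|]; nra.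
have [C1 C10 h1] := Tphi; have [C2 C20 h2] := T2_M Tphi Tphi.
have [C3 C30 h3] := Tpsi; have [C4 C40 h4] := T2_M Tpsi Tpsi.
have /choice[C5 h5] : forall i, exists C : R, 0 <= C /\ forall v u, `|taylor_rem
    (fun v => psi1 i v * psi1 i v) (fun j v => psi1 i v * psi2 i j v + psi1 i v * psi2 i j v) v u|
    <= C * dotv u u.
  move=> i; have [C C0 h] := T2_M (Tpsi1 i) (Tpsi1 i).
  by exists C; split => // v u; case: (h v).
exists (2 * C1 + 2 * C2 + 2 * C3 + 2 * C4 + \sum_i C5 i).
  rewrite addr_ge0// ?sumr_ge0//; last by move=> i _; case: (h5 i).
  by rewrite !addr_ge0// mulr_ge0.
move=> s t v u s0 t0 st1; have N0 := dotvv_ge0 u.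
have -> : taylor_rem (potential s t) (potential_grad s t) v u =
  2 * s * taylor_rem phi phi1 v u
  - 2 * s ^+ 2 * taylor_rem (fun v => phi v * phi v) (fun i v => phi v * phi1 i v + phi v * phi1 i v) v u
  - 2 * t * taylor_rem psi psi1 v u
  + 2 * t ^+ 2 * taylor_rem (fun v => psi v * psi v) (fun i v => psi v * psi1 i v + psi v * psi1 i v) v u
  + t ^+ 2 * \sum_i taylor_rem (fun v => psi1 i v * psi1 i v) (fun j v => psi1 i v * psi2 i j v + psi1 i v * psi2 i j v) v u.
  rewrite /taylor_rem /potential.
  have -> : \sum_i potential_grad s t i v * u 0 i =
     2 * s * (\sum_i phi1 i v * u 0 i) - 2 * s ^+ 2 * (\sum_i (phi v * phi1 i v + phi v * phi1 i v) * u 0 i)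
     - 2 * t * (\sum_i psi1 i v * u 0 i) + 2 * t ^+ 2 * (\sum_i (psi v * psi1 i v + psi v * psi1 i v) * u 0 i)
     + t ^+ 2 * \sum_i \sum_j (psi1 i v * psi2 i j v + psi1 i v * psi2 i j v) * u 0 j.
    rewrite (exchange_big _ _ _ _ _ (fun i j => (psi1 i v * psi2 i j v + psi1 i v * psi2 i j v) * u 0 j)).
    rewrite !mulr_sumr -!sumrN -!big_split /=; apply: eq_bigr => j _.
    by rewrite /potential_grad -mulr_suml big_split /=; ring.
  rewrite !sumrB.
  have e w : \sum_i psi1 i w ^+ 2 = \sum_i psi1 i w * psi1 i w.
    by apply: eq_bigr => i _; rewrite expr2.
  by rewrite !e; ring.
have [_ _ /(_ u) r1 _] := h1 v; have [_ _ /(_ u) r2 _] := h2 v.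
have [_ _ /(_ u) r3 _] := h3 v; have [_ _ /(_ u) r4 _] := h4 v.
have r5 : `|\sum_i taylor_rem (fun v => psi1 i v * psi1 i v)
    (fun j v => psi1 i v * psi2 i j v + psi1 i v * psi2 i j v) v u| <= (\sum_i C5 i) * dotv u u.
  apply: (le_trans (ler_norm_sum _ _ _)); rewrite mulr_suml.
  by apply: ler_sum => i _; case: (h5 i).
set x1 := taylor_rem phi phi1 v u in r1 *; set x2 := taylor_rem _ _ v u in r2 *.
set x3 := taylor_rem psi psi1 v u in r3 *; set x4 := taylor_rem _ _ v u in r4 *.
set x5 := \sum_i taylor_rem _ _ v u in r5 *; set C6 := \sum_i _ in r5 *.
set N := dotv u u in N0 r1 r2 r3 r4 r5 *.
have bd (c x C K : R) : 0 <= c -> c <= K * (s + t) -> 0 <= K -> `|x| <= C * N -> - (K * C * (s + t) * N) <= c * x /\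
     c * x <= K * C * (s + t) * N.
  move=> c0 cK K0 xC; have : `|c * x| <= K * C * (s + t) * N.
    have -> : K * C * (s + t) * N = K * (s + t) * (C * N) by ring.
    by rewrite normrM ler_pM// ger0_norm.
  by rewrite ler_norml => /andP[].
have [[c1 c1'] [c3 c3'] [c2 c2'] [c4 c4'] c5'] := cs _ _ s0 t0 st1.
have [b1 _] := bd _ x1 C1 2 c1 c1' (ler0n R 2) r1.
have [_ b2] := bd _ x2 C2 2 c2 c2' (ler0n R 2) r2.
have [_ b3] := bd _ x3 C3 2 c3 c3' (ler0n R 2) r3.
have [b4 _] := bd _ x4 C4 2 c4 c4' (ler0n R 2) r4.
have [b5 _] := bd _ x5 C6 1 (sqr_ge0 t) c5' (ler01) r5.
have -> : (2 * C1 + 2 * C2 + 2 * C3 + 2 * C4 + C6) * (s + t) * N =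
  2 * C1 * (s + t) * N + 2 * C2 * (s + t) * N + 2 * C3 * (s + t) * N + 2 * C4 * (s + t) * N
   + 1 * C6 * (s + t) * N by ring.
clear - b1 b2 b3 b4 b5; lra.
Qed.

Local Notation P := (param R n).
Let s (p : P) : R := par_s p.
Let t (p : P) : R := par_t p.
Let v (p : P) : V := par_v p.
Let eps p := s p + t p.

Let eps_ge0 p : 0 <= eps p.
Proof. by rewrite addr_ge0// ltW// (par_s_gt0, par_t_gt0). Qed.
Let sO : isO eps 1 s.
Proof.
apply: isO_eps => p; rewrite (ltW (par_s_gt0 p)) lerDl ltW//; exact: par_t_gt0.
Qed.
Let tO : isO eps 1 t.
Proof.
apply: isO_eps => p; rewrite (ltW (par_t_gt0 p)) lerDr ltW//; exact: par_s_gt0.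
Qed.

Let A p := 1 + 2 * (s p * phi (v p)).
Let B p := 1 + 2 * (t p * psi (v p)).
Let gphi p := gradrow phi1 (v p).
Let gpsi p := gradrow psi1 (v p).
Let G p := dotv (gphi p) (gphi p).
Let H p := dotv (gpsi p) (gpsi p).
Let a p := disp (A p) (s p *: gphi p).
Let b p := disp (B p) (t p *: gpsi p).
Let F p := v p + b p.
Let D p := dotv (b p - a p) (b p - a p).

Let phiO : isO eps 0 (fun p => phi (v p)). Proof. exact: T2_isO Tphi v. Qed.
Let psiO : isO eps 0 (fun p => psi (v p)). Proof. exact: T2_isO Tpsi v. Qed.
Let gphiO i : isO eps 0 (fun p => gphi p 0 i).
Proof.
by apply: isO_ext (T2_isO_grad eps Tphi v i) => p; rewrite /gphi mxE.
Qed.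
Let gpsiO i : isO eps 0 (fun p => gpsi p 0 i).
Proof.
by apply: isO_ext (T2_isO_grad eps Tpsi v i) => p; rewrite /gpsi mxE.
Qed.
Let phi1O i : isO eps 0 (fun p => phi1 i (v p)). Proof. exact: T2_isO (Tphi1 i) v. Qed.
Let psi1O i : isO eps 0 (fun p => psi1 i (v p)). Proof. exact: T2_isO (Tpsi1 i) v. Qed.
Let psi2O i j : isO eps 0 (fun p => psi2 i j (v p)). Proof. exact: T2_isO (Tpsi2 i j) v. Qed.
Let GO : isO eps 0 G. Proof. exact: isO_dotvg. Qed.
Let HO : isO eps 0 H. Proof. exact: isO_dotvg. Qed.
Let aO i : isO eps 1 (fun p => a p 0 i). Proof. exact: isO_disp. Qed.
Let bO i : isO eps 1 (fun p => b p 0 i). Proof. exact: isO_disp. Qed.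

Let dotab p : dotv (a p) (b p) = 0.
Proof.
rewrite /a /b /disp !(dotvZl, dotvZr) /dotv big1 ?mulr0// => i _.
by rewrite !mxE orth1.
Qed.

Let DE p : D p = dotv (a p) (a p) + dotv (b p) (b p).
Proof. by rewrite /D !(dotvDl, dotvDr, dotvNl, dotvNr) (dotvC (b p) (a p)) dotab; ring. Qed.

Let alO : isO eps 2 (fun p => dotv (a p) (a p)). Proof. exact: isO_dotv_disp. Qed.
Let beO : isO eps 2 (fun p => dotv (b p) (b p)). Proof. exact: isO_dotv_disp. Qed.
Let DO : isO eps 2 D.
Proof. by apply: (isO_ext (fun p => esym (DE p))); bigO. Qed.

Let b_orth (x : V -> R) i p : (forall w, x w * psi1 i w = 0) -> x (v p) * b p 0 i = 0.
Proof.
move=> x0; rewrite /b /disp !mxE; set c := _ / _.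
by rewrite mulrCA (mulrCA (x _)) x0 !mulr0.
Qed.

(** The first-order term is [grad phi . b], which vanishes since [b] is parallel to [grad psi]. In
    the same way [phi1F] below rests on [D^2 phi . grad psi = 0]. *)
Let phiF : isO eps 2 (fun p => phi (F p) - phi (v p)).
Proof.
apply: isO_ext (T2_congO2 eps_ge0 v bO Tphi) => p; rewrite big1 ?addr0// => i _.
exact: b_orth.
Qed.

Let psiF1 : isO eps 1 (fun p => psi (F p) - psi (v p)).
Proof. exact: (T2_congO1 eps_ge0 v bO Tpsi). Qed.
Let psi1F1 i : isO eps 1 (fun p => psi1 i (F p) - psi1 i (v p)).
Proof. exact: (T2_congO1 eps_ge0 v bO (Tpsi1 i)). Qed.
Let psi2F1 i j : isO eps 1 (fun p => psi2 i j (F p) - psi2 i j (v p)).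
Proof. exact: (T2_congO1 eps_ge0 v bO (Tpsi2 i j)). Qed.

Let a3 i : isO eps 3 (fun p => a p 0 i - s p * (1 - 2 * (s p * phi (v p))) * gphi p 0 i).
Proof. exact: (congO_disp eps_ge0 sO phiO gphiO i). Qed.
Let b3 i : isO eps 3 (fun p => b p 0 i - t p * (1 - 2 * (t p * psi (v p))) * gpsi p 0 i).
Proof. exact: (congO_disp eps_ge0 tO psiO gpsiO i). Qed.

Let b2 i : isO eps 2 (fun p => b p 0 i - t p * gpsi p 0 i).
Proof.
have h := b3 i.
apply: (isO_ext (f := fun p => (b p 0 i - t p * (1 - 2 * (t p * psi (v p))) * gpsi p 0 i)
   - 2 * t p ^+ 2 * psi (v p) * gpsi p 0 i)) => [p|]; first by ring.
by bigO.
Qed.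

Let psiF : isO eps 2 (fun p => psi (F p) - (psi (v p) + t p * H p)).
Proof.
have h : isO eps 2 (fun p => psi (F p) - (psi (v p) + \sum_i psi1 i (v p) * b p 0 i)) :=
  T2_congO2 eps_ge0 v bO Tpsi.
have h' : isO eps 2 (fun p => \sum_i psi1 i (v p) * (b p 0 i - t p * gpsi p 0 i)).
  by apply: (isO_sum eps_ge0) => i; have hi := b2 i; have hi' := psi1O i; bigO.
apply: (isO_ext (f := fun p => (psi (F p) - (psi (v p) + \sum_i psi1 i (v p) * b p 0 i))
  + \sum_i psi1 i (v p) * (b p 0 i - t p * gpsi p 0 i))) => [p|]; last by bigO.
under [X in _ + X]eq_bigr do rewrite mulrBr.
rewrite sumrB; have -> : \sum_i psi1 i (v p) * (t p * gpsi p 0 i) = t p * H p.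
  by rewrite /H /dotv mulr_sumr; apply: eq_bigr => i _; rewrite /gpsi !mxE; ring.
by ring.
Qed.

Let phi1F i : isO eps 2 (fun p => phi1 i (F p) - phi1 i (v p)).
Proof.
apply: isO_ext (T2_congO2 eps_ge0 v bO (Tphi1 i)) => p; rewrite big1 ?addr0// => j _.
exact: b_orth.
Qed.

Let psi1F i : isO eps 2 (fun p => psi1 i (F p) - (psi1 i (v p) + t p * \sum_j psi2 i j (v p) * psi1 j (v p))).
Proof.
have h : isO eps 2 (fun p => psi1 i (F p) - (psi1 i (v p) + \sum_j psi2 i j (v p) * b p 0 j)) :=
  T2_congO2 eps_ge0 v bO (Tpsi1 i).
have h' : isO eps 2 (fun p => \sum_j psi2 i j (v p) * (b p 0 j - t p * gpsi p 0 j)).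
  by apply: (isO_sum eps_ge0) => j; have hj := b2 j; have hj' := psi2O i j; bigO.
apply: (isO_ext (f := fun p => (psi1 i (F p) - (psi1 i (v p) + \sum_j psi2 i j (v p) * b p 0 j))
  + \sum_j psi2 i j (v p) * (b p 0 j - t p * gpsi p 0 j))) => [p|]; last by bigO.
under [X in _ + X]eq_bigr do rewrite mulrBr.
rewrite sumrB; have -> : \sum_j psi2 i j (v p) * (t p * gpsi p 0 j) = t p * \sum_j psi2 i j (v p) * psi1 j (v p).
  by rewrite mulr_sumr; apply: eq_bigr => j _; rewrite /gpsi !mxE; ring.
by ring.
Qed.

(* The gradient of [dual_cost] at [u = v + b p]; the first and second orders cancel. *)
Let W j p := 2 * (b p - a p) 0 j + potential_grad (s p) (t p) j (F p)
  + 2 / 3 * D p * (b p - a p) 0 j.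

Let WO j : isO eps 3 (W j).
Proof.
have ha := a3 j.
have hb := b3 j.
have h1 : isO eps 1 (fun p => phi (F p) * phi1 j (F p) - phi (v p) * phi1 j (v p)).
  apply: (congO_M eps_ge0).
  - exact: (isO_weaken eps_ge0 phiF).
  - exact: (isO_weaken eps_ge0 (phi1F j)).
  - exact: T2_isO Tphi F.
  - exact: phi1O.
have h2 : isO eps 1 (fun p => psi (F p) * psi1 j (F p) - psi (v p) * psi1 j (v p)).
  by apply: (congO_M eps_ge0) => //; exact: T2_isO Tpsi F.
have h3 : isO eps 1 (fun p => \sum_i (psi1 i (F p) * psi2 i j (F p) - psi1 i (v p) * psi2 i j (v p))).
  apply: (isO_sum eps_ge0) => i; apply: (congO_M eps_ge0) => //.
  exact: T2_isO (Tpsi1 i) F.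
have h4 := phi1F j; have h5 := psi1F j.
(* Each summand pairs a difference with a prefactor of complementary order, and [D (b - a)] is cubic
   by itself. What has been added and subtracted cancels: the linear terms in [grad phi] and
   [grad psi], the terms [phi grad phi] and [psi grad psi], and the two copies of
   [D^2 psi . grad psi], which match by the symmetry of the Hessian. *)
apply: (isO_ext (f := fun p => 2 * (b p 0 j - t p * (1 - 2 * (t p * psi (v p))) * gpsi p 0 j)
  - 2 * (a p 0 j - s p * (1 - 2 * (s p * phi (v p))) * gphi p 0 j)
  + 2 * s p * (phi1 j (F p) - phi1 j (v p))
  - 4 * s p ^+ 2 * (phi (F p) * phi1 j (F p) - phi (v p) * phi1 j (v p))
  - 2 * t p * (psi1 j (F p) - (psi1 j (v p) + t p * \sum_i psi2 j i (v p) * psi1 i (v p)))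
  + 4 * t p ^+ 2 * (psi (F p) * psi1 j (F p) - psi (v p) * psi1 j (v p))
  + 2 * t p ^+ 2 * \sum_i (psi1 i (F p) * psi2 i j (F p) - psi1 i (v p) * psi2 i j (v p))
  + 2 / 3 * D p * (b p 0 j - a p 0 j))) => [p|]; last by bigO.
rewrite /W /potential_grad sumrB.
have -> : \sum_i psi2 j i (v p) * psi1 i (v p) = \sum_i psi1 i (v p) * psi2 i j (v p).
  by apply: eq_bigr => i _; rewrite sym2 mulrC.
by rewrite /gphi /gpsi !mxE; ring.
Qed.

Let E p := v p + a p.

(** Put [w = u - F]. The increment of the cost is at least [W . w + |w|^2 / 2]: half of [|w|^2]
    absorbs the remainder of the potential, and what the quartic term adds beyond its linear part is
    nonnegative. Completing the square leaves a loss of [|W|^2 / 2], of sixth order. *)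
Lemma dual_cost_min : exists C d : R, [/\ 0 <= C, 0 < d &
  forall p, eps p <= d -> forall u,
    dual_cost (s p) (t p) (E p) (F p) - C * eps p ^+ 6 <= dual_cost (s p) (t p) (E p) u].
Proof.
have [C1 C10 h1] := potential_taylor.
have WO2 : isO eps 6 (fun p => \sum_j W j p ^+ 2) by bigO.
have [C [d [C0 d0 hC]]] := WO2.
have C1p : 0 < 2 * (C1 + 1) by rewrite mulr_gt0// ltr_wpDl.
(* The last bound on [eps] gives [C1 * eps <= 1 / 2], so that the remainder of the potential fits
   into half of [|w|^2]. *)
exists C, (Num.min d (Num.min 1 (2 * (C1 + 1))^-1)); split => //.
  by rewrite !lt_min d0 ltr01 invr_gt0.
move=> p; rewrite !le_min => /and3P[pd p1 pC] u.
have {}pC : C1 * eps p <= 1 / 2.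
  by move: pC; rewrite -[_^-1]mul1r ler_pdivlMr//; have := eps_ge0 p; lra.
pose w := u - F p.
have uE : u = F p + w by rewrite /w addrC subrK.
have {hC} := hC p pd; rewrite ger0_norm; last by apply: sumr_ge0 => j _; rewrite sqr_ge0.
move=> hC; have s0 := ltW (par_s_gt0 p); have t0 := ltW (par_t_gt0 p).
have := h1 (s p) (t p) (F p) w s0 t0 p1.
rewrite /taylor_rem -uE => h1p.
have FE : F p - E p = b p - a p by rewrite /F /E opprD addrACA subrr add0r.
have uE' : u - E p = (b p - a p) + w by rewrite -FE /w [RHS]addrC addrA subrK.
rewrite /dual_cost FE uE' -/(D p).
have -> : dotv (b p - a p + w) (b p - a p + w) =
    D p + (2 * dotv (b p - a p) w + dotv w w).
  rewrite /D; have e (x y : V) : dotv (x + y) (x + y) = dotv x x + (2 * dotv x y + dotv y y).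
    by rewrite dotvDl !dotvDr (dotvC y x); ring.
  exact: e.
set X := dotv (b p - a p) w; set N := dotv w w.
have N0 : 0 <= N by exact: dotvv_ge0.
have D0 : 0 <= D p by exact: dotvv_ge0.
have hW : 2 * X + \sum_j potential_grad (s p) (t p) j (F p) * w 0 j + 2 / 3 * D p * X =
    \sum_j W j p * w 0 j.
  rewrite /W; move: (2 / 3 * D p) => y.
  rewrite /X /dotv !mulr_sumr -!big_split; apply: eq_bigr => j _ /=.
  by ring.
have hAM : - (\sum_j W j p ^+ 2 / 2 + N / 2) <= \sum_j W j p * w 0 j.
  rewrite /N /dotv mulr_suml -big_split -sumrN; apply: ler_sum => j _ /=.
  by have := sqr_ge0 (W j p + w 0 j); rewrite sqrrD; lra.
have hN : C1 * (s p + t p) * N <= N / 2.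
  by rewrite mulrC ler_wpM2l// -[_^-1]mul1r.
have hX2 : 0 <= (2 * X + N) ^+ 2 by rewrite sqr_ge0.
have DN : 0 <= D p * N by rewrite mulr_ge0.
rewrite -mulr_suml in hAM.
have hh : 0 <= C * eps p ^+ 6 by rewrite mulr_ge0// exprn_ge0.
have -> : (D p + (2 * X + N)) ^+ 2 = D p ^+ 2 + 4 * D p * X + 2 * (D p * N) + (2 * X + N) ^+ 2 by ring.
have e3 : 2 / 3 * D p * X = (4 * D p * X) / 6 by field.
rewrite e3 in hW; rewrite -/N in h1p; clear e3; clearbody X N.
move: h1p hW hAM hC hX2 DN hh; set W2 := \sum_i W i p ^+ 2.
set Ww := \sum_j W j p * w 0 j; set gw := \sum_i potential_grad _ _ i _ * _.
move: (potential _ _ u) (potential _ _ (F p)) (C * eps p ^+ 6) => gu gF c.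
move: (4 * D p * X) (D p * N) ((2 * X + N) ^+ 2) (D p ^+ 2) (D p) W2 Ww gw N0 hN.
move=> *; lra.
Qed.

Let r0 p := Num.sqrt (A p ^+ 2 + s p ^+ 2 * G p).
Let r1 p := Num.sqrt (B p ^+ 2 + t p ^+ 2 * H p).
Let S p := A p * B p - s p ^+ 2 * t p ^+ 2 * G p * H p / 6.
Let w0 p := r0 p * r1 p * expR (- (D p / 2 + D p ^+ 2 / 12)).

Let r0O : isO eps 0 r0. Proof. exact: isO_mass_radius. Qed.
Let r1O : isO eps 0 r1. Proof. exact: isO_mass_radius. Qed.
Let AO : isO eps 0 A. Proof. by rewrite /A; bigO. Qed.
Let BO : isO eps 0 B. Proof. by rewrite /B; bigO. Qed.
Let SO : isO eps 0 S. Proof. by rewrite /S; bigO. Qed.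

(** This is where the curvature term arises. Since [a] and [b] are orthogonal, [D = |a|^2 + |b|^2],
    and the exponential splits into the factors attached to [r0] and [r1], which yield [A B], and a
    cross factor [exp (- |a|^2 |b|^2 / 6)] left by [D^2 / 12]. *)
Let w0S : isO eps 5 (fun p => w0 p - S p).
Proof.
pose X p := r0 p * expR (- (dotv (a p) (a p) / 2 + dotv (a p) (a p) ^+ 2 / 12)).
pose Y p := r1 p * expR (- (dotv (b p) (b p) / 2 + dotv (b p) (b p) ^+ 2 / 12)).
have hA : isO eps 6 (fun p => X p - A p) := congO_mass_radius eps_ge0 sO phiO gphiO.
have hB : isO eps 6 (fun p => Y p - B p) := congO_mass_radius eps_ge0 tO psiO gpsiO.
pose q p := - (dotv (a p) (a p) * dotv (b p) (b p) / 6).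
have qO : isO eps 4 q by rewrite /q; bigO.
have ZO : isO eps 12 (fun p => expR (q p) - (1 + q p + q p ^+ 2 / 2)) :=
  congO_expR eps_ge0 qO.
have XO : isO eps 0 X by apply: (isO_of_congO eps_ge0 (isO_weaken eps_ge0 hA (leq0n _))).
have XY : isO eps 6 (fun p => X p * Y p - A p * B p) by exact: congO_M.
have h1 : isO eps 3 (fun p => dotv (a p) (a p) - s p ^+ 2 * G p) :=
  congO_dotv_disp eps_ge0 sO phiO gphiO.
have h2 : isO eps 3 (fun p => dotv (b p) (b p) - t p ^+ 2 * H p) :=
  congO_dotv_disp eps_ge0 tO psiO gpsiO.
have h3 : isO eps 5 (fun p => dotv (a p) (a p) * dotv (b p) (b p) - s p ^+ 2 * G p * (t p ^+ 2 * H p)).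
  apply: (isO_ext (f := fun p => dotv (a p) (a p) * (dotv (b p) (b p) - t p ^+ 2 * H p)
     + (dotv (a p) (a p) - s p ^+ 2 * G p) * (t p ^+ 2 * H p))) => [p|]; first by ring.
  by bigO.
have h4 : isO eps 5 (fun p => expR (q p) - (1 - s p ^+ 2 * G p * (t p ^+ 2 * H p) / 6)).
  apply: (isO_ext (f := fun p => (expR (q p) - (1 + q p + q p ^+ 2 / 2)) + q p ^+ 2 / 2
    - (dotv (a p) (a p) * dotv (b p) (b p) - s p ^+ 2 * G p * (t p ^+ 2 * H p)) / 6)) => [p|].
    by rewrite /q; field.
  by bigO.
have h5 : isO eps 5 (fun p => X p * Y p * expR (q p) - A p * B p * (1 - s p ^+ 2 * G p * (t p ^+ 2 * H p) / 6)).
  apply: (congO_M eps_ge0) => //.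
  - exact: (isO_weaken eps_ge0 XY).
  - apply: (isO_of_congO eps_ge0 (isO_weaken eps_ge0 XY (leq0n _))); by bigO.
  - by bigO.
(* In front of the fourth-order term [A B] may be replaced by [1], since [A B - 1] has first
   order. *)
apply: (isO_ext (f := fun p => (X p * Y p * expR (q p) - A p * B p * (1 - s p ^+ 2 * G p * (t p ^+ 2 * H p) / 6))
  - (2 * (s p * phi (v p)) + 2 * (t p * psi (v p)) + 4 * (s p * phi (v p)) * (t p * psi (v p))) * (s p ^+ 2 * G p * (t p ^+ 2 * H p) / 6))) => [p|]; last by bigO.
have -> : w0 p = X p * Y p * expR (q p).
  rewrite /w0; have -> : - (D p / 2 + D p ^+ 2 / 12) =
      - (dotv (a p) (a p) / 2 + dotv (a p) (a p) ^+ 2 / 12)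
      + - (dotv (b p) (b p) / 2 + dotv (b p) (b p) ^+ 2 / 12) + q p.
    by rewrite /q DE; field.
  by rewrite 2!expRD /X /Y; ring.
by rewrite /S /A /B; field.
Qed.

Let HKE p : HK_density (s p) (t p) (v p) =
  mass phi phi1 (s p) (v p) + mass psi psi1 (t p) (v p) - 2 * S p.
Proof. by rewrite /HK_density /mass -/(gphi p) -/(gpsi p) -/(G p) -/(H p) /S /A /B; field. Qed.

(** Given [w0S], it remains to exchange the cosine for the exponential, at a cost proportional to
    [D^3], hence of sixth order. *)
Lemma plan_cost_upper : exists C d : R, [/\ 0 <= C, 0 < d & forall p, eps p <= d ->
  mass phi phi1 (s p) (v p) + mass psi psi1 (t p) (v p)
  - 2 * (Num.sqrt (mass phi phi1 (s p) (v p)) * Num.sqrt (mass psi psi1 (t p) (v p)) * cos (normv (b p - a p)))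
  <= HK_density (s p) (t p) (v p) + C * eps p ^+ 5].
Proof.
have [d d0 hd] := isO_small eps_ge0 DO (@ltr01 R).
have h : isO eps 6 (fun p => r0 p * r1 p * (cos (normv (b p - a p)) - expR (- (D p / 2 + D p ^+ 2 / 12)))).
  apply: (isO_dominated d0 (C := 1) (g := fun p => r0 p * r1 p * D p ^+ 3)); last by bigO.
  have Dn p : D p = normv (b p - a p) ^+ 2 by rewrite normv_sqr.
  move=> p /hd; rewrite mul1r !(normrM (r0 p * r1 p)) Dn => a1'.
  apply: ler_wpM2l => //.
  have : `|normv (b p - a p)| <= 1.
    by move: a1'; rewrite normrX expr_le1.
  move=> /cosBexpR_norm; rewrite -!exprM => h; apply: (le_trans h).
  by rewrite ger0_norm// exprn_ge0// normv_ge0.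
have h2 : isO eps 5 (fun p => - 2 * (r0 p * r1 p * cos (normv (b p - a p)) - S p)).
  apply: (isO_ext (f := fun p => - 2 * (r0 p * r1 p * (cos (normv (b p - a p)) - expR (- (D p / 2 + D p ^+ 2 / 12))) + (w0 p - S p)))) => [p|].
    by rewrite /w0; ring.
  by bigO.
have [C [d' [C0 d'0 hC]]] := h2.
exists C, d'; split => // p /hC; rewrite ler_norml => /andP[_].
by rewrite HKE -/(gphi p) -/(gpsi p) -/(G p) -/(H p) -/(r0 p) -/(r1 p); lra.
Qed.

Let w1 p := potential (s p) (t p) (F p).

(** The dual term of the second marginal reaches the value of the equality case only up to third
    order. That is enough, because its error is squared in [dual_upper]. *)
Let dual_mass : isO eps 3 (fun p => (B p ^+ 2 + t p ^+ 2 * H p) * expR (w1 p) - A p * B p).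
(* Below, [g p] is the second-order expansion of [log (A B / (B^2 + t^2 H))], using
   [log (1 + 2 x) = 2 x - 2 x^2 + ...]. Its last sign is opposite to the one in [potential], because
   [- 2 t psi (F p)] contributes a further [- 2 t^2 H]. *)
Proof.
pose g p := 2 * s p * phi (v p) - 2 * s p ^+ 2 * phi (v p) ^+ 2 - 2 * t p * psi (v p)
  + 2 * t p ^+ 2 * psi (v p) ^+ 2 - t p ^+ 2 * H p.
have gO : isO eps 1 g by rewrite /g; bigO.
have h1 : isO eps 1 (fun p => phi (F p) ^+ 2 - phi (v p) ^+ 2).
  have h0 : isO eps 1 (fun p => phi (F p) - phi (v p)) := isO_weaken (k' := 1) eps_ge0 phiF isT.
  exact: (congO_M eps_ge0 h0 h0 (T2_isO _ Tphi F) phiO).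
have h2 : isO eps 1 (fun p => psi (F p) ^+ 2 - psi (v p) ^+ 2).
  exact: (congO_M eps_ge0 psiF1 psiF1 (T2_isO _ Tpsi F) psiO).
have h3 : isO eps 1 (fun p => \sum_i psi1 i (F p) ^+ 2 - H p).
  apply: (isO_ext (f := fun p => \sum_i (psi1 i (F p) ^+ 2 - psi1 i (v p) ^+ 2))) => [p|].
    rewrite sumrB; congr (_ - _); apply: eq_bigr => i _.
    by rewrite /gpsi !mxE expr2.
  apply: (isO_sum eps_ge0) => i.
  exact: (congO_M eps_ge0 (psi1F1 i) (psi1F1 i) (T2_isO _ (Tpsi1 i) F) (psi1O i)).
have wg : isO eps 3 (fun p => w1 p - g p).
  apply: (isO_ext (f := fun p => 2 * s p * (phi (F p) - phi (v p))
    - 2 * s p ^+ 2 * (phi (F p) ^+ 2 - phi (v p) ^+ 2)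
    - 2 * t p * (psi (F p) - (psi (v p) + t p * H p))
    + 2 * t p ^+ 2 * (psi (F p) ^+ 2 - psi (v p) ^+ 2)
    + t p ^+ 2 * (\sum_i psi1 i (F p) ^+ 2 - H p))) => [p|]; last by bigO.
  by rewrite /w1 /potential /g; ring.
have wO : isO eps 1 w1 by apply: (isO_of_congO eps_ge0 (isO_weaken (k' := 1) eps_ge0 wg isT)).
have eO : isO eps 3 (fun p => expR (w1 p) - (1 + w1 p + w1 p ^+ 2 / 2)) :=
  congO_expR eps_ge0 wO.
apply: (isO_ext (f := fun p => (B p ^+ 2 + t p ^+ 2 * H p) * (expR (w1 p) - (1 + w1 p + w1 p ^+ 2 / 2))
  + (B p ^+ 2 + t p ^+ 2 * H p) * (w1 p - g p) * (1 + (w1 p + g p) / 2)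
  + ((B p ^+ 2 + t p ^+ 2 * H p) * (1 + g p + g p ^+ 2 / 2) - A p * B p))) => [p|]; first by field.
have h5 : isO eps 3 (fun p => (B p ^+ 2 + t p ^+ 2 * H p) * (1 + g p + g p ^+ 2 / 2) - A p * B p).
  pose f0 p := phi (v p); pose f1 p := psi (v p).
  have f0O : isO eps 0 f0 := phiO; have f1O : isO eps 0 f1 := psiO.
  (* g = g1 + g2 splits into its parts of first and second order. *)
  pose g1 p := 2 * s p * f0 p - 2 * t p * f1 p.
  pose g2 p := - 2 * s p ^+ 2 * f0 p ^+ 2 + 2 * t p ^+ 2 * f1 p ^+ 2 - t p ^+ 2 * H p.
  pose m2 p := 4 * t p ^+ 2 * f1 p ^+ 2 + t p ^+ 2 * H p.
  have g1O : isO eps 1 g1 by rewrite /g1; bigO.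
  have g2O : isO eps 2 g2 by rewrite /g2; bigO.
  have m2O : isO eps 2 m2 by rewrite /m2; bigO.
  apply: (isO_ext (f := fun p => (1 + 4 * t p * f1 p + m2 p) * (g1 p * g2 p + g2 p ^+ 2 / 2)
    + 4 * t p * f1 p * (g2 p + g1 p ^+ 2 / 2) + m2 p * (g1 p + g2 p + g1 p ^+ 2 / 2))) => [p|]; last by bigO.
  by rewrite /A /B /g /g1 /g2 /m2 -/(f0 p) -/(f1 p); field.
by bigO.
Qed.

(** [f0] enters only through lying below every upper bound of the family, so that the supremum can
    be substituted later. With [p1] the second dual term, the first one is at most [q / p1], where
    [q] is [S^2] up to fifth order, and [p1 + q / p1 - 2 S = (q - S^2) / p1 + (p1 - S)^2 / p1]. The
    last term has sixth order although [p1 - S] has only third. *)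
Lemma dual_upper : exists C d : R, [/\ 0 <= C, 0 < d & forall p, eps p <= d ->
  forall f0, (forall y, (forall u, expR (- dual_cost (s p) (t p) (E p) u) <= y) -> f0 <= y) ->
  mass phi phi1 (s p) (v p) * f0 + mass psi psi1 (t p) (v p) * expR (w1 p)
  <= mass phi phi1 (s p) (v p) + mass psi psi1 (t p) (v p)
     - HK_density (s p) (t p) (v p) + C * eps p ^+ 5].
Proof.
have [C1 [d1 [C10 d10 h1]]] := dual_cost_min.
pose m0 p := A p ^+ 2 + s p ^+ 2 * G p; pose m1 p := B p ^+ 2 + t p ^+ 2 * H p.
have m0r p : m0 p = r0 p ^+ 2 := esym (sqr_mass_radius s (fun p => phi (v p)) gphi p).
have m1r p : m1 p = r1 p ^+ 2 := esym (sqr_mass_radius t (fun p => psi (v p)) gpsi p).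
pose p1 p := m1 p * expR (w1 p).
pose e6 p := C1 * eps p ^+ 6.
have epsO : isO eps 1 eps by apply: isO_eps => p; rewrite eps_ge0 lexx.
have e6O : isO eps 6 e6 by rewrite /e6; bigO.
have ee : isO eps 5 (fun p => expR (e6 p) - 1).
  have h : isO eps 18 (fun p => expR (e6 p) - (1 + e6 p + e6 p ^+ 2 / 2)) := congO_expR eps_ge0 e6O.
  apply: (isO_ext (f := fun p => (expR (e6 p) - (1 + e6 p + e6 p ^+ 2 / 2)) + (e6 p + e6 p ^+ 2 / 2))) => [p|]; first by ring.
  by bigO.
have w0O : isO eps 0 w0 by apply: (isO_of_congO eps_ge0 (isO_weaken (k' := 0) eps_ge0 w0S isT)).
have p1A : isO eps 3 (fun p => p1 p - A p * B p) := dual_mass.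
have p11 : isO eps 1 (fun p => p1 p - 1).
  apply: (isO_ext (f := fun p => (p1 p - A p * B p) + (2 * (s p * phi (v p)) + 2 * (t p * psi (v p))
     + 2 * (s p * phi (v p)) * (2 * (t p * psi (v p)))))) => [p|]; last by bigO.
  by rewrite /A /B; ring.
have p1V : isO eps 0 (fun p => (p1 p)^-1).
  have [_] := congO_inv eps_ge0 p11; apply: isO_ext => p; congr (_^-1); by ring.
have p1S : isO eps 3 (fun p => p1 p - S p).
  apply: (isO_ext (f := fun p => (p1 p - A p * B p) + s p ^+ 2 * t p ^+ 2 * G p * H p / 6)) => [p|]; last by bigO.
  by rewrite /S; ring.
pose q p := w0 p ^+ 2 * expR (e6 p).
have wS2 : isO eps 5 (fun p => w0 p ^+ 2 - S p ^+ 2) by exact: congO_M.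
have qS : isO eps 5 (fun p => q p - S p ^+ 2).
  apply: (isO_ext (f := fun p => (w0 p ^+ 2 - S p ^+ 2) + w0 p ^+ 2 * (expR (e6 p) - 1))) => [p|].
    by rewrite /q; ring.
  by bigO.
have tot : isO eps 5 (fun p => (p1 p)^-1 * (q p - S p ^+ 2) + (p1 p)^-1 * (p1 p - S p) ^+ 2) by bigO.
have [C [d2 [C0 d20 hC]]] := tot.
have [d3 d30 hd3] := isO_small eps_ge0 p11 (ltac:(lra) : 0 < 1 / 2 :> R).
exists C, (Num.min d1 (Num.min d2 d3)); split => //; first by rewrite !lt_min d10 d20.
move=> p; rewrite !le_min => /and3P[pd1 pd2 pd3] f0 f0P.
have {}f0P : f0 <= expR (- dual_cost (s p) (t p) (E p) (F p) + e6 p).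
  by apply: f0P => u; rewrite ler_expR; have := h1 p pd1 u; rewrite -/(e6 p); lra.
have p1p : 0 < p1 p by have := hd3 p pd3; rewrite ler_norml => /andP[]; lra.
have m00 : 0 <= m0 p by rewrite m0r sqr_ge0.
have key : m0 p * f0 <= q p / p1 p.
  rewrite ler_pdivlMr//; apply: (@le_trans _ _ (m0 p * expR (- dual_cost (s p) (t p) (E p) (F p) + e6 p) * p1 p)).
    by rewrite ler_wpM2r ?(ltW p1p)// ler_wpM2l.
  rewrite le_eqVlt; apply/orP; left; apply/eqP.
  have FE : F p - E p = b p - a p by rewrite /F /E opprD addrACA subrr add0r.
  rewrite /q /w0 /p1 m0r m1r /dual_cost FE -/(D p) -/(w1 p).
  have -> : - (D p + D p ^+ 2 / 6 + w1 p) + e6 p =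
     - (D p / 2 + D p ^+ 2 / 12) + - (D p / 2 + D p ^+ 2 / 12) + e6 p - w1 p by field.
  rewrite expRB 2!expRD; field.
  by rewrite gt_eqF// expR_gt0.
have {hC} := hC p pd2; rewrite ler_norml => /andP[_ hC].
rewrite HKE -/(gphi p) -/(gpsi p) -/(G p) -/(H p) -/(m0 p) -/(m1 p).
have -> : mass phi phi1 (s p) (v p) = m0 p by [].
have -> : mass psi psi1 (t p) (v p) = m1 p by [].
rewrite -/(p1 p).
have e : (p1 p)^-1 * (q p - S p ^+ 2) + (p1 p)^-1 * (p1 p - S p) ^+ 2 = p1 p + q p / p1 p - 2 * S p.
  by field; rewrite gt_eqF.
rewrite e in hC; lra.
Qed.

End expansion.

(** * Circle, torus and trigonometric products *)

Section circle_theory.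
Context (R : realType).
Implicit Types (a b : R) (y : circle R).

Lemma to_circle_eqP a b :
  to_circle a = to_circle b <-> exists z : int, a - b = z%:~R * (2 * pi).
Proof.
split=> [/eqquotP|h]; first by move=> /asboolP.
by apply/eqquotP/asboolP.
Qed.

Lemma circle_liftK y : to_circle (circle_lift y) = y.
Proof. exact: reprK. Qed.

Lemma to_circle_lift a : exists z : int, circle_lift (to_circle a) = a + z%:~R * (2 * pi).
Proof.
have /to_circle_eqP[z e] : to_circle (circle_lift (to_circle a)) = to_circle a.
  by rewrite circle_liftK.
by exists z; rewrite -e addrC subrK.
Qed.

Lemma to_circleD2pi a (z : int) : to_circle (a + z%:~R * (2 * pi)) = to_circle a.
Proof. by apply/to_circle_eqP; exists z; rewrite addrAC subrr add0r. Qed.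

(** Rounding [(a - b) / (2 pi)] to the nearest integer leaves a difference of at most half a period,
    and adding a nonzero multiple of the period to such a difference cannot make it shorter. *)
Lemma circle_dist_lb a b :
  exists z : int, `|a - (b + z%:~R * (2 * pi))| <= circle_dist (to_circle a) (to_circle b).
Proof.
pose T := 2 * pi : R; have T0 : 0 < T by exact: two_pi_gt0.
pose z := Num.floor ((a - b) / T + 1 / 2).
have hz : `|a - b - z%:~R * T| <= T / 2.
  have /andP[h1 h2] := floor_itv ((a - b) / T + 1 / 2) .
  have e : a - b - z%:~R * T = ((a - b) / T - z%:~R) * T by field; rewrite gt_eqF.
  rewrite e normrM (gtr0_norm T0) mulrC ler_wpM2l ?(ltW T0)//.
  rewrite ler_norml; move: h1 h2; rewrite -/z intrD; lra.
exists z; rewrite opprD addrA -/T.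
apply: lb_le_inf; first by exists `|a - b|, a, b.
move=> _ [a' [b' [/to_circle_eqP[x ax] /to_circle_eqP[x' bx] ->]]].
have -> : a' - b' = (a - b - z%:~R * T) + (x - x' + z)%:~R * T.
  rewrite intrD rmorphB/= !mulrDl mulNr -ax -bx; ring.
set w := a - b - _ in hz *; set m := x - x' + z.
have [->|m0] := eqVneq m 0; first by rewrite mul0r addr0.
have : 1 <= `|m%:~R : R| by rewrite -intr_norm ler1z -gtz0_ge1 normr_gt0.
have := ler_normB (m%:~R * T + w) w; rewrite addrK normrM (gtr0_norm T0).
rewrite (addrC w); nra.
Qed.

Lemma circle_dist_ge0 y y' : 0 <= circle_dist y y'.
Proof.
rewrite -(circle_liftK y) -(circle_liftK y'); have [z] := circle_dist_lb (circle_lift y) (circle_lift y').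
exact: le_trans.
Qed.

End circle_theory.

Section torus_theory.
Context (R : realType) (n : nat).
Implicit Types (u v : 'rV[R]_n) (x : torus R n).

Definition latticev (m : 'rV[int]_n) : 'rV[R]_n := \row_i ((m 0 i)%:~R * (2 * pi)).

Definition periodic_rV T (f : 'rV[R]_n -> T) := forall v m, f (v + latticev m) = f v.

Lemma torus_liftK x : to_torus (torus_lift x) = x.
Proof.
by apply: eq_from_tnth => i; rewrite tnth_mktuple mxE circle_liftK.
Qed.

Lemma to_torus_lift v : exists m, torus_lift (to_torus v) = v + latticev m.
Proof.
have /choice[m hm] : forall i, exists z : int,
    circle_lift (to_circle (v 0 i)) = v 0 i + z%:~R * (2 * pi).
  by move=> i; exact: to_circle_lift.
by exists (\row_i m i); apply/rowP => i; rewrite !mxE tnth_mktuple hm.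
Qed.

Lemma to_torusD v m : to_torus (v + latticev m) = to_torus v.
Proof.
by apply: eq_from_tnth => i; rewrite !tnth_mktuple !mxE to_circleD2pi.
Qed.

Lemma periodic_lift T (f : 'rV[R]_n -> T) v : periodic_rV f ->
  f (torus_lift (to_torus v)) = f v.
Proof. by move=> pf; have [m ->] := to_torus_lift v. Qed.

Lemma torus_dist_le u v : torus_dist (to_torus u) (to_torus v) <= normv (u - v).
Proof.
rewrite ler_wsqrtr//; apply: ler_sum => i _; rewrite !tnth_mktuple !mxE -expr2.
rewrite -(real_normK (num_real (u 0 i - v 0 i))) lerXn2r ?nnegrE//.
  exact: circle_dist_ge0.
exact: circle_distE.
Qed.

Lemma torus_dist_lb u v : exists m, normv (u - (v + latticev m)) <= torus_dist (to_torus u) (to_torus v).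
Proof.
have /choice[m hm] : forall i, exists z : int,
    `|u 0 i - (v 0 i + z%:~R * (2 * pi))| <= circle_dist (to_circle (u 0 i)) (to_circle (v 0 i)).
  by move=> i; exact: circle_dist_lb.
exists (\row_i m i); rewrite ler_wsqrtr//; apply: ler_sum => i _.
rewrite !tnth_mktuple !mxE -expr2 -[X in X <= _]real_normK ?num_real//.
by rewrite lerXn2r ?nnegrE// circle_dist_ge0.
Qed.

Lemma torus_dist_ge0 (x x' : torus R n) : 0 <= torus_dist x x'.
Proof. exact: sqrtr_ge0. Qed.

End torus_theory.

Section T2_linear.
Context (R : realType) (n : nat).
Implicit Types (f : 'rV[R]_n -> R) (g : 'I_n -> 'rV[R]_n -> R).

Lemma T2_D f1 f2 g1 g2 : T2 f1 g1 -> T2 f2 g2 ->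
  T2 (fun v => f1 v + f2 v) (fun i v => g1 i v + g2 i v).
Proof.
move=> [C1 C10 h1] [C2 C20 h2]; exists (2 * (C1 + C2)).
  by rewrite mulr_ge0// addr_ge0.
have D12 (x y : R) : `|x| <= C1 -> `|y| <= C2 -> `|x + y| <= 2 * (C1 + C2).
  move=> xC yC; apply: (le_trans (ler_normD x y)).
  by apply: (le_trans (lerD xC yC)); lra.
move=> v; have [f1v g1v r1 l1] := h1 v; have [f2v g2v r2 l2] := h2 v; split.
- exact: D12.
- by move=> i; exact: D12.
- move=> u; have -> : taylor_rem (fun v => f1 v + f2 v) (fun i v => g1 i v + g2 i v) v u =
    taylor_rem f1 g1 v u + taylor_rem f2 g2 v u.
    rewrite /taylor_rem; under eq_bigr do rewrite mulrDl.
    by rewrite big_split/=; ring.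
  apply: (le_trans (ler_normD _ _)); have N0 := dotvv_ge0 u.
  have := r1 u; have := r2 u; nra.
- move=> u; have := l1 u; have := l2 u; have := dotvv_ge0 u.
  set x := f1 _ - _; set y := f2 _ - _ => *.
  have -> : f1 (v + u) + f2 (v + u) - (f1 v + f2 v) = x + y by rewrite /x /y; ring.
  clearbody x y; have := sqr_ge0 (x - y); rewrite sqrrB sqrrD; lra.
Qed.

Lemma T2_Z c f g : T2 f g -> T2 (fun v => c * f v) (fun i v => c * g i v).
Proof.
move=> /(T2_M (T2_cst n c)); apply: T2_eqg => i v.
by rewrite mulr0 addr0.
Qed.

Lemma T2_derive f g v i : T2 f g -> 'D_(delta_mx 0 i) f v = g i v.
Proof.
move=> [C C0 h]; have [_ _ r _] := h v.
apply/cvg_lim => //; apply/cvgrPdist_le => e e0.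
near=> x.
have x0 : x != 0 by near: x; exact: nbhs_dnbhs_neq.
have xe : `|x| <= e / (C + 1).
  by near: x; apply: dnbhs0_le; rewrite divr_gt0// ltr_wpDl.
have := r (x *: delta_mx 0 i); rewrite /taylor_rem.
have -> : \sum_j g j v * (x *: delta_mx 0 i : 'rV_n) 0 j = g i v * x.
  rewrite (bigD1 i)//= !mxE !eqxx/= mulr1 big1 ?addr0// => j ji.
  by rewrite !mxE eqxx/= (negbTE ji) !mulr0.
have -> : dotv (x *: delta_mx 0 i) (x *: delta_mx 0 i : 'rV_n) = x ^+ 2.
  rewrite /dotv (bigD1 i)//= !mxE !eqxx/= mulr1 big1 ?addr0// => j ji.
  by rewrite !mxE eqxx/= (negbTE ji) !mulr0.
move=> hr.
rewrite /shift/= [_ + v]addrC /GRing.scale/=.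
have -> : g i v - x^-1 * (f (v + x *: delta_mx 0 i) - f v) =
  - (x^-1 * (f (v + x *: delta_mx 0 i) - f v - g i v * x)) by field.
rewrite normrN normrM normfV ler_pdivrMl ?normr_gt0//.
apply: (le_trans hr); rewrite -(real_normK (num_real x)) expr2 mulrCA ler_wpM2l//.
move: xe; rewrite ler_pdivlMr ?ltr_wpDl//; have := normr_ge0 x; nra.
Unshelve. all: by end_near. Qed.

End T2_linear.

Section trig_products.
Context (R : realType) (n : nat).
Implicit Types (j : int) (m : nat) (y : R) (k : 'rV[int]_n) (al : 'I_n -> nat).

(* The [m]-th derivative of the [j]-th basis function of the circle. *)
Definition beta j m y : R :=
  if 0 < j then Num.sqrt 2 * j%:~R ^+ m * cos (j%:~R * y + m%:R * (pi / 2))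
  else if j < 0 then Num.sqrt 2 * j%:~R ^+ m * sin (j%:~R * y + m%:R * (pi / 2))
  else (m == 0)%:R.

Lemma cos_lip2 (x h : R) : (cos (x + h) - cos x) ^+ 2 <= 16 * h ^+ 2.
Proof.
have -> : 16 * h ^+ 2 = (4 * `|h|) ^+ 2 by rewrite exprMn real_normK ?num_real//; ring.
rewrite -real_normK ?num_real// lerXn2r ?nnegrE ?mulr_ge0//.
have [h1|h1] := leP `|h| 1; last first.
  apply: (le_trans (ler_normB _ _)); have := cos_max (x + h); have := cos_max x; lra.
have := cos_taylor x h; rewrite -(real_normK (num_real h)).
have : `|cos (x + h) - cos x| <= `|cos (x + h) - cos x + sin x * h| + `|sin x * h|.
  by rewrite -{1}(addrK (sin x * h) (cos (x + h) - cos x)) ler_normB.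
have : `|sin x * h| <= `|h| by rewrite normrM ler_piMl// sin_max.
have := normr_ge0 h; nra.
Qed.

Lemma sin_lip2 (x h : R) : (sin (x + h) - sin x) ^+ 2 <= 16 * h ^+ 2.
Proof.
have := cos_lip2 (x - pi / 2) h.
by rewrite (addrAC x) !cosBpihalf.
Qed.

Lemma cosD_pihalfS (x : R) m : cos (x + m.+1%:R * (pi / 2)) = - sin (x + m%:R * (pi / 2)).
Proof. by rewrite -cosDpihalf -addrA -[m.+1]addn1 natrD [in LHS]mulrDl mul1r. Qed.

Lemma sinD_pihalfS (x : R) m : sin (x + m.+1%:R * (pi / 2)) = cos (x + m%:R * (pi / 2)).
Proof. by rewrite -sinDpihalf -addrA -[m.+1]addn1 natrD [in LHS]mulrDl mul1r. Qed.

Lemma T2_beta j m p : T2 (fun v : 'rV[R]_n => beta j m (v 0 p))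
  (fun i v => if i == p then beta j m.+1 (v 0 p) else 0).
Proof.
pose a : R := j%:~R; pose c := Num.sqrt 2 * a ^+ m.
pose C := `|c| + `|c * a| + 3 * `|c| * a ^+ 2 + 16 * c ^+ 2 * a ^+ 2 + 1.
have c0 := normr_ge0 c; have ca0 := normr_ge0 (c * a); have a20 := sqr_ge0 a.
have c20 := sqr_ge0 c.
have c3 : 0 <= 3 * `|c| * a ^+ 2 by apply: mulr_ge0 => //; exact: mulr_ge0.
have c4 : 0 <= 16 * c ^+ 2 * a ^+ 2 by apply: mulr_ge0 => //; exact: mulr_ge0.
have cE : Num.sqrt 2 * a ^+ m.+1 = c * a by rewrite exprSr mulrA.
have [hC1 hC2 hC3 hC4] : [/\ `|c| <= C, `|c * a| <= C, 3 * `|c| * a ^+ 2 <= C & 16 * c ^+ 2 * a ^+ 2 <= C].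
  by rewrite /C; split; lra.
have C1 : 1 <= C by rewrite /C; lra.
have C0 : 0 <= C by lra.
have bd (x y z : R) : `|x| <= z -> `|y| <= 1 -> `|x * y| <= z.
  by move=> xz y1; rewrite normrM; apply: le_trans xz; rewrite ler_piMr.
apply: (@T2_coord _ _ _ _ C) => [y|y|y x|y x]; rewrite /beta -/a ?cE -/c.
- case: ifP => _; first by rewrite bd// cos_max.
  case: ifP => _; first by rewrite bd// sin_max.
  by case: (m == 0)%N; rewrite ?normr1 ?normr0.
- case: ifP => _; first by rewrite bd// cos_max.
  case: ifP => _; first by rewrite bd// sin_max.
  by rewrite normr0.
- apply: (@le_trans _ _ (3 * `|c| * a ^+ 2 * x ^+ 2)); last by rewrite ler_wpM2r ?sqr_ge0.
  have -> : 3 * `|c| * a ^+ 2 * x ^+ 2 = `|c| * (3 * (a * x) ^+ 2) by ring.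
  rewrite mulrDr (addrAC (a * y)).
  case: ifP => _.
    rewrite cosD_pihalfS.
    set t := a * y + _; have -> : c * cos (t + a * x) - c * cos t - c * a * - sin t * x =
      c * (cos (t + a * x) - cos t + sin t * (a * x)) by ring.
    by rewrite normrM ler_wpM2l// cos_taylor.
  case: ifP => _.
    rewrite sinD_pihalfS.
    set t := a * y + _; have -> : c * sin (t + a * x) - c * sin t - c * a * cos t * x =
      c * (sin (t + a * x) - sin t - cos t * (a * x)) by ring.
    by rewrite normrM ler_wpM2l// sin_taylor.
  rewrite subrr mul0r subr0 normr0; apply: mulr_ge0 => //.
  by apply: mulr_ge0 => //; exact: sqr_ge0.
- apply: (@le_trans _ _ (16 * c ^+ 2 * a ^+ 2 * x ^+ 2)); last by rewrite ler_wpM2r ?sqr_ge0.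
  have -> : 16 * c ^+ 2 * a ^+ 2 * x ^+ 2 = c ^+ 2 * (16 * (a * x) ^+ 2) by ring.
  rewrite mulrDr (addrAC (a * y)).
  case: ifP => _; first by rewrite -mulrBr exprMn ler_wpM2l// cos_lip2.
  case: ifP => _; first by rewrite -mulrBr exprMn ler_wpM2l// sin_lip2.
  rewrite subrr expr0n/=; apply: mulr_ge0 => //.
  by apply: mulr_ge0 => //; exact: sqr_ge0.
Qed.

Lemma cos_intD (x : R) (z : int) : cos (x + z%:~R * (2 * pi)) = cos x.
Proof.
rewrite (mulr_natl pi 2).
have h (m : nat) w : cos (w + m%:R * (pi *+ 2)) = cos w :> R.
  elim: m w => [|m ih] w; first by rewrite mul0r addr0.
  by rewrite -[m.+1]addn1 natrD mulrDl addrA mul1r cosD2pi ih.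
case: z => m; first exact: h.
by rewrite NegzE mulrNz mulNr -[LHS](h m.+1) subrK.
Qed.

Lemma sin_intD (x : R) (z : int) : sin (x + z%:~R * (2 * pi)) = sin x.
Proof. by rewrite -!cosBpihalf addrAC cos_intD. Qed.

Lemma beta_periodic j m y (z : int) : beta j m (y + z%:~R * (2 * pi)) = beta j m y.
Proof.
rewrite /beta mulrDr mulrA -intrM (addrAC (j%:~R * y)).
by rewrite cos_intD sin_intD.
Qed.

Definition trig_prod k al (v : 'rV[R]_n) : R := \prod_p beta (k 0 p) (al p) (v 0 p).

Definition incr al (i : 'I_n) : 'I_n -> nat := fun p => (al p + (p == i))%N.

Lemma incrC al i i' : incr (incr al i) i' = incr (incr al i') i.
Proof. by apply/funext => p; rewrite /incr addnAC. Qed.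

Lemma T2_trig_prod k al : T2 (trig_prod k al) (fun i => trig_prod k (incr al i)).
Proof.
(* Over a duplicate-free list the induction adds one coordinate at a time; the derivative in a
   coordinate outside the list is zero. *)
suff H (r : seq 'I_n) : uniq r -> T2 (fun v => \prod_(p <- r) beta (k 0 p) (al p) (v 0 p))
   (fun i v => if i \in r then \prod_(p <- r) beta (k 0 p) (incr al i p) (v 0 p) else 0).
  by apply: T2_eqg (H _ (index_enum_uniq _)) => i v; rewrite mem_index_enum.
elim: r => [_|p r ih /= /andP[pr /ih{}ih]].
  have -> : (fun v : 'rV[R]_n => \prod_(p <- [::]) beta (k 0 p) (al p) (v 0 p)) = fun=> 1.
    by apply/funext => v; rewrite big_nil.
  exact: T2_cst.
have -> : (fun v : 'rV[R]_n => \prod_(i <- p :: r) beta (k 0 i) (al i) (v 0 i)) =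
  fun v => beta (k 0 p) (al p) (v 0 p) * \prod_(i <- r) beta (k 0 i) (al i) (v 0 i).
  by apply/funext => v; rewrite big_cons.
apply: T2_eqg (T2_M (T2_beta (k 0 p) (al p) p) ih) => i v.
rewrite inE big_cons; have [->|ip] := eqVneq i p.
  have -> : incr al p p = (al p).+1 by rewrite /incr eqxx addn1.
  rewrite (negbTE pr) mulr0 add0r /= mulrC; congr (_ * _).
  rewrite big_seq [RHS]big_seq; apply: eq_bigr => q qr; rewrite /incr.
  by case: eqP qr pr => [-> ->//|_ _ _]; rewrite addn0.
have -> : incr al i p = al p by rewrite /incr eq_sym (negbTE ip) addn0.
rewrite mulr0 addr0 /=.
by case: ifP => //; rewrite mulr0.
Qed.

Lemma trig_prod_periodic k al : periodic_rV (trig_prod k al).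
Proof. by move=> v m; apply: eq_bigr => p _; rewrite !mxE beta_periodic. Qed.

(** For a zero frequency the factor is constant, and differentiating it kills the product. With
    disjoint supports this gives all orthogonality relations between derivatives. *)
Lemma trig_prod0 k al i v : k 0 i = 0 -> (0 < al i)%N -> trig_prod k al v = 0.
Proof.
move=> ki ai; rewrite /trig_prod (bigD1 i)//= /beta ki ltxx.
by case: (al i) ai => //= m _; rewrite mul0r.
Qed.

Lemma trig_prod_orth k k' al al' i v : (forall p, k 0 p * k' 0 p = 0) ->
  (0 < al i)%N -> (0 < al' i)%N -> trig_prod k al v * trig_prod k' al' v = 0.
Proof.
move=> kk ai ai'; have /eqP := kk i; rewrite mulf_eq0 => /orP[/eqP h|/eqP h].
  by rewrite (trig_prod0 _ h ai) mul0r.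
by rewrite (trig_prod0 _ h ai') mulr0.
Qed.

Lemma fourier_basisE k (x : torus R n) :
  fourier_basis k x = trig_prod k (fun=> 0) (torus_lift x).
Proof.
apply: eq_bigr => p _; rewrite /circle_basis /beta !mxE.
by rewrite !mulr1 !mul0r !addr0.
Qed.

End trig_products.

Section gradient.
Context (R : realType) (n : nat).

Lemma grad_T2 (f : 'rV[R]_n -> R) g (F : torus R n -> R) x :
  periodic_rV f -> T2 f g -> (forall x, F x = f (torus_lift x)) ->
  grad F x = gradrow g (torus_lift x).
Proof.
move=> pf fg Ff; apply/rowP => i; rewrite !mxE.
have -> : F \o @to_torus R n = f by apply/funext => v; rewrite /= Ff periodic_lift.
exact: T2_derive.
Qed.

End gradient.

(** * Measurability and change of variables *)

Section lower_integral.
Local Open Scope ereal_scope.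
Context d (T : measurableType d) (R : realType).
Import HBNNSimple.

(* No measurability is required: the integral of a nonnegative function is the
   supremum of the integrals of the simple functions below it. *)
Lemma ge0_le_lower_integral (mu : {measure set T -> \bar R}) (f g : T -> \bar R) :
  (forall x, 0 <= f x) -> (forall x, f x <= g x) ->
  \int[mu]_x f x <= \int[mu]_x g x.
Proof.
move=> f0 fg; rewrite !ge0_integralTE//; last by move=> x; exact: le_trans (fg x).
apply: ge_ereal_sup => _ [h /= hf <-]; apply: ereal_sup_ubound; exists h => //= x.
exact: le_trans (hf x) (fg x).
Qed.

(** [Pr] and [exp_measure] integrate against plain set functions, where no lemma about measures
    applies. Still, such an integral is built from the values on measurable sets alone. *)
Lemma eq_setfun_integral (m1 m2 : set T -> \bar R) D (f : T -> \bar R) :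
  (forall A, measurable A -> m1 A = m2 A) ->
  \int[m1]_(x in D) f x = \int[m2]_(x in D) f x.
Proof.
move=> m12; rewrite /integral; have e (h : {nnsfun T >-> R}) : sintegral m1 h = sintegral m2 h.
  by apply: eq_fsbigr => r _; rewrite m12.
by congr (ereal_sup _ - ereal_sup _); apply: eq_imagel => h _; exact: e.
Qed.

End lower_integral.

Section pushforward_le.
Local Open Scope ereal_scope.
Context d1 d2 (X : measurableType d1) (Y : measurableType d2) (R : realType).
Context (mu : {measure set X -> \bar R}) (phi : {mfun X >-> Y}).
Import HBNNSimple.

(** [f] is not assumed measurable: a simple function below [f] pulls back to one below [f \o phi].
    This is the direction that bounds the cost of a plan from above. *)
Lemma le_integral_pushforward (f : Y -> \bar R) : (forall y, 0 <= f y) ->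
  \int[pushforward mu phi]_y f y <= \int[mu]_x f (phi x).
Proof.
move=> f0; rewrite [leLHS]ge0_integralTE//; apply: ge_ereal_sup => _ [h /= hf <-].
have := integral_nnsfun (pushforward mu phi) measurableT h.
rewrite patch_setT => <-; rewrite ge0_integral_pushforward//.
- by rewrite preimage_setT; apply: ge0_le_lower_integral => x; rewrite ?lee_fin//; exact: hf.
- exact/measurable_EFinP.
- by move=> y _; rewrite lee_fin.
Qed.

End pushforward_le.

Section weighted_transfer.
Local Open Scope ereal_scope.
Context d (T : measurableType d) (R : realType).
Import HBNNSimple.

Section one_side.
Context dX (X : measurableType dX) (m : {measure set X -> \bar R}).
Context (a : X -> T) (w : X -> R) (w0 : forall x, (0 <= w x)%R).
Context (wm : forall A, measurable A -> measurable_fun setT (fun x => w x * \1_A (a x))%R).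

Lemma weighted_nnsfunE (h : {nnsfun T >-> R}) x :
  (w x * h (a x) = \sum_(r \in range h) (r * (w x * \1_(h @^-1` [set r]) (a x))))%R.
Proof.
rewrite (fimfunE h (a x)) mulr_fsumr.
by apply: eq_fsbigr => r _; rewrite mulrCA.
Qed.

Lemma measurable_weighted_nnsfun (h : {nnsfun T >-> R}) :
  measurable_fun setT (fun x => w x * h (a x))%R.
Proof.
rewrite (_ : (fun x => _) = fun x => (\sum_(r \in range h) (r * (w x * \1_(h @^-1` [set r]) (a x))))%R); last first.
  by apply/funext => x; rewrite weighted_nnsfunE.
under eq_fun do rewrite fsbig_finite//=.
apply: measurable_sum => r; apply: measurable_funM => //.
exact: wm.
Qed.

Lemma integral_weighted_nnsfun (h : {nnsfun T >-> R}) :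
  \int[m]_x (w x * h (a x))%:E =
  \sum_(r \in range h) (r%:E * \int[m]_x (w x * \1_(h @^-1` [set r]) (a x))%:E).
Proof.
have i0 (A : set T) x : (0 <= w x * \1_A (a x))%R by rewrite mulr_ge0// indicE.
have r0 r x : (0 <= r * (w x * \1_(h @^-1` [set r]) (a x)))%R.
  rewrite mulrCA mulr_ge0//.
  by have := nnfun_muleindic_ge0 h r (a x); rewrite lee_fin.
under eq_integral do rewrite weighted_nnsfunE -fsumEFin//.
rewrite ge0_integral_fsum//; last 2 first.
- move=> r; apply/measurable_EFinP; apply: measurable_funM => //; exact: wm.
- by move=> r x _; rewrite lee_fin.
apply: eq_fsbigr => r /[!inE] -[x _ <-].
under eq_integral do rewrite EFinM.
rewrite ge0_integralZl_EFin//.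
- by move=> y _; rewrite lee_fin.
- by apply/measurable_EFinP; exact: wm.
Qed.

Context (h : T -> R) (mh : measurable_fun setT h) (h0 : forall x, (0 <= h x)%R).
Let mh' : measurable_fun setT (EFin \o h).
Proof. exact/measurable_EFinP. Qed.

Let h_ := nnsfun_approx measurableT mh'.

Let nd_h y : nondecreasing_seq (fun n => h_ n y).
Proof. by move=> i j ij; exact/lefP/nd_nnsfun_approx. Qed.

Let cvg_h y : h_ ^~ y @ \oo --> h y.
Proof.
have /fine_cvgP[_] : (EFin \o h_ ^~ y) @ \oo --> (h y)%:E; last exact.
by apply: cvg_nnsfun_approx => // z _; rewrite lee_fin.
Qed.

Lemma measurable_weighted : measurable_fun setT (fun x => w x * h (a x))%R.
Proof.
apply: (@measurable_fun_cvg _ _ _ _ (fun n x => w x * h_ n (a x))%R).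
  by move=> n; exact: measurable_weighted_nnsfun.
by move=> x _; apply: cvgMr; exact: cvg_h.
Qed.

Lemma cvg_integral_weighted :
  \int[m]_x (w x * h_ n (a x))%:E @[n --> \oo] --> \int[m]_x (w x * h (a x))%:E.
Proof.
have -> : \int[m]_x (w x * h (a x))%:E = \int[m]_x limn (fun n => (w x * h_ n (a x))%:E).
  apply: eq_integral => x _; apply/esym/cvg_lim => //.
  by apply: cvg_EFin; [exact: nearW|apply: cvgMr; exact: cvg_h].
apply: cvg_monotone_convergence => //.
- by move=> n; apply/measurable_EFinP; exact: measurable_weighted_nnsfun.
- by move=> n x _; rewrite lee_fin mulr_ge0.
- by move=> x _ i j ij; rewrite lee_fin ler_wpM2l//; exact: nd_h.
Qed.

End one_side.

Context dX (X : measurableType dX) (mX : {measure set X -> \bar R}).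
Context (a : X -> T) (w : X -> R) (w0 : forall x, (0 <= w x)%R).
Context (wm : forall A, measurable A -> measurable_fun setT (fun x => w x * \1_A (a x))%R).
Context dY (Y : measurableType dY) (mY : {measure set Y -> \bar R}).
Context (b : Y -> T) (z : Y -> R) (z0 : forall y, (0 <= z y)%R).
Context (zm : forall A, measurable A -> measurable_fun setT (fun y => z y * \1_A (b y))%R).
Context (ab : forall A, measurable A ->
  \int[mX]_x (w x * \1_A (a x))%:E = \int[mY]_y (z y * \1_A (b y))%:E).

(** Measurability is assumed of the weighted indicators only, not of [a], so there is no pushforward
    under [a] to integrate against. It is the situation of [cone_base], arbitrary at the apex, with
    the weight [r^2], which vanishes there. Equality on indicators passes to simple functions and,
    by monotone convergence, to [h]. *)
Lemma weighted_transfer (h : T -> R) : measurable_fun setT h -> (forall x, (0 <= h x)%R) ->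
  \int[mX]_x (w x * h (a x))%:E = \int[mY]_y (z y * h (b y))%:E.
Proof.
move=> mh h0; have cX := cvg_integral_weighted (m := mX) w0 wm mh h0.
have cY := cvg_integral_weighted (m := mY) z0 zm mh h0.
rewrite -(cvg_lim _ cX)// -(cvg_lim _ cY)//; congr (lim (_ @ \oo)).
apply/funext => n; rewrite !integral_weighted_nnsfun//.
by apply: eq_fsbigr => r _; rewrite ab.
Qed.

End weighted_transfer.

Section torus_measurability.
Context (R : realType) (n : nat).
Implicit Types (u v : 'rV[R]_n).

Lemma circle_dist_triangle (x y z : circle R) :
  circle_dist x z <= circle_dist x y + circle_dist y z.
Proof.
rewrite -(circle_liftK x) -(circle_liftK y) -(circle_liftK z).
set a := circle_lift x; set b := circle_lift y; set c := circle_lift z.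
have [k hk] := circle_dist_lb a b; have [m hm] := circle_dist_lb b c.
rewrite -[in leLHS](to_circleD2pi c (k + m)).
apply: (le_trans (circle_distE _ _)); apply: le_trans (lerD hk hm).
apply: le_trans (ler_normD _ _); rewrite le_eqVlt; apply/orP; left; apply/eqP.
by congr `|_|; rewrite intrD mulrDl; ring.
Qed.

Lemma measurable_circle_ball (x : circle R) (e : R) :
  measurable [set y | circle_dist x y < e].
Proof.
apply: sub_sigma_algebra => y /= xy; exists (e - circle_dist x y); first by rewrite subr_gt0.
move=> z yz; apply: (le_lt_trans (circle_dist_triangle x y z)).
by rewrite addrC -ltrBrDr.
Qed.

Lemma open_box (V : set 'rV[R]_n) v : open V -> V v ->
  exists2 e : R, 0 < e & forall u, (forall i, `|u 0 i - v 0 i| < e) -> V u.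
Proof.
rewrite openE => /(_ v)/[apply] /nbhs_ballP[e /= e0 eV]; exists e => // u uv.
by apply: eV; split => // i j; rewrite (ord1 i) /= /ball/= distrC; exact: uv.
Qed.

(** The lift is an arbitrary choice of representatives, but periodicity of [V] makes the choice
    immaterial. The set is then a countable union of products of open arcs with rational data, taken
    over those boxes that lie in [V]; countability is what the product sigma-algebra asks for. *)
Lemma measurable_lift_open (V : set 'rV[R]_n) : open V ->
  (forall v m, V v -> V (v + latticev R m)) ->
  measurable [set x : torus R n | V (torus_lift x)].
Proof.
move=> oV pV.
pose box (q : 'rV[rat]_n * rat) : set 'rV[R]_n :=
  [set v | forall i, `|v 0 i - ratr (q.1 0 i)| < ratr q.2].
pose Box (q : 'rV[rat]_n * rat) : set (torus R n) :=
  \bigcap_(i in [set: 'I_n]) ((fun x : torus R n => tnth x i) @^-1`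
    [set y | circle_dist (to_circle (ratr (q.1 0 i))) y < ratr q.2]).
pose F q := if `[< box q `<=` V >] then Box q else set0.
have mF q : measurable (F q).
  rewrite /F; case: ifP => // _; apply: fin_bigcap_measurable => // i _.
  rewrite -[X in measurable X]setTI; apply: (@measurable_tnth _ (circle R)) => //.
  exact: measurable_circle_ball.
suff -> : [set x : torus R n | V (torus_lift x)] = \bigcup_q F q.
  by apply: countable_bigcupT_measurable => //; exact: countableP.
apply/seteqP; split => [x /= Vx|x [q _]].
  have [e e0 eV] := open_box oV Vx.
  have /rat_in_itvoo[rho] : 0 < e / 2 by rewrite divr_gt0.
  rewrite in_itv/= => /andP[rho0 rhoe].
  have /choice[q hq] : forall i, exists q : rat, `|torus_lift x 0 i - ratr q| < ratr rho.
    move=> i; have /rat_in_itvoo[q] : torus_lift x 0 i - ratr rho < torus_lift x 0 i + ratr rho.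
      by rewrite ltrD2l gtrN.
    by rewrite in_itv/= => /andP[h1 h2]; exists q; rewrite ltr_norml; apply/andP; split; lra.
  exists (\row_i q i, rho) => //; rewrite /F; case: asboolP => [_|].
    move=> i _ /=; rewrite mxE -(circle_liftK (tnth x i)).
    apply: (le_lt_trans (circle_distE _ _)); rewrite distrC.
    by have := hq i; rewrite mxE.
  case=> u /= uq; apply: eV => i.
  have := uq i; rewrite mxE => h1; have := hq i => h2.
  have -> : u 0 i - torus_lift x 0 i = (u 0 i - ratr (q i)) - (torus_lift x 0 i - ratr (q i)) by ring.
  apply: (le_lt_trans (ler_normB _ _)); lra.
rewrite /F; case: asboolP => // bV Bx /=.
have /choice[z hz] : forall i, exists z : int,
    `|ratr (q.1 0 i) - (torus_lift x 0 i + z%:~R * (2 * pi))| < ratr q.2.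
  move=> i; have := Bx i I; rewrite /= -(circle_liftK (tnth x i)) => h.
  have [z hz] := circle_dist_lb (ratr (q.1 0 i)) (circle_lift (tnth x i)).
  by exists z; rewrite mxE; exact: le_lt_trans h.
have : V (torus_lift x + latticev R (\row_i z i)).
  apply: bV => i; rewrite distrC.
  have -> : (torus_lift x + latticev R (\row_i z i)) 0 i = torus_lift x 0 i + (z i)%:~R * (2 * pi).
    by rewrite !mxE.
  exact: hz.
move=> /(pV _ (- (\row_i z i))); congr V; apply/rowP => i.
by rewrite !mxE rmorphN mulNr addrK.
Qed.

Lemma measurable_lift_lsc (h : 'rV[R]_n -> R) : periodic_rV h ->
  (forall c, open [set v | c < h v]) ->
  measurable_fun setT (fun x : torus R n => h (torus_lift x)).
Proof.
move=> ph oh; apply: (measurability _ (RGenOInfty.measurableE R)) => //.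
move=> _ [_ [c ->] <-]; rewrite setTI.
rewrite [X in measurable X](_ : _ = [set x | [set v | c < h v] (torus_lift x)]).
  by apply: measurable_lift_open => // v m /=; rewrite ph.
by apply/seteqP; split => x /=; rewrite in_itv/= andbT.
Qed.

Lemma measurable_lift_continuous (h : 'rV[R]_n -> R) : periodic_rV h -> continuous h ->
  measurable_fun setT (fun x : torus R n => h (torus_lift x)).
Proof.
move=> ph ch; apply: measurable_lift_lsc => // c.
rewrite [X in open X](_ : _ = h @^-1` [set y | c < y])//.
by apply: open_comp => [v _|]; [exact: ch|exact: open_gt].
Qed.

Lemma T2_continuous (f : 'rV[R]_n -> R) g : T2 f g -> continuous f.
Proof.
move=> [C C0 h] v; apply/(@cvgrPdist_le _ _ _ (nbhs v) (nbhs_filter v)) => e e0.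
pose K := C * n%:R + 1; have K0 : 0 < K by rewrite ltr_wpDl// mulr_ge0.
have d0 : 0 < Num.min 1 (e ^+ 2 / K).
  by rewrite lt_min ltr01 divr_gt0// exprn_gt0.
apply/nbhs_ballP; exists (Num.min 1 (e ^+ 2 / K)) => //= u [_ uv].
have [_ _ _ /(_ (u - v))] := h v; rewrite (addrC v) subrK => fu.
rewrite distrC -ler_sqr ?nnegrE ?(ltW e0)// real_normK ?num_real//.
apply: (le_trans fu); apply: (@le_trans _ _ (C * \sum_(i < n) e ^+ 2 / K)).
  rewrite ler_wpM2l//; apply: ler_sum => i _; rewrite !mxE -expr2.
  have := uv 0 i; rewrite /ball/= lt_min distrC => /andP[u1 u2].
  rewrite -real_normK ?num_real// expr2; apply: le_trans (ltW u2).
  by rewrite ler_piMr// ltW.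
rewrite sumr_const card_ord -mulr_natr mulrA mulrAC -mulrA.
have -> : C * (n%:R * (e ^+ 2 / K)) = (C * n%:R) / K * e ^+ 2 by field; rewrite gt_eqF.
by rewrite ler_piMl ?sqr_ge0// ler_pdivrMr// mul1r lerDl.
Qed.

End torus_measurability.

Section pointwise_continuity.
Context (R : realType) (X : topologicalType) (x : X).
Implicit Types (f g : X -> R).

Lemma ctn_cst c : continuous_at x (fun=> c : R).
Proof. exact: cst_continuous. Qed.

Lemma ctnD f g : continuous_at x f -> continuous_at x g ->
  continuous_at x (fun u => f u + g u).
Proof. exact: continuousD. Qed.

Lemma ctnN f : continuous_at x f -> continuous_at x (fun u => - f u).
Proof. exact: continuousN. Qed.

Lemma ctnM f g : continuous_at x f -> continuous_at x g ->
  continuous_at x (fun u => f u * g u).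
Proof. exact: continuousM. Qed.

Lemma ctn_comp (h : R -> R) f : continuous_at x f -> continuous_at (f x) h ->
  continuous_at x (fun u => h (f u)).
Proof. exact: continuous_comp. Qed.

Lemma ctnX f k : continuous_at x f -> continuous_at x (fun u => f u ^+ k).
Proof. by move=> cf; apply: (ctn_comp (h := fun y => y ^+ k)) => //; exact: exprn_continuous. Qed.

Lemma ctn_sum (I : finType) (F : I -> X -> R) : (forall i, continuous_at x (F i)) ->
  continuous_at x (fun u => \sum_i F i u).
Proof.
move=> cF; suff H (r : seq I) : continuous_at x (fun u => \sum_(i <- r) F i u) by exact: H.
elim: r => [|i r ih].
  by rewrite (_ : (fun u => _) = fun=> 0); [exact: ctn_cst|apply/funext => u; rewrite big_nil].
rewrite (_ : (fun u => _) = fun u => F i u + \sum_(j <- r) F j u); first exact: ctnD.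
by apply/funext => u; rewrite big_cons.
Qed.

End pointwise_continuity.

Ltac ctn := repeat (first [ assumption | lazymatch goal with
  | |- continuous_at _ (fun u => @?f u + @?g u) => apply: (@ctnD _ _ _ f g)
  | |- continuous_at _ (fun u => - @?f u) => apply: (@ctnN _ _ _ f)
  | |- continuous_at _ (fun u => @?f u * @?g u) => apply: (@ctnM _ _ _ f g)
  | |- continuous_at _ (fun u => @?f u ^+ _) => apply: (@ctnX _ _ _ f)
  | |- continuous_at _ (fun u => \sum_i _) => apply: ctn_sum => ?
  | |- continuous_at _ (fun u => ?c) => exact: ctn_cst
  end]).

(** * Distance and measurability on the cone *)

Section cone_theory.
Context (R : realType) (n : nat).
Implicit Types (x : torus R n) (r : R) (c : cone R n).

Lemma to_cone_repr x r : cone_radius (to_cone x r) = `|r| /\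
  (r != 0 -> cone_base (to_cone x r) = x).
Proof.
rewrite /cone_radius /cone_base /to_cone.
set p := (x, `|r|%:nng); set q := repr _.
have : cone_rel q p by apply/eqquotP; exact: reprK.
rewrite /cone_rel => /orP[/eqP ->|/andP[/eqP q0 /eqP p0]]; first by split.
have r0 : `|r| = 0 by exact: p0.
by rewrite q0 r0; split => //; rewrite -normr_eq0 r0 eqxx.
Qed.

Lemma cone_radius_to_cone x r : cone_radius (to_cone x r) = `|r|.
Proof. by case: (to_cone_repr x r). Qed.

Lemma cone_base_to_cone x r : r != 0 -> cone_base (to_cone x r) = x.
Proof. by case: (to_cone_repr x r). Qed.

Lemma cone_radius_ge0 c : 0 <= cone_radius c.
Proof. by rewrite /cone_radius; exact: ge0. Qed.

Lemma cone_dist_sqr c c' : cone_dist c c' ^+ 2 =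
  cone_radius c ^+ 2 + cone_radius c' ^+ 2 - 2 * cone_radius c * cone_radius c'
    * cos (Num.min (torus_dist (cone_base c) (cone_base c')) pi).
Proof.
rewrite sqr_sqrtr//; set r := cone_radius c; set r' := cone_radius c'; set C := cos _.
have h : 2 * r * r' * C <= 2 * r * r'.
  by rewrite ler_piMr ?cos_le1// !mulr_ge0// cone_radius_ge0.
have := sqr_ge0 (r - r'); rewrite sqrrB; lra.
Qed.

Lemma cone_dist_ge0 c c' : 0 <= cone_dist c c'.
Proof. exact: sqrtr_ge0. Qed.

Lemma cone_dist_radius c c' : (cone_radius c - cone_radius c') ^+ 2 <= cone_dist c c' ^+ 2.
Proof.
rewrite cone_dist_sqr; set r := cone_radius c; set r' := cone_radius c'; set C := cos _.
have h : 2 * r * r' * C <= 2 * r * r'.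
  by rewrite ler_piMr ?cos_le1// !mulr_ge0// cone_radius_ge0.
by rewrite sqrrB; lra.
Qed.

Lemma cone_dist_le_radius c c' : cone_dist c c' ^+ 2 <= (cone_radius c + cone_radius c') ^+ 2.
Proof.
rewrite cone_dist_sqr; set r := cone_radius c; set r' := cone_radius c'; set C := cos _.
have h : 2 * r * r' * - C <= 2 * r * r'.
  rewrite ler_piMr//; first by rewrite !mulr_ge0// cone_radius_ge0.
  by rewrite lerNl cos_geN1.
by rewrite sqrrD; lra.
Qed.

Lemma cone_radius_lip c c' : `|cone_radius c - cone_radius c'| <= cone_dist c c'.
Proof.
rewrite -ler_sqr ?nnegrE ?cone_dist_ge0// real_normK ?num_real//.
exact: cone_dist_radius.
Qed.

Lemma cone_dist_to_cone_le (p q : 'rV[R]_n) r s : 0 < r -> 0 < s ->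
  cone_dist (to_cone (to_torus p) r) (to_cone (to_torus q) s) ^+ 2
  <= (r - s) ^+ 2 + r * s * dotv (p - q) (p - q).
Proof.
move=> r0 s0; rewrite cone_dist_sqr !cone_radius_to_cone !gtr0_norm//.
rewrite !cone_base_to_cone ?gt_eqF//; set d := torus_dist _ _; set m := Num.min d pi.
have d0 : 0 <= d by exact: torus_dist_ge0.
have dpq : d ^+ 2 <= dotv (p - q) (p - q).
  by rewrite -normv_sqr lerXn2r ?nnegrE ?normv_ge0// torus_dist_le.
have m0 : 0 <= m by rewrite le_min d0 pi_ge0.
have mpq : m ^+ 2 <= dotv (p - q) (p - q).
  apply: le_trans dpq; rewrite lerXn2r ?nnegrE//.
  by rewrite ge_min lexx.
have h := cos_ge2 m.
have rs : 0 < r * s by rewrite mulr_gt0.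
have : r * s * (1 - dotv (p - q) (p - q) / 2) <= r * s * cos m.
  by rewrite ler_pM2l//; lra.
by rewrite sqrrB; lra.
Qed.

Lemma measurable_cone_radius : measurable_fun [set: cone R n] (@cone_radius R n).
Proof.
apply: (measurability _ (RGenOInfty.measurableE R)) => //.
move=> _ [_ [a ->] <-]; rewrite setTI; apply: sub_sigma_algebra => c /=.
rewrite in_itv/= andbT => ac; exists (cone_radius c - a); first by rewrite subr_gt0.
move=> c' cc'; rewrite in_itv/= andbT.
have := cone_radius_lip c c'; rewrite ler_norml => /andP[_]; lra.
Qed.

(** Away from the apex the cone distance controls the base distance: if the latter is at least [e],
    then the squared cone distance is at least [2 r r' (1 - cos m)] with [m = min e pi]. *)
Lemma cone_base_near c e : 0 < cone_radius c -> 0 < e ->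
  exists2 d : R, 0 < d & forall c', cone_dist c c' < d ->
    0 < cone_radius c' /\ torus_dist (cone_base c) (cone_base c') < e.
Proof.
move=> r0 e0; set r := cone_radius c in r0 *.
have p0 := pi_gt0 R.
pose m := Num.min e pi; have m0 : 0 < m by rewrite lt_min e0 p0.
have mpi : m <= pi by rewrite ge_min lexx orbT.
have cm : cos m < 1.
  rewrite -cos0 ltr_cos// in_itv/= ?lexx ?pi_ge0// mpi andbT ltW//.
(* The first bound keeps [r'] above [r / 2]. Both together make the squared distance less than
   [r^2 (1 - cos m) / 4], against the lower bound [r^2 (1 - cos m)]. *)
pose d := Num.min (r / 2) (r / 2 * (1 - cos m)).
have k0 : 0 < 1 - cos m by rewrite subr_gt0.
have d0 : 0 < d by rewrite lt_min divr_gt0//= mulr_gt0// divr_gt0.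
exists d => // c'; rewrite lt_min => /andP[cr ck].
have r'0 : r / 2 < cone_radius c'.
  by have := cone_radius_lip c c'; rewrite ler_norml -/r => /andP[h1 h2]; lra.
split; first by apply: lt_trans r'0; rewrite divr_gt0.
rewrite ltNge; apply/negP => ed.
have := cone_dist_sqr c c'; rewrite -/r; set r' := cone_radius c' in r'0 *.
set M := Num.min _ pi.
have Mm : cos M <= cos m.
  have mM : m <= M by rewrite le_min ge_min ed/= mpi.
  have Mpi : M <= pi by rewrite ge_min lexx orbT.
  have M_itv : M \in `[0, pi] by rewrite in_itv/= Mpi andbT (le_trans (ltW m0)).
  have m_itv : m \in `[0, pi] by rewrite in_itv/= mpi andbT ltW.
  move: mM; rewrite le_eqVlt => /predU1P[<-//|mM].
  by apply: ltW; rewrite ltr_cos.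
move=> dE; have : cone_dist c c' ^+ 2 < (r / 2) * (r / 2 * (1 - cos m)).
  by rewrite expr2 ltr_pM ?cone_dist_ge0.
have : (r * r') * cos M <= (r * r') * cos m.
  by rewrite ler_wpM2l// mulr_ge0 ?(ltW r0)// ltW// (lt_trans _ r'0)// divr_gt0.
have : (r * (r / 2)) * (1 - cos m) <= (r * r') * (1 - cos m).
  by rewrite ler_wpM2r ?(ltW k0)// ler_wpM2l ?(ltW r0)// ltW.
have := sqr_ge0 (r - r'); rewrite dE sqrrB.
have : 0 <= r * r * (1 - cos m) by rewrite !mulr_ge0 ?(ltW r0) ?(ltW k0).
move: (cos M) (cos m) => C1 C2; lra.
Qed.

(* [cone_base] takes an arbitrary value at the apex, so only its restriction to
   positive radii is measurable. *)
Let base' c : torus R n := if 0 < cone_radius c then cone_base c else to_torus 0.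

Let measurable_base' : measurable_fun setT base'.
Proof.
apply/(@measurable_fun_tnthP _ _ _ (circle R)) => i.
apply: (@measurability _ _ _ _ _ _ (dist_open (@circle_dist R))) => //.
move=> _ [U oU <-]; rewrite setTI.
pose A := [set c | 0 < cone_radius c /\ U (tnth (cone_base c) i)].
have mA : measurable A.
  apply: sub_sigma_algebra => c [r0 Uc]; have [e e0 eU] := oU _ Uc.
  have [d d0 hd] := cone_base_near r0 e0; exists d => // c' /hd[r'0 de]; split => //.
  apply: eU; apply: le_lt_trans de; rewrite -[leLHS]ger0_norm ?circle_dist_ge0//.
  rewrite -sqrtr_sqr ler_wsqrtr// (bigD1 i)//= lerDl; apply: sumr_ge0 => j _.
  exact: sqr_ge0.
have mr : measurable [set c : cone R n | 0 < cone_radius c].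
  have := measurable_cone_radius measurableT (measurable_itv `]0, +oo[).
  rewrite setTI; congr measurable; apply/seteqP.
  by split => c /=; rewrite in_itv/= andbT.
rewrite [X in measurable X](_ : _ = A `|` ((~` [set c | 0 < cone_radius c]) `&` [set c | U (tnth (to_torus (0 : 'rV[R]_n)) i)])); last first.
  apply/seteqP; split => c /=; rewrite /base' /A /=; case: ifPn => r0.
  - by left.
  - by move=> Uc; right; split => //; exact/negP.
  - by case=> [[]//|[]].
  - by case=> [[]|[]] // h; rewrite h in r0.
apply: measurableU => //; apply: measurableI; first exact: measurableC.
have [h|h] := pselect (U (tnth (to_torus (0 : 'rV[R]_n)) i)).
  by rewrite [X in measurable X](_ : _ = setT)//; apply/seteqP; split.
by rewrite [X in measurable X](_ : _ = set0)//; apply/seteqP; split.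
Qed.

Lemma measurable_cone_weight (A : set (torus R n)) : measurable A ->
  measurable_fun [set: cone R n] (fun c => cone_radius c ^+ 2 * \1_A (cone_base c)).
Proof.
move=> mA; rewrite (_ : (fun c => _) = fun c => cone_radius c ^+ 2 * \1_A (base' c)).
  apply: measurable_funM; first by apply: measurable_funX; exact: measurable_cone_radius.
  by apply: measurableT_comp => //; exact: measurable_indic.
apply/funext => c; rewrite /base'; case: ifPn => //.
rewrite lt_neqAle cone_radius_ge0 andbT negbK => /eqP <-.
by rewrite expr0n/= !mul0r.
Qed.

Lemma measurable_to_cone_lift (p : 'rV[R]_n -> 'rV[R]_n) (r : 'rV[R]_n -> R) :
    (forall i, continuous (fun v => p v 0 i)) -> continuous r -> (forall v, 0 < r v) ->
    (forall v m, p (v + latticev R m) = p v + latticev R m) -> periodic_rV r ->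
  measurable_fun setT (fun x : torus R n => to_cone (to_torus (p (torus_lift x))) (r (torus_lift x))).
Proof.
move=> cp cr r0 pp pr; apply: (@measurability _ _ _ _ _ _ (dist_open (@cone_dist R n))) => //.
move=> _ [U oU <-]; rewrite setTI.
pose V := [set v | U (to_cone (to_torus (p v)) (r v))].
apply: (@measurable_lift_open _ _ V); last first.
  by move=> v m; rewrite /V/= pp pr to_torusD.
rewrite openE => v /oU[e e0 eU]; rewrite /interior.
pose D u := (r v - r u) ^+ 2 + r v * r u * \sum_i (p v 0 i - p u 0 i) ^+ 2.
have cD : {for v, continuous D}.
  have cr' : continuous_at v r by exact: cr.
  suff : continuous_at v D by [].
  by rewrite /D; ctn; exact: cp.
have Dv : D v = 0.
  rewrite /D subrr expr0n/= add0r big1 ?mulr0// => i _.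
  by rewrite subrr expr0n.
have : \forall u \near v, D u < e ^+ 2.
  have := cD (`]-oo, e ^+ 2[)%classic; apply.
  by rewrite Dv; apply: lt_nbhsl; rewrite exprn_gt0.
apply: filterS => u Du; apply: eU.
rewrite -ltr_sqr ?nnegrE ?cone_dist_ge0 ?(ltW e0)//.
apply: le_lt_trans Du; apply: (le_trans (cone_dist_to_cone_le _ _ (r0 v) (r0 u))).
rewrite lerD2l ler_wpM2l ?mulr_ge0 ?(ltW (r0 _))//.
by rewrite le_eqVlt; apply/orP; left; apply/eqP/eq_bigr => i _; rewrite !mxE expr2.
Qed.

End cone_theory.

Section continuous_disp.
Context (R : realType) (n : nat) (X : topologicalType) (x : X).
Context (A : X -> R) (w : X -> 'rV[R]_n).
Context (cA : continuous_at x A) (A0 : A x != 0)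
  (cw : forall i, continuous_at x (fun u => w u 0 i)).

Lemma continuous_dotv : continuous_at x (fun u => dotv (w u) (w u)).
Proof. by rewrite /dotv; ctn; exact: cw. Qed.

Lemma continuous_normv : continuous_at x (fun u => normv (w u)).
Proof. exact: (ctn_comp continuous_dotv (@sqrt_continuous _ _)). Qed.

Let angle : continuous_at x (fun u => atan (normv (w u) / A u)).
Proof.
apply: (@ctn_comp _ _ _ (@atan R) (fun u => normv (w u) / A u)).
  by apply: ctnM; [exact: continuous_normv|exact: continuousV].
exact: continuous_atan.
Qed.

(** Where [w] vanishes its direction need not have a limit, but the length of [disp] is the absolute
    value of the angle, which tends to [0] there. *)
Lemma continuous_disp i : continuous_at x (fun u => disp (A u) (w u) 0 i).
Proof.
have [w0|w0] := eqVneq (normv (w x)) 0; last first.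
  rewrite (_ : (fun u => _) = fun u => atan (normv (w u) / A u) * (normv (w u))^-1 * w u 0 i).
    apply: ctnM; last exact: cw; apply: ctnM; first exact: angle.
    by apply: (@continuousV _ _ (fun u => normv (w u))) => //; exact: continuous_normv.
  by apply/funext => u; rewrite mxE.
apply/(@cvgrPdist_lt _ _ _ (nbhs x) (nbhs_filter x)) => e e0.
have -> : disp (A x) (w x) 0 i = 0 by rewrite (normv_eq0 w0) !mxE mulr0.
have := angle; move=> /(@cvgrPdist_lt _ _ _ (nbhs x) (nbhs_filter x))/(_ e e0).
rewrite w0 mul0r atan0; apply: filterS => u; rewrite !sub0r !normrN; apply: le_lt_trans.
rewrite -ler_sqr ?nnegrE// !real_normK ?num_real// -dotv_disp.
exact: sqr_coord_le.
Qed.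

End continuous_disp.

(** * The exponential of a measure as an image of the volume *)

Section exponential.
Context (R : realType) (n : nat).
Local Notation M := (torus R n).
Local Notation mu := (torus_volume R n).
Context (f : 'rV[R]_n -> R) (g : 'I_n -> 'rV[R]_n -> R) (h : 'I_n -> 'I_n -> 'rV[R]_n -> R).
Context (Tf : T2 f g) (Tg : forall i, T2 (g i) (h i)).
Context (pf : periodic_rV f) (pg : forall i, periodic_rV (g i)).
Context (F : M -> R) (FE : forall x, F x = f (torus_lift x)).
Context (s : R) (A0 : forall v, 0 < 1 + 2 * (s * f v)).

Definition exp_point (x : M) : cone R n :=
  to_cone (to_torus (torus_lift x + exp_shift f g s (torus_lift x)))
    (Num.sqrt (mass f g s (torus_lift x))).

Lemma mass_gt0 v : 0 < mass f g s v.
Proof. by rewrite ltr_wpDr ?exprn_gt0// mulr_ge0 ?sqr_ge0// dotvv_ge0. Qed.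

Lemma measurable_exp_point : measurable_fun setT exp_point.
Proof.
have cf v : continuous_at v f by exact: T2_continuous Tf v.
have cg i v : continuous_at v (g i) by exact: T2_continuous (Tg i) v.
have cA v : continuous_at v (fun u => 1 + 2 * (s * f u)) by ctn.
have cw i v : continuous_at v (fun u => (s *: gradrow g u) 0 i).
  rewrite (_ : (fun u => _) = fun u => s * g i u); last by apply/funext => u; rewrite !mxE.
  by ctn.
have pgr v m : gradrow g (v + latticev R m) = gradrow g v.
  by apply/rowP => i; rewrite !mxE pg.
apply: (measurable_to_cone_lift (p := fun v => v + exp_shift f g s v) (r := fun v => Num.sqrt (mass f g s v))).
- move=> i v; have -> : (fun u : 'rV[R]_n => (u + exp_shift f g s u) 0 i) = fun u => u 0 i + exp_shift f g s u 0 i.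
    by apply/funext => u; rewrite mxE.
  apply: ctnD; first exact: coord_continuous.
  by apply: continuous_disp => //; rewrite gt_eqF.
- move=> v; apply: (ctn_comp (h := @Num.sqrt R)); last exact: sqrt_continuous.
  rewrite /mass; have cfv := cf v; ctn; apply: continuous_dotv => i.
  rewrite (_ : (fun u => _) = g i); first exact: cg.
  by apply/funext => u; rewrite mxE.
- by move=> v; rewrite sqrtr_gt0 mass_gt0.
- by move=> v m; rewrite /exp_shift pf pgr addrAC.
- by move=> v m; rewrite /mass pf pgr.
Qed.

Definition exp_point_mfun : {mfun M >-> cone R n} :=
  HB.pack exp_point (isMeasurableFun.Build _ _ _ _ _ measurable_exp_point).

Lemma cone_exp_point (x : M) : let c := to_cone x 1 in
  cone_exp c (grad (fun y => s * F y) (cone_base c))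
      (2 * cone_radius c * (s * F (cone_base c))) = exp_point x.
Proof.
move=> c; have r1 : cone_radius c = 1 by rewrite cone_radius_to_cone normr1.
have bx : cone_base c = x by rewrite cone_base_to_cone// oner_eq0.
have pZ : periodic_rV (fun v => s * f v) by move=> v m; rewrite pf.
have sF y : s * F y = s * f (torus_lift y) by rewrite FE.
rewrite /cone_exp r1 bx (grad_T2 (g := fun i v => s * g i v) x pZ (T2_Z s Tf) sF).
have -> : gradrow (fun i v => s * g i v) (torus_lift x) = s *: gradrow g (torus_lift x).
  by apply/rowP => i; rewrite !mxE.
rewrite sF; set w := s *: _; rewrite !mulr1 !mul1r expr1n mul1r normv_sqr.
rewrite /exp_point /mass /exp_shift /disp -/w; congr to_cone.
  case: eqP => [->|//]; by rewrite scaler0 addr0 torus_liftK.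
have -> // : dotv w w = s ^+ 2 * dotv (gradrow g (torus_lift x)) (gradrow g (torus_lift x)).
by rewrite /w dotvZl dotvZr mulrA -expr2.
Qed.

(** The volume has mass one, so [hat_measure] is its image under [x |-> to_cone x 1], and the cone
    exponential at that point is [exp_point x]. The two set functions need to be compared on
    measurable sets only. *)
Lemma exp_measureE B :
  exp_measure mu (fun y => s * F y) B = Pr (pushforward mu exp_point) B.
Proof.
apply: eq_setfun_integral => D mD; rewrite /pushforward /hat_measure /=.
have r1 : total_radius mu = 1.
  rewrite -[RHS]sqrtr1; congr Num.sqrt.
  exact: (congr1 fine (probability_setT mu)).
rewrite r1 expr1n invr1 mul1e /pushforward /product_measure1.
transitivity (\int[mu]_x (\1_(exp_point @^-1` D) x)%:E)%E.
  apply: eq_integral => x _ /=; rewrite /dirac indicE indicE; congr ((_ : bool)%:R%:E).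
  by rewrite mem_xsection; apply/idP/idP; rewrite !inE /= cone_exp_point.
rewrite integral_indic ?setIT//.
by rewrite -[X in measurable X]setTI; exact: measurable_exp_point.
Qed.

End exponential.

(** * Plans and weak duality *)

Section HK_bounds.
Context (R : realType) (n : nat).
Local Notation M := (torus R n).
Local Notation C := (cone R n).

Lemma PrE (nu : set C -> \bar R) (A : set M) :
  Pr nu A = (\int[nu]_c (cone_radius c ^+ 2 * \1_A (cone_base c))%:E)%E.
Proof.
rewrite /Pr /integral patch_setT.
suff -> : (fun c : C => (cone_radius c ^+ 2)%:E) \_ (@cone_base R n @^-1` A) =
    (fun c => (cone_radius c ^+ 2 * \1_A (cone_base c))%:E) by [].
apply/funext => c; rewrite /patch indicE; have [h|h] := boolP (c \in _).
  by rewrite mem_set ?mulr1//; move: h; rewrite inE.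
by rewrite memNset ?mulr0// => h'; move/negP: h; apply; rewrite inE.
Qed.

Context d (X : measurableType d) (P : probability X R) (Phi0 Phi1 : {mfun X >-> C}).
Context (mu0 mu1 : set M -> \bar R).
Context (mu0E : forall A, measurable A -> mu0 A = Pr (pushforward P Phi0) A)
  (mu1E : forall A, measurable A -> mu1 A = Pr (pushforward P Phi1) A).
Context (K : R) (rK0 : forall x, cone_radius (Phi0 x) <= K)
  (rK1 : forall x, cone_radius (Phi1 x) <= K).

Let Phi (x : X) : C * C := (Phi0 x, Phi1 x).
Let mPhi : measurable_fun setT Phi.
Proof. by apply/measurable_fun_pair; exact: measurable_funP. Qed.
Let Phi_mfun : {mfun X >-> (C * C)%type} :=
  HB.pack Phi (isMeasurableFun.Build _ _ _ _ _ mPhi).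

Let le_integral_plan (f : C * C -> R) (b : R) : (forall z, 0 <= f z) ->
  (forall x, f (Phi x) <= b) ->
  (\int[pushforward P Phi_mfun]_z (f z)%:E <= b%:E)%E.
Proof.
move=> f0 fb; have := @le_integral_pushforward _ _ _ _ _ P Phi_mfun (EFin \o f).
move=> /(_ (fun z => f0 z)) h; apply: (le_trans h).
apply: (@le_trans _ _ (\int[P]_x (cst b%:E x))%E).
  by apply: ge0_le_lower_integral => x; rewrite lee_fin//; exact: fb.
by rewrite integral_cst// [X in (_ * X)%E](_ : _ = 1%E) ?mule1//; exact: probability_setT.
Qed.

Lemma HK_plan_pushforward : HK_plan mu0 mu1 (distribution P Phi_mfun).
Proof.
split.
  exists (point, point).
  pose b : R := 1 + 2 * (K + cone_radius (point : C)) ^+ 2.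
  apply: (@le_lt_trans _ _ b%:E); last exact: ltry.
  apply: (le_integral_plan (f := fun z => 1 + cone2_dist z (point, point) ^+ 2)) => [z|x].
    by rewrite addr_ge0// sqr_ge0.
  rewrite /b lerD2l sqr_sqrtr ?addr_ge0 ?sqr_ge0//= mulr_natl mulr2n.
  have h (c : C) : cone_radius c <= K -> cone_dist c point ^+ 2 <= (K + cone_radius (point : C)) ^+ 2.
    move=> cK; apply: (le_trans (cone_dist_le_radius _ _)).
    have := cone_radius_ge0 c; have := cone_radius_ge0 (point : C) => p0 c0.
    by rewrite lerXn2r ?nnegrE ?addr_ge0 ?lerD2r// (le_trans c0).
  by apply: lerD; apply: h.
move=> A mA; split; first by rewrite mu0E.
by rewrite mu1E.
Qed.

Lemma HK_plan_cost_le (f : X -> R) :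
  (forall x, cone_dist (Phi0 x) (Phi1 x) ^+ 2 <= f x) ->
  exists2 q : {measure set (C * C) -> \bar R}, HK_plan mu0 mu1 q &
   (\int[q]_z (cone_dist z.1 z.2 ^+ 2)%:E <= \int[P]_x (f x)%:E)%E.
Proof.
move=> df; exists (distribution P Phi_mfun); first exact: HK_plan_pushforward.
apply: (@le_trans _ _ (\int[P]_x (cone_dist (Phi0 x) (Phi1 x) ^+ 2)%:E)%E).
  apply: (@le_integral_pushforward _ _ _ _ _ P Phi_mfun (fun z => (cone_dist z.1 z.2 ^+ 2)%:E)).
  by move=> z; rewrite lee_fin sqr_ge0.
by apply: ge0_le_lower_integral => x; rewrite lee_fin// sqr_ge0.
Qed.

Context (q : {measure set (C * C) -> \bar R}) (qplan : HK_plan mu0 mu1 q).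

(** A plan prescribes its marginals only through [Pr]. Hence the integrals that can be carried over
    to [P] are those of [r^2] times a function of the base point. *)
Let transfer (i : {mfun (C * C)%type >-> C}) (Ps : {mfun X >-> C}) (h : M -> R) :
    (forall A, measurable A -> Pr (pushforward q i) A = Pr (pushforward P Ps) A) ->
    measurable_fun setT h -> (forall x, 0 <= h x) ->
  (\int[q]_z (cone_radius (i z) ^+ 2 * h (cone_base (i z)))%:E =
   \int[P]_x (cone_radius (Ps x) ^+ 2 * h (cone_base (Ps x)))%:E)%E.
Proof.
move=> iP mh h0; have w0 (c : C) : 0 <= cone_radius c ^+ 2 by rewrite sqr_ge0.
have wm := @measurable_cone_weight R n.
have mwh := measurable_weighted wm mh h0.
have e : (\int[pushforward q i]_c (cone_radius c ^+ 2 * h (cone_base c))%:E =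
    \int[pushforward P Ps]_c (cone_radius c ^+ 2 * h (cone_base c))%:E)%E.
  by apply: weighted_transfer => // A mA; rewrite -!PrE iP.
have pf d' (Y : measurableType d') (m : {measure set Y -> \bar R}) (j : {mfun Y >-> C}) :
    (\int[pushforward m j]_c (cone_radius c ^+ 2 * h (cone_base c))%:E =
     \int[m]_x (cone_radius (j x) ^+ 2 * h (cone_base (j x)))%:E)%E.
  rewrite ge0_integral_pushforward ?preimage_setT//; first exact/measurable_EFinP.
  by move=> c _; rewrite lee_fin mulr_ge0.
by rewrite -!pf.
Qed.

Let fst_mfun : {mfun (C * C)%type >-> C} :=
  HB.pack (@fst C C) (isMeasurableFun.Build _ _ _ _ _ (@measurable_fst _ _ C C)).
Let snd_mfun : {mfun (C * C)%type >-> C} :=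
  HB.pack (@snd C C) (isMeasurableFun.Build _ _ _ _ _ (@measurable_snd _ _ C C)).

Context (f0 f1 : M -> R) (mf0 : measurable_fun setT f0) (mf1 : measurable_fun setT f1)
  (f00 : forall x, 0 <= f0 x) (f10 : forall x, 0 <= f1 x).
Context (B : R) (f0B : forall x, f0 x <= B) (f1B : forall x, f1 x <= B).

Definition dual_density x : R :=
  cone_radius (Phi0 x) ^+ 2 + cone_radius (Phi1 x) ^+ 2
  - (cone_radius (Phi0 x) ^+ 2 * f0 (cone_base (Phi0 x)) + cone_radius (Phi1 x) ^+ 2 * f1 (cone_base (Phi1 x))).

(** Integrate the pointwise inequality against [q]. All terms but the cost are [r^2] times a
    function of one base point, the constant [1] included, so their integrals do not depend on the
    plan and can be computed on [P]. *)
Lemma HK_weak_duality :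
  (forall c c', cone_radius c ^+ 2 + cone_radius c' ^+ 2
    <= cone_dist c c' ^+ 2 + (cone_radius c ^+ 2 * f0 (cone_base c) + cone_radius c' ^+ 2 * f1 (cone_base c'))) ->
  P.-integrable setT (EFin \o dual_density) /\
  (\int[P]_x (dual_density x)%:E <= \int[q]_z (cone_dist z.1 z.2 ^+ 2)%:E)%E.
Proof.
move=> dual; have [_ qP] := qplan.
have q0 A : measurable A -> Pr (pushforward q fst_mfun) A = Pr (pushforward P Phi0) A.
  by move=> mA; have [e _] := qP A mA; rewrite -mu0E// -e.
have q1 A : measurable A -> Pr (pushforward q snd_mfun) A = Pr (pushforward P Phi1) A.
  by move=> mA; have [_ e] := qP A mA; rewrite -mu1E// -e.
pose w (c : C) := cone_radius c ^+ 2.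
have w0 (c : C) : 0 <= w c by rewrite sqr_ge0.
have wm := @measurable_cone_weight R n.
have m1 : measurable_fun setT (fun _ : M => 1 : R) by exact: measurable_cst.
have mw (h : M -> R) : measurable_fun setT h -> (forall x, 0 <= h x) ->
    measurable_fun setT (fun c : C => w c * h (cone_base c)).
  by move=> mh h0; exact: (measurable_weighted wm mh h0).
have intP (Ps : {mfun X >-> C}) (h : M -> R) : (forall x, cone_radius (Ps x) <= K) ->
    measurable_fun setT h -> (forall x, 0 <= h x) -> (exists b, forall x, h x <= b) ->
    P.-integrable setT (fun x => (w (Ps x) * h (cone_base (Ps x)))%:E).
  move=> rK mh h0 [b hb].
  have mwh : measurable_fun setT (fun x => w (Ps x) * h (cone_base (Ps x))).
    by apply: (measurableT_comp (mw _ mh h0)).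
  apply: (@le_integrable _ _ _ P setT measurableT _ (cst (K ^+ 2 * b)%:E)).
  - exact/measurable_EFinP.
  - move=> x _ /=; have b0 : 0 <= b := le_trans (h0 (to_torus 0)) (hb _).
    have wK : w (Ps x) <= K ^+ 2.
      by rewrite lerXn2r ?nnegrE ?cone_radius_ge0// (le_trans (cone_radius_ge0 _) (rK x)).
    rewrite lee_fin ger0_norm; last by rewrite mulr_ge0.
    by rewrite ger0_norm; [exact: ler_pM|rewrite mulr_ge0// sqr_ge0].
  - exact: finite_measure_integrable_cst.
have intq (i : {mfun (C * C)%type >-> C}) (Ps : {mfun X >-> C}) (h : M -> R) :
    (forall A, measurable A -> Pr (pushforward q i) A = Pr (pushforward P Ps) A) ->
    (forall x, cone_radius (Ps x) <= K) ->
    measurable_fun setT h -> (forall x, 0 <= h x) -> (exists b, forall x, h x <= b) ->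
    q.-integrable setT (fun z => (w (i z) * h (cone_base (i z)))%:E).
  move=> iP rK mh h0 hb; have /integrableP[mI fI] := intP Ps h rK mh h0 hb.
  apply/integrableP; split.
    by apply/measurable_EFinP; apply: (measurableT_comp (mw _ mh h0)).
  rewrite (eq_integral (fun z => (w (i z) * h (cone_base (i z)))%:E)); last first.
    by move=> z _; rewrite gee0_abs// lee_fin; apply: mulr_ge0; [exact: w0|exact: h0].
  rewrite (transfer iP mh h0).
  move: fI; rewrite (eq_integral (fun x => (w (Ps x) * h (cone_base (Ps x)))%:E))//.
  by move=> x _; rewrite gee0_abs// lee_fin; apply: mulr_ge0; [exact: w0|exact: h0].
have b1 : exists b, forall x : M, (fun=> 1) x <= b :> R by exists 1.
have bf0 : exists b, forall x, f0 x <= b by exists B.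
have bf1 : exists b, forall x, f1 x <= b by exists B.
have l01 (x : M) : 0 <= (fun=> 1 : R) x by [].
have P0 := intP Phi0 _ rK0 m1 l01 b1; have P1 := intP Phi1 _ rK1 m1 l01 b1.
have Pf0 := intP Phi0 _ rK0 mf0 f00 bf0; have Pf1 := intP Phi1 _ rK1 mf1 f10 bf1.
have Q0 := intq fst_mfun _ _ q0 rK0 m1 l01 b1; have Q1 := intq snd_mfun _ _ q1 rK1 m1 l01 b1.
have Qf0 := intq fst_mfun _ _ q0 rK0 mf0 f00 bf0; have Qf1 := intq snd_mfun _ _ q1 rK1 mf1 f10 bf1.
have e : EFin \o dual_density = ((fun x => (w (Phi0 x) * 1)%:E) \+ (fun x => (w (Phi1 x) * 1)%:E)
  \- ((fun x => (w (Phi0 x) * f0 (cone_base (Phi0 x)))%:E)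
     \+ (fun x => (w (Phi1 x) * f1 (cone_base (Phi1 x)))%:E)))%E.
  by apply/funext => x; rewrite /dual_density /= !mulr1 /w.
have iP01 := integrableD measurableT P0 P1; have iPf := integrableD measurableT Pf0 Pf1.
split; first by rewrite e; exact: integrableB.
pose g (z : C * C) : R := w z.1 * 1 + w z.2 * 1 - (w z.1 * f0 (cone_base z.1) + w z.2 * f1 (cone_base z.2)).
have eg : EFin \o g = ((fun z => (w (fst_mfun z) * 1)%:E) \+ (fun z => (w (snd_mfun z) * 1)%:E)
  \- ((fun z => (w (fst_mfun z) * f0 (cone_base (fst_mfun z)))%:E)
     \+ (fun z => (w (snd_mfun z) * f1 (cone_base (snd_mfun z)))%:E)))%E.
  by apply/funext.
have iQ01 := integrableD measurableT Q0 Q1; have iQf := integrableD measurableT Qf0 Qf1.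
have -> : (\int[P]_x (dual_density x)%:E = \int[q]_z (g z)%:E)%E.
  rewrite -[LHS]/(\int[P]_x (EFin \o dual_density) x)%E -[RHS]/(\int[q]_z (EFin \o g) z)%E e eg.
  rewrite !integralB// !integralD//.
  congr (_ + _ - (_ + _))%E; apply: esym.
  - exact: (transfer q0 m1 l01).
  - exact: (transfer q1 m1 l01).
  - exact: (transfer q0 mf0 f00).
  - exact: (transfer q1 mf1 f10).
(* Passing to the positive part of [g] makes both integrands nonnegative; comparing lower integrals
   then avoids the measurability of the cost. *)
apply: (@le_trans _ _ (\int[q]_z ((EFin \o g)^\+ z))%E).
  rewrite -[leLHS]/(\int[q]_z (EFin \o g) z)%E integralE.
  by apply: geeDl; rewrite leeNl oppe0; apply: integral_ge0.
apply: ge0_le_lower_integral => // z; rewrite funeposE ge_max lee_fin lee_fin sqr_ge0 andbT.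
by rewrite /g /w !mulr1 lerBlDr; exact: dual.
Qed.

End HK_bounds.

(** * Means of trigonometric products *)

Section bounded_integrable.
Context d (T : measurableType d) (R : realType) (P : probability T R).

Lemma bounded_integrable (f : T -> R) B : measurable_fun setT f ->
  (forall x, `|f x| <= B) -> P.-integrable setT (EFin \o f).
Proof.
move=> mf fB; apply: (@le_integrable _ _ _ P setT measurableT _ (cst B%:E)).
- exact/measurable_EFinP.
- by move=> x _; rewrite /= lee_fin (le_trans (fB x))// ler_norm.
- exact: finite_measure_integrable_cst.
Qed.

End bounded_integrable.

Section integral_probability_power.
Context d (T : measurableType d) (R : realType) (P : probability T R).

Lemma measurable_prod_tnth n (F : 'I_n -> T -> R) :
  (forall p, measurable_fun setT (F p)) ->
  measurable_fun setT (fun x : n.-tuple T => \prod_p F p (tnth x p)).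
Proof.
move=> mF; apply: measurable_prod => p _.
by apply: measurableT_comp => //; exact: measurable_tnth.
Qed.

Lemma integral_probability_power n (F : 'I_n -> T -> R) c :
    (forall p, measurable_fun setT (F p)) ->
    (forall p, exists B, forall y, `|F p y| <= B) ->
    (forall p, \int[P]_y (F p y)%:E = (c p)%:E)%E ->
  (\int[probability_power P n]_x (\prod_p F p (tnth x p))%:E = (\prod_p c p)%:E)%E.
Proof.
elim: n F c => [|n ih] F c mF bF cF.
  rewrite big_ord0; under eq_integral do rewrite big_ord0.
  by rewrite integral_cst// [X in (_ * X)%E](_ : _ = 1%E) ?mule1//; exact: probability_setT.
pose F' p := F (lift ord0 p); pose c' p := c (lift ord0 p).
have [B0 hB0] := bF ord0.
have /choice[B hB] : forall p, exists B, forall y, `|F' p y| <= B by move=> p; exact: bF.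
have mF' := measurable_prod_tnth (fun p => mF (lift ord0 p)).
have bF' (x : n.-tuple T) : `|\prod_p F' p (tnth x p)| <= \prod_p B p.
  by rewrite normr_prod; apply: ler_prod => p _; rewrite normr_ge0 hB.
have B00 : 0 <= B0 by exact: le_trans (hB0 point).
have BB0 : 0 <= \prod_p B p.
  by apply: prodr_ge0 => p _; exact: le_trans (hB p point).
have mf : measurable_fun setT (fun x : T * n.-tuple T => F ord0 x.1 * \prod_p F' p (tnth x.2 p)).
  apply: measurable_funM; first exact: measurableT_comp (mF ord0) measurable_fst.
  exact: measurableT_comp mF' measurable_snd.
have eF : ((fun x : n.+1.-tuple T => (\prod_p F p (tnth x p))%:E) \o @tuple_cons _ T n) =
    EFin \o (fun x : T * n.-tuple T => F ord0 x.1 * \prod_p F' p (tnth x.2 p)).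
  apply/funext => x /=; rewrite big_ord_recl; congr (_ * _)%:E.
  by apply: eq_bigr => p _; rewrite tnthS.
have iF : (P \x probability_power P n)%E.-integrable setT
    (EFin \o (fun x : T * n.-tuple T => F ord0 x.1 * \prod_p F' p (tnth x.2 p))).
  apply: (@bounded_integrable _ _ _ (P \x probability_power P n)%E _ (B0 * \prod_p B p)) => // x.
  by rewrite normrM ler_pM.
rewrite /= integral_distribution; last 2 first.
- by apply/measurable_EFinP; exact: measurable_prod_tnth.
- by rewrite eF.
rewrite eF -integral12_prod_meas1//.
transitivity (\int[P]_x ((F ord0 x)%:E * (\prod_p c' p)%:E))%E.
  apply: eq_integral => x _; rewrite /fubini_F /=.
  under eq_integral do rewrite EFinM.
  rewrite integralZl//; last exact: (@bounded_integrable _ _ _ (probability_power P n) _ _ mF' bF').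
  by rewrite (ih F' c' (fun p => mF _) (fun p => bF _) (fun p => cF _)).
rewrite integralZr//; last exact: (@bounded_integrable _ _ _ P _ _ (mF ord0) hB0).
by rewrite cF big_ord_recl EFinM.
Qed.

End integral_probability_power.

Section circle_mean.
Context (R : realType).
Local Notation T := (2 * pi : R).

Lemma measurable_circle_lift (G : R -> R) : continuous G ->
  (forall y (z : int), G (y + z%:~R * T) = G y) ->
  measurable_fun setT (fun y : circle R => G (circle_lift y)).
Proof.
move=> cG pG; apply: (measurability _ (RGenOInfty.measurableE R)) => //.
move=> _ [_ [c ->] <-]; rewrite setTI; apply: sub_sigma_algebra => y /=.
rewrite in_itv/= andbT => cy.
have : \forall x \near circle_lift y, c < G x.
  by have /cvgr_gt := cG (circle_lift y); apply.
move=> /nbhs_ballP[e /= e0 eG]; exists e => // y'.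
rewrite -{1}(circle_liftK y) -{1}(circle_liftK y') => yy'.
have [z hz] := circle_dist_lb (circle_lift y) (circle_lift y').
by rewrite in_itv/= andbT -(pG _ z); apply: eG; exact: le_lt_trans yy'.
Qed.

Lemma integral_circle (G H : R -> R) (B : R) : (forall x : R, is_derive x 1 H (G x)) ->
    continuous G -> (forall y (z : int), G (y + z%:~R * T) = G y) ->
    (forall x, `|G x| <= B) ->
  (\int[circle_prob R]_y (G (circle_lift y))%:E = ((H T - H 0) / T)%:E)%E.
Proof.
move=> dH cG pG GB.
have mG := measurable_circle_lift cG pG.
have pG' (x : R) : G (circle_lift (to_circle x)) = G x.
  by have [z ->] := to_circle_lift x.
have T0 : 0 < T by exact: two_pi_gt0.
have GB0 x : 0 <= G x + B by have := GB x; rewrite ler_norml => /andP[]; lra.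
have dHB (x : R) : is_derive x 1 (fun x => H x + B * x) (G x + B).
  by apply: is_derive_eq; rewrite /GRing.scale/= !mulr1.
have cGB : continuous (fun x => G x + B).
  by move=> x; apply: (@ctnD _ _ x G (fun=> B)); [exact: cG|exact: ctn_cst].
(* Adding [B] makes the integrand nonnegative, as the change of variables and the integral over the
   uniform law require; the constant is subtracted again at the end. *)
suff h : (\int[circle_prob R]_y (G (circle_lift y) + B)%:E = ((H T - H 0) / T + B)%:E)%E.
  have -> : (\int[circle_prob R]_y (G (circle_lift y))%:E =
     \int[circle_prob R]_y ((G (circle_lift y) + B)%:E - (cst B%:E y)))%E.
    by apply: eq_integral => y _; rewrite /= -EFinB addrK.
  rewrite integralB//.
  - rewrite h integral_cst// [X in (_ - _ * X)%E](_ : _ = 1%E).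
      by rewrite mule1 -EFinB addrK.
    exact: probability_setT.
  - apply: (@bounded_integrable _ _ _ (circle_prob R) _ (B + B)).
      by apply: measurable_funD => //; exact: measurable_cst.
    move=> y; rewrite ger0_norm// lerD2r; exact: le_trans (ler_norm _) (GB _).
  - exact: finite_measure_integrable_cst.
rewrite ge0_integral_distribution; last 2 first.
- by apply/measurable_EFinP/measurable_funD => //; exact: measurable_cst.
- by move=> y; rewrite lee_fin.
rewrite integral_uniform; last 2 first.
- apply/measurable_EFinP; apply: (measurableT_comp (f := fun y : circle R => G (circle_lift y) + B)).
    by apply: measurable_funD => //; exact: measurable_cst.
  exact: measurable_to_circle.
- by move=> x; rewrite lee_fin.
have -> : (\int[lebesgue_measure]_(x in `[0%R, T]) ((fun y => (G (circle_lift y) + B)%:E) \o to_circle_mfun R) x =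
  \int[lebesgue_measure]_(x in `[0%R, T]) (G x + B)%:E)%E.
  by apply: eq_integral => x _; rewrite /= pG'.
rewrite (@continuous_FTC2 _ _ (fun x => H x + B * x))//.
- rewrite -EFinB -EFinM; congr (_%:E); rewrite subr0 mulr0 addr0.
  by move: (pi : R) (pi_gt0 R) => w w0; field; rewrite gt_eqF.
- by apply: continuous_subspaceT.
- have cH : continuous (fun x => H x + B * x).
    by move=> x; apply: differentiable_continuous; apply/derivable1_diffP; have [] := dHB x.
  split.
  + by move=> x _; have [] := dHB x.
  + by apply: cvg_at_right_filter; exact: cH.
  + by apply: cvg_at_left_filter; exact: cH.
- by move=> x _; rewrite derive1E; have [_ ->] := dHB x.
Qed.

End circle_mean.

Section trig_means.
Context (R : realType).
Local Notation T := (2 * pi : R).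

Lemma is_derive_beta j m (y : R) : is_derive y 1 (beta j m) (beta j m.+1 y).
Proof.
have hl : is_derive y 1 (fun x : R => j%:~R * x + m%:R * (pi / 2)) j%:~R.
  by apply: is_derive_eq; rewrite /GRing.scale/= addr0 mulr1.
rewrite /beta; case: ifP => _; [|case: ifP => _]; last exact: is_derive_cst.
- have := @is_derive1_comp _ cos (fun x : R => j%:~R * x + m%:R * (pi / 2)) _ _ _ (is_derive_cos _) hl.
  move=> /(is_deriveZ (Num.sqrt 2 * j%:~R ^+ m)) h.
  apply: is_derive_eq h _; rewrite cosD_pihalfS /GRing.scale/= exprSr; ring.
- have := @is_derive1_comp _ sin (fun x : R => j%:~R * x + m%:R * (pi / 2)) _ _ _ (is_derive_sin _) hl.
  move=> /(is_deriveZ (Num.sqrt 2 * j%:~R ^+ m)) h.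
  apply: is_derive_eq h _; rewrite sinD_pihalfS /GRing.scale/= exprSr; ring.
Qed.

Lemma continuous_beta j m : continuous (@beta R j m).
Proof.
move=> y; apply: differentiable_continuous; apply/derivable1_diffP.
by have [] := is_derive_beta j m y.
Qed.

Lemma beta_bound j m : exists B, forall y : R, `|beta j m y| <= B.
Proof.
exists (`|Num.sqrt 2 * j%:~R ^+ m| + 1) => y; rewrite /beta.
case: ifP => _; [|case: ifP => _].
- rewrite normrM (@le_trans _ _ `|Num.sqrt 2 * j%:~R ^+ m|)// ?lerDl//.
  by rewrite ler_piMr// cos_max.
- rewrite normrM (@le_trans _ _ `|Num.sqrt 2 * j%:~R ^+ m|)// ?lerDl//.
  by rewrite ler_piMr// sin_max.
- by case: (m == 0%N); rewrite ?normr0 ?normr1 ?lerDr// addr_ge0.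
Qed.

Lemma beta0E m (y : R) : beta 0 m y = (m == 0)%:R.
Proof. by rewrite /beta ltxx. Qed.

Lemma integral_beta j :
  (\int[circle_prob R]_y (beta j 0 (circle_lift y))%:E = (j == 0)%:R%:E)%E.
Proof.
have [->|j0] := eqVneq j 0.
  under eq_integral do rewrite beta0E.
  by rewrite integral_cst// [X in (_ * X)%E](_ : _ = 1%E) ?mule1//; exact: probability_setT.
have jR0 : j%:~R != 0 :> R by rewrite intr_eq0.
have [B hB] := beta_bound j 0.
(* A second derivative multiplies the basis function by [- j^2], so [- j^-2] times the first
   derivative is a periodic antiderivative. *)
pose H y : R := - (j%:~R ^- 2) * beta j 1 y.
have dH (y : R) : is_derive y 1 H (beta j 0 y).
  have h := is_deriveZ (- (j%:~R ^- 2)) (is_derive_beta j 1 y).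
  apply: is_derive_eq h _; rewrite /beta /GRing.scale/=.
  have e : 2%:R * (pi / 2) = pi :> R by field.
  have j2 : j%:~R ^+ 2 * j%:~R ^- 2 = 1 :> R by rewrite mulfV// expf_neq0.
  case: ifP => jp; [|case: ifP => jn]; last by case: (ltgtP j 0) j0 jp jn.
  - rewrite e cosDpi mul0r addr0 expr0 mulr1.
    transitivity (j%:~R ^+ 2 * j%:~R ^- 2 * (Num.sqrt 2 * cos (j%:~R * y)) : R); first by ring.
    by rewrite j2 mul1r.
  - rewrite e sinDpi mul0r addr0 expr0 mulr1.
    transitivity (j%:~R ^+ 2 * j%:~R ^- 2 * (Num.sqrt 2 * sin (j%:~R * y)) : R); first by ring.
    by rewrite j2 mul1r.
rewrite (integral_circle dH _ _ hB); first last.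
- by move=> y z; exact: beta_periodic.
- exact: continuous_beta.
have := beta_periodic j 1 (0 : R) 1; rewrite add0r mul1r => e.
by rewrite /H e subrr mul0r.
Qed.

Lemma integral_beta_sqr j m :
  (\int[circle_prob R]_y (beta j m (circle_lift y) ^+ 2)%:E = ((j%:~R ^+ m) ^+ 2)%:E)%E.
Proof.
have [->|j0] := eqVneq j 0.
  under eq_integral do rewrite beta0E.
  rewrite integral_cst// [X in (_ * X)%E](_ : _ = 1%E) ?mule1; last exact: probability_setT.
  by rewrite mulr0z expr0n.
have jR0 : j%:~R != 0 :> R by rewrite intr_eq0.
have [B hB] := beta_bound j m.
(* With [c] and [s] the cosine and sine of [th], one has [2 c^2 = 1 + (c^2 - s^2)] and
   [2 s^2 = 1 - (c^2 - s^2)]. The sign [sg] selects the case, and [s c / j] is an antiderivative of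
   [c^2 - s^2]. *)
pose sg : R := if 0 < j then 1 else -1.
pose th y : R := j%:~R * y + m%:R * (pi / 2).
pose H y : R := (j%:~R ^+ m) ^+ 2 * y + sg * (j%:~R ^+ m) ^+ 2 / j%:~R * (sin (th y) * cos (th y)).
have dth (y : R) : is_derive y 1 th j%:~R.
  by apply: is_derive_eq; rewrite /GRing.scale/= addr0 mulr1.
have ds (y : R) := @is_derive1_comp _ sin th _ _ _ (is_derive_sin (th y)) (dth y).
have dc (y : R) := @is_derive1_comp _ cos th _ _ _ (is_derive_cos (th y)) (dth y).
have s2 : Num.sqrt 2 ^+ 2 = 2 :> R by rewrite sqr_sqrtr.
have dH (y : R) : is_derive y 1 H (beta j m y ^+ 2).
  have h1 := is_deriveM (ds y) (dc y).
  have h2 := is_deriveZ (sg * (j%:~R ^+ m) ^+ 2 / j%:~R) h1.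
  have h3 := is_deriveZ ((j%:~R ^+ m) ^+ 2 : R) (is_derive_id y 1).
  apply: is_derive_eq (is_deriveD h3 h2) _.
  rewrite /beta /GRing.scale/= -/(th y) /sg.
  have cs : sin (th y) ^+ 2 = 1 - cos (th y) ^+ 2 by rewrite -(cos2Dsin2 (th y)); ring.
  move: (cos (th y)) (sin (th y)) cs => c s cs.
  case: ifP => jp; [|case: ifP => jn].
  - rewrite !exprMn s2.
    rewrite [LHS](_ : _ = (j%:~R ^+ m) ^+ 2 * (1 + c ^+ 2 - s ^+ 2)); last by field.
    by rewrite cs; ring.
  - rewrite !exprMn s2.
    rewrite [LHS](_ : _ = (j%:~R ^+ m) ^+ 2 * (1 - c ^+ 2 + s ^+ 2)); last by field.
    by rewrite cs; ring.
  - by case: (ltgtP j 0) j0 jp jn.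
have hB2 (y : R) : `|beta j m y ^+ 2| <= B ^+ 2.
  by rewrite normrX lerXn2r ?nnegrE// (le_trans _ (hB y)).
rewrite (integral_circle dH _ _ hB2); first last.
- by move=> y z; rewrite beta_periodic.
- by move=> y; apply: ctnX; exact: continuous_beta.
have eth : th T = th 0 + j%:~R * T by rewrite /th; ring.
rewrite /H eth cos_intD sin_intD mulr0 add0r addrK mulfK//.
by rewrite gt_eqF// two_pi_gt0.
Qed.

End trig_means.

Section mean_value.
Context d (T : measurableType d) (R : realType) (P : probability T R).

Implicit Types (F G : T -> R) (a b c m B : R).

Definition has_mean (F : T -> R) m :=
  P.-integrable setT (EFin \o F) /\ (\int[P]_x (F x)%:E = m%:E)%E.

Lemma has_mean_bounded F B m : measurable_fun setT F -> (forall x, `|F x| <= B) ->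
  (\int[P]_x (F x)%:E = m%:E)%E -> has_mean F m.
Proof. by move=> mF FB Fm; split=> //; exact: bounded_integrable mF FB. Qed.

Lemma has_meanD F G a b : has_mean F a -> has_mean G b -> has_mean (fun x => F x + G x) (a + b).
Proof.
move=> [iF Fa] [iG Gb]; split.
  by have := integrableD measurableT iF iG; apply: eq_integrable.
by under eq_integral do rewrite EFinD; rewrite integralD// Fa Gb.
Qed.

Lemma has_meanZ c F a : has_mean F a -> has_mean (fun x => c * F x) (c * a).
Proof.
move=> [iF Fa]; split.
  by have := integrableZl measurableT c iF; apply: eq_integrable.
by under eq_integral do rewrite EFinM; rewrite integralZl// Fa.
Qed.

Lemma has_mean_cst c : has_mean (fun=> c) c.
Proof.
apply: (@has_mean_bounded _ `|c|) => //.
by rewrite integral_cst// [X in (_ * X)%E](_ : _ = 1%E) ?mule1//; exact: probability_setT.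
Qed.

Lemma has_mean_sum (I : Type) (r : seq I) (F : I -> T -> R) (a : I -> R) :
  (forall i, has_mean (F i) (a i)) ->
  has_mean (fun x => \sum_(i <- r) F i x) (\sum_(i <- r) a i).
Proof.
move=> Fa; elim: r => [|i r ih].
  by under eq_fun do rewrite big_nil; rewrite big_nil; exact: has_mean_cst.
by under eq_fun do rewrite big_cons; rewrite big_cons; exact: has_meanD.
Qed.

Lemma has_mean_Rintegral F m : has_mean F m -> \int[P]_x F x = m.
Proof. by rewrite /Rintegral => -[_ ->]. Qed.

End mean_value.

Section torus_means.
Context (R : realType) (n : nat).
Local Notation P := (torus_volume R n).

Lemma has_mean_prod (G : 'I_n -> R -> R) c :
    (forall p, continuous (G p)) ->
    (forall p y (z : int), G p (y + z%:~R * (2 * pi)) = G p y) ->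
    (forall p, exists B, forall y, `|G p y| <= B) ->
    (forall p, \int[circle_prob R]_y (G p (circle_lift y))%:E = (c p)%:E)%E ->
  has_mean P (fun x => \prod_p G p (torus_lift x 0 p)) (\prod_p c p).
Proof.
move=> cG pG bG Gc.
have eG (x : torus R n) : \prod_p G p (torus_lift x 0 p) = \prod_p G p (circle_lift (tnth x p)).
  by apply: eq_bigr => p _; rewrite mxE.
have mG (p : 'I_n) : measurable_fun setT (fun y : circle R => G p (circle_lift y)).
  by apply: measurable_circle_lift => //; exact: pG.
have /choice[B hB] := bG.
apply: (@has_mean_bounded _ _ _ _ _ (\prod_p B p)).
- by under eq_fun do rewrite eG; exact: (measurable_prod_tnth mG).
- by move=> x; rewrite normr_prod; apply: ler_prod => p _; rewrite normr_ge0/=.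
under eq_integral do rewrite eG.
apply: (integral_probability_power (F := fun p y => G p (circle_lift y))) => // p.
by exists (B p).
Qed.

Context (k l : 'rV[int]_n) (kl : forall p, k 0 p * l 0 p = 0).

(** In every coordinate at least one of the two frequencies is zero, so one of the two factors is
    constant and the mean of the product is the product of the means. *)
Lemma has_mean_trig_prod_sqrM al be :
  has_mean P (fun x => trig_prod k al (torus_lift x) ^+ 2 * trig_prod l be (torus_lift x) ^+ 2)
   (\prod_p (((k 0 p)%:~R ^+ al p) ^+ 2 * ((l 0 p)%:~R ^+ be p) ^+ 2)).
Proof.
under eq_fun do rewrite /trig_prod -!prodrXl -big_split/=.
apply: (has_mean_prod (G := fun p y => beta (k 0 p) (al p) y ^+ 2 * beta (l 0 p) (be p) y ^+ 2)).
- move=> p y; apply: ctnM; apply: ctnX; exact: continuous_beta.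
- by move=> p y z; rewrite !beta_periodic.
- move=> p; have [B hB] := @beta_bound R (k 0 p) (al p); have [C hC] := @beta_bound R (l 0 p) (be p).
  exists (B ^+ 2 * C ^+ 2) => y; rewrite normrM !normrX.
  have B0 := le_trans (normr_ge0 _) (hB 0); have C0 := le_trans (normr_ge0 _) (hC 0).
  by apply: ler_pM; rewrite ?exprn_ge0// lerXn2r ?nnegrE.
- move=> p; have /eqP := kl p; rewrite mulf_eq0 => /orP[] /eqP ->.
  + under eq_integral => y _ do rewrite beta0E -natrX EFinM.
    rewrite integralZl//; last first.
      have [B hB] := @beta_bound R (l 0 p) (be p).
      apply: (@bounded_integrable _ _ _ (circle_prob R) _ (B ^+ 2)).
        apply: (measurable_circle_lift (G := fun y => beta (l 0 p) (be p) y ^+ 2)).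
          by move=> y; apply: ctnX; exact: continuous_beta.
        by move=> y z; rewrite beta_periodic.
      have B0 := le_trans (normr_ge0 _) (hB 0).
      by move=> y; rewrite normrX lerXn2r ?nnegrE.
    by rewrite integral_beta_sqr mulr0z expr0n natrX.
  + under eq_integral => y _ do rewrite beta0E -natrX mulrC EFinM.
    rewrite integralZl//; last first.
      have [B hB] := @beta_bound R (k 0 p) (al p).
      apply: (@bounded_integrable _ _ _ (circle_prob R) _ (B ^+ 2)).
        apply: (measurable_circle_lift (G := fun y => beta (k 0 p) (al p) y ^+ 2)).
          by move=> y; apply: ctnX; exact: continuous_beta.
        by move=> y z; rewrite beta_periodic.
      have B0 := le_trans (normr_ge0 _) (hB 0).
      by move=> y; rewrite normrX lerXn2r ?nnegrE.
    by rewrite integral_beta_sqr mulr0z expr0n natrX mulrC.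
Qed.

Lemma has_mean_trig_prodM : k != 0 ->
  has_mean P (fun x => trig_prod k (fun=> 0%N) (torus_lift x) * trig_prod l (fun=> 0%N) (torus_lift x)) 0.
Proof.
move=> k0; under eq_fun do rewrite /trig_prod -big_split/=.
have [p kp] : exists p, k 0 p != 0.
  apply: contrapT => h; move/eqP: k0; apply; apply/rowP => p; rewrite mxE.
  by apply/eqP; apply: contrapT => /negP kp; apply: h; exists p.
have lp : l 0 p = 0 by have /eqP := kl p; rewrite mulf_eq0 (negbTE kp) => /eqP.
(* The mean [0] is written as the product of the coordinate means, among which the one at [p]
   vanishes. *)
rewrite [X in has_mean _ _ X](_ : _ = \prod_q ((k 0 q == 0) && (l 0 q == 0))%:R); last first.
  by rewrite (bigD1 p)//= (negbTE kp) mul0r.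
apply: (has_mean_prod (G := fun p y => beta (k 0 p) 0 y * beta (l 0 p) 0 y)).
- move=> q y; apply: ctnM; exact: continuous_beta.
- by move=> q y z; rewrite !beta_periodic.
- move=> q; have [B hB] := @beta_bound R (k 0 q) 0; have [C hC] := @beta_bound R (l 0 q) 0.
  by exists (B * C) => y; rewrite normrM ler_pM.
- move=> q; have /eqP := kl q; rewrite mulf_eq0 => /orP[] /eqP ->; rewrite eqxx ?andbT ?andTb.
  + by under eq_integral do rewrite beta0E mul1r; rewrite integral_beta.
  + by under eq_integral do rewrite beta0E mulr1; rewrite integral_beta.
Qed.

End torus_means.

Section fourier_means.
Context (R : realType) (n : nat).
Local Notation P := (torus_volume R n).
Local Notation tp k al := (@trig_prod R n k al).
Local Notation al0 := (fun=> 0%N).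

Lemma trig_prod_row0 v : tp 0 al0 v = 1.
Proof. by rewrite /trig_prod big1// => p _; rewrite mxE beta0E. Qed.

Lemma prod_exp0 (k : 'rV[int]_n) : \prod_p (((k 0 p)%:~R : R) ^+ 0) ^+ 2 = 1.
Proof. by rewrite big1// => p _; rewrite expr0 expr1n. Qed.

Lemma prod_incr (k : 'rV[int]_n) i :
  \prod_p (((k 0 p)%:~R : R) ^+ incr al0 i p) ^+ 2 = (k 0 i)%:~R ^+ 2.
Proof.
rewrite (bigD1 i)//= big1 ?mulr1 => [|p pi]; first by rewrite /incr eqxx expr1.
by rewrite /incr (negbTE pi) expr0 expr1n.
Qed.

(** This is the case of a zero second frequency vector, for which the second product is [1]. *)
Lemma has_mean_trig_prod_sqr k al :
  has_mean P (fun x => tp k al (torus_lift x) ^+ 2) (\prod_p ((k 0 p)%:~R ^+ al p) ^+ 2).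
Proof.
have h : forall p, k 0 p * (0 : 'rV[int]_n) 0 p = 0 by move=> p; rewrite mxE mulr0.
have := @has_mean_trig_prod_sqrM R n k 0 h al al0.
rewrite big_split/= prod_exp0 mulr1.
by under eq_fun do rewrite trig_prod_row0 expr1n mulr1.
Qed.

Lemma int_norm_sqr (k : 'rV[int]_n) : int_norm R k ^+ 2 = \sum_i (k 0 i)%:~R ^+ 2.
Proof. by rewrite normv_sqr; apply: eq_bigr => i _; rewrite !mxE. Qed.

Lemma dotv_gradrow (f1 : 'I_n -> 'rV[R]_n -> R) v :
  dotv (gradrow f1 v) (gradrow f1 v) = \sum_i f1 i v ^+ 2.
Proof. by apply: eq_bigr => i _; rewrite !mxE. Qed.

Lemma has_mean_grad_sqr k :
  has_mean P (fun x => \sum_i tp k (incr al0 i) (torus_lift x) ^+ 2) (int_norm R k ^+ 2).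
Proof.
rewrite int_norm_sqr; apply: has_mean_sum => i.
by rewrite -prod_incr; exact: has_mean_trig_prod_sqr.
Qed.

Context (k l : 'rV[int]_n) (kl : forall p, k 0 p * l 0 p = 0) (k0 : k != 0).
Let phi := tp k al0.
Let psi := tp l al0.
Let phi1 i := tp k (incr al0 i).
Let psi1 i := tp l (incr al0 i).

Lemma has_mean_grad_sqrM :
  has_mean P (fun x => (\sum_i phi1 i (torus_lift x) ^+ 2) * \sum_i psi1 i (torus_lift x) ^+ 2)
   (int_norm R k ^+ 2 * int_norm R l ^+ 2).
Proof.
rewrite !int_norm_sqr mulr_suml.
under eq_fun do rewrite mulr_suml; apply: has_mean_sum => i.
rewrite mulr_sumr; under eq_fun do rewrite mulr_sumr; apply: has_mean_sum => j.
by rewrite -!prod_incr -big_split; exact: has_mean_trig_prod_sqrM.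
Qed.

Local Notation S s t := (s ^+ 2 * (4 + int_norm R k ^+ 2) + t ^+ 2 * (4 + int_norm R l ^+ 2)).

Lemma has_mean_H1 s t :
  has_mean P (fun x => \sum_i (s * phi1 i (torus_lift x) - t * psi1 i (torus_lift x)) ^+ 2
    + 4 * (s * phi (torus_lift x) - t * psi (torus_lift x)) ^+ 2) (S s t).
Proof.
have orth v i : phi1 i v * psi1 i v = 0.
  by apply: (trig_prod_orth (i := i)) => //; rewrite /incr eqxx.
have E x : \sum_i (s * phi1 i (torus_lift x) - t * psi1 i (torus_lift x)) ^+ 2
    + 4 * (s * phi (torus_lift x) - t * psi (torus_lift x)) ^+ 2 =
  s ^+ 2 * (\sum_i phi1 i (torus_lift x) ^+ 2)
  + (t ^+ 2 * (\sum_i psi1 i (torus_lift x) ^+ 2)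
  + (4 * s ^+ 2 * phi (torus_lift x) ^+ 2 + (4 * t ^+ 2 * psi (torus_lift x) ^+ 2
  + (- 8 * s * t) * (phi (torus_lift x) * psi (torus_lift x))))).
  have -> : \sum_i (s * phi1 i (torus_lift x) - t * psi1 i (torus_lift x)) ^+ 2 =
    s ^+ 2 * (\sum_i phi1 i (torus_lift x) ^+ 2) + t ^+ 2 * (\sum_i psi1 i (torus_lift x) ^+ 2).
    rewrite !mulr_sumr -big_split/=; apply: eq_bigr => i _.
    transitivity (s ^+ 2 * phi1 i (torus_lift x) ^+ 2 + t ^+ 2 * psi1 i (torus_lift x) ^+ 2
      - 2 * s * t * (phi1 i (torus_lift x) * psi1 i (torus_lift x))); first by ring.
    by rewrite orth mulr0 subr0.
  by ring.
under eq_fun do rewrite E.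
have -> : S s t = s ^+ 2 * int_norm R k ^+ 2 + (t ^+ 2 * int_norm R l ^+ 2
  + (4 * s ^+ 2 * 1 + (4 * t ^+ 2 * 1 + (- 8 * s * t) * 0))) by ring.
have h1 m : has_mean P (fun x => tp m al0 (torus_lift x) ^+ 2) 1.
  by rewrite -(prod_exp0 m); exact: has_mean_trig_prod_sqr.
do 4 (apply: has_meanD; first by apply: has_meanZ; [exact: has_mean_grad_sqr || exact: h1]).
by apply: has_meanZ; exact: has_mean_trig_prodM.
Qed.

Lemma has_mean_HK_density s t :
  has_mean P (fun x => HK_density phi phi1 psi psi1 s t (torus_lift x))
    (S s t + s ^+ 2 * t ^+ 2 * (int_norm R k ^+ 2 * int_norm R l ^+ 2) / 3).
Proof.
have orth v i : phi1 i v * psi1 i v = 0.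
  by apply: (trig_prod_orth (i := i)) => //; rewrite /incr eqxx.
have E x : HK_density phi phi1 psi psi1 s t (torus_lift x) =
  (\sum_i (s * phi1 i (torus_lift x) - t * psi1 i (torus_lift x)) ^+ 2
    + 4 * (s * phi (torus_lift x) - t * psi (torus_lift x)) ^+ 2)
  + s ^+ 2 * t ^+ 2 / 3 * ((\sum_i phi1 i (torus_lift x) ^+ 2) * \sum_i psi1 i (torus_lift x) ^+ 2).
  rewrite /HK_density !dotv_gradrow.
  have -> : \sum_i (s * phi1 i (torus_lift x) - t * psi1 i (torus_lift x)) ^+ 2 =
    s ^+ 2 * (\sum_i phi1 i (torus_lift x) ^+ 2) + t ^+ 2 * (\sum_i psi1 i (torus_lift x) ^+ 2).
    rewrite !mulr_sumr -big_split/=; apply: eq_bigr => i _.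
    transitivity (s ^+ 2 * phi1 i (torus_lift x) ^+ 2 + t ^+ 2 * psi1 i (torus_lift x) ^+ 2
      - 2 * s * t * (phi1 i (torus_lift x) * psi1 i (torus_lift x))); first by ring.
    by rewrite orth mulr0 subr0.
  by field.
under eq_fun do rewrite E.
apply: has_meanD; first exact: has_mean_H1.
by rewrite [X in has_mean _ _ X]mulrAC; apply: has_meanZ; exact: has_mean_grad_sqrM.
Qed.

Lemma H1_norm_fourier s t :
  H1_norm P (fun x => s * fourier_basis k x - t * fourier_basis l x) ^+ 2 = S s t.
Proof.
have Tf : T2 (fun v => s * phi v + - t * psi v) (fun i v => s * phi1 i v + - t * psi1 i v).
  by apply: T2_D; apply: T2_Z; exact: T2_trig_prod.
have pf : periodic_rV (fun v => s * phi v + - t * psi v).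
  by move=> v m; rewrite /phi /psi !trig_prod_periodic.
have gradE x := grad_T2 (F := fun x => s * fourier_basis k x - t * fourier_basis l x) x pf Tf.
rewrite /H1_norm sqr_sqrtr; last first.
  by apply: Rintegral_ge0 => x _; apply: addr_ge0; [exact: sqr_ge0|apply: mulr_ge0 => //; exact: sqr_ge0].
rewrite -(has_mean_Rintegral (has_mean_H1 s t)); congr Rintegral.
apply/funext => x; rewrite gradE => [|y]; last by rewrite !fourier_basisE mulNr.
rewrite normv_sqr dotv_gradrow !fourier_basisE; congr (_ + _).
by apply: eq_bigr => i _; rewrite mulNr.
Qed.

Lemma H1_dot_fourier : H1_dot P (fourier_basis k) (fourier_basis l) = 0.
Proof.
have gradE m x := grad_T2 (F := @fourier_basis R n m) x (@trig_prod_periodic R n m _)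
  (@T2_trig_prod R n m al0) (@fourier_basisE R n m).
rewrite /H1_dot -[RHS](mulr0 4) -(has_mean_Rintegral (has_meanZ 4 (@has_mean_trig_prodM R n k l kl k0))); congr Rintegral.
apply/funext => x; rewrite !gradE !fourier_basisE mulrA /dotv big1 ?add0r// => i _.
by rewrite !mxE; apply: (trig_prod_orth (i := i)) => //; rewrite /incr eqxx.
Qed.

End fourier_means.

(** * The expansion of HK *)

Section cos_min.
Context (R : realType).
Implicit Types m d : R.

Lemma cos_min_anti m d : 0 <= m -> m <= d -> cos (Num.min d pi) <= cos (Num.min m pi).
Proof.
move=> m0 md; have p0 := pi_ge0 R.
have : Num.min m pi <= Num.min d pi by rewrite le_min !ge_min md lexx orbT.
rewrite le_eqVlt => /predU1P[->//|h]; apply: ltW; rewrite ltr_cos// in_itv/= le_min ge_min lexx orbT andbT.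
  by rewrite m0.
by rewrite p0 (le_trans m0).
Qed.

Lemma cos_min_le_expR m : 0 <= m -> cos (Num.min m pi) <= expR (- (m ^+ 2 / 2 + m ^+ 4 / 12)).
Proof.
move=> m0; have [mp|pm] := leP m pi; first by apply: cos_le_expR; rewrite m0.
by rewrite cospi (le_trans _ (ltW (expR_gt0 _))).
Qed.

End cos_min.

(** * The dual potential and its admissibility *)

Section dual_potential.
Context (R : realType) (n : nat).
Implicit Types u v : 'rV[R]_n.
Context (g : 'rV[R]_n -> R) (K : R) (gK : forall v, `|g v| <= K) (pg : periodic_rV g).

Let cost v u := dotv (u - v) (u - v) + dotv (u - v) (u - v) ^+ 2 / 6 + g u.

(* The exponential of the inf-convolution of [- g] with [d^2 + d^4 / 6]. *)
Definition dual_potential v : R := sup (range (fun u => expR (- cost v u))).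

Let cost_ge v u : - K <= cost v u.
Proof.
have := gK u; have := dotvv_ge0 (u - v); have := sqr_ge0 (dotv (u - v) (u - v)).
by rewrite ler_norml /cost => h1 h2 /andP[h3 h4]; lra.
Qed.

Lemma dual_potential_le v y : (forall u, expR (- cost v u) <= y) -> dual_potential v <= y.
Proof.
move=> h; apply: ge_sup; first by exists (expR (- cost v v)), v.
by move=> _ [u _ <-].
Qed.

Lemma dual_potential_ge v u : expR (- cost v u) <= dual_potential v.
Proof.
apply: ub_le_sup; last by exists u.
by exists (expR K) => _ [w _ <-]; rewrite ler_expR lerNl.
Qed.

Lemma dual_potential_bound v : dual_potential v <= expR K.
Proof. by apply: dual_potential_le => u; rewrite ler_expR lerNl. Qed.

Lemma dual_potential_ge0 v : 0 <= dual_potential v.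
Proof. exact: le_trans (ltW (expR_gt0 _)) (dual_potential_ge v v). Qed.

Lemma dual_potential_periodic : periodic_rV dual_potential.
Proof.
have costD v u m : cost (v + latticev R m) (u + latticev R m) = cost v u.
  have -> : cost (v + latticev R m) (u + latticev R m) = dotv (u - v) (u - v)
      + dotv (u - v) (u - v) ^+ 2 / 6 + g (u + latticev R m).
    by rewrite /cost opprD addrACA subrr addr0.
  by rewrite pg.
move=> v m; apply/le_anti/andP; split; apply: dual_potential_le => u.
  by rewrite -(subrK (latticev R m) u) costD; exact: dual_potential_ge.
by rewrite -(costD _ _ m); exact: dual_potential_ge.
Qed.

(** The supremum runs over an uncountable family, but a supremum of continuous functions is lower
    semicontinuous, and open superlevel sets are enough. *)
Lemma measurable_dual_potential :
  measurable_fun setT (fun x : torus R n => dual_potential (torus_lift x)).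
Proof.
apply: measurable_lift_lsc; first exact: dual_potential_periodic.
move=> c; rewrite openE => v /= cv.
have [|_ [u _ <-] cu] := sup_gt _ cv; first by exists (expR (- cost v v)), v.
have cc : continuous_at v (fun w => expR (- cost w u)).
  have cx i : continuous_at v (fun w : 'rV[R]_n => (u - w) 0 i).
    rewrite (_ : (fun w => _) = fun w : 'rV[R]_n => u 0 i - w 0 i); last first.
      by apply/funext => w; rewrite !mxE.
    apply: ctnD; first exact: ctn_cst; apply: ctnN; exact: coord_continuous.
  apply: (ctn_comp (h := @expR R)); last exact: continuous_expR.
  by rewrite /cost /dotv; ctn.
have : \forall w \near v, c < expR (- cost w u) by move/cvgr_gt : cc; apply.
by apply: filterS => w cw; exact: lt_le_trans cw (dual_potential_ge w u).
Qed.

(* Since [cos (min d pi) <= exp (- d^2 / 2 - d^4 / 12)], this is the AM-GM inequality. *)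
Lemma dual_potential_cone (c c' : cone R n) :
  cone_radius c ^+ 2 + cone_radius c' ^+ 2 <= cone_dist c c' ^+ 2
  + (cone_radius c ^+ 2 * dual_potential (torus_lift (cone_base c))
     + cone_radius c' ^+ 2 * expR (g (torus_lift (cone_base c')))).
Proof.
rewrite cone_dist_sqr; have := cone_radius_ge0 c; have := cone_radius_ge0 c'.
move: (cone_radius c) (cone_radius c') (cone_base c) (cone_base c') => r r' x x' r'0 r0.
set C := cos _; pose v := torus_lift x.
(* By periodicity of [g], the lift of [x'] may be replaced by its translate [u] nearest to [v],
   whose Euclidean distance to [v] is at most the torus distance. *)
have [m hm] := torus_dist_lb v (torus_lift x').
rewrite !torus_liftK in hm; pose u := torus_lift x' + latticev R m.
have gu : g (torus_lift x') = g u by rewrite /u pg.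
pose N := normv (u - v).
have Nx : N <= torus_dist x x'.
  by apply: le_trans hm; rewrite /N /normv -(opprB v u) dotvNl dotvNr opprK.
have N0 : 0 <= N by exact: normv_ge0.
have Ce : C <= expR (- (N ^+ 2 / 2 + N ^+ 4 / 12)).
  by apply: le_trans (cos_min_anti N0 Nx) _; exact: cos_min_le_expR.
pose a := expR (- cost v u / 2); pose b := expR (g u / 2).
have ab : expR (- (N ^+ 2 / 2 + N ^+ 4 / 12)) = a * b.
  by rewrite -expRD; congr expR; rewrite /cost -normv_sqr -/N; field.
have a2 : expR (- cost v u) = a ^+ 2 by rewrite -expRM_natl; congr expR; field.
have b2 : expR (g u) = b ^+ 2 by rewrite -expRM_natl; congr expR; field.
have fa : a ^+ 2 <= dual_potential v by rewrite -a2; exact: dual_potential_ge.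
rewrite gu b2; rewrite ab in Ce.
have h1 : r ^+ 2 * a ^+ 2 <= r ^+ 2 * dual_potential v by rewrite ler_wpM2l ?sqr_ge0.
have h2 : r * r' * C <= r * r' * (a * b) by rewrite ler_wpM2l ?mulr_ge0.
have h3 := sqr_ge0 (r * a - r' * b).
have h4 : (r * a - r' * b) ^+ 2 = r ^+ 2 * a ^+ 2 + r' ^+ 2 * b ^+ 2 - 2 * (r * r' * (a * b)) by ring.
rewrite h4 in h3; rewrite -/v.
move: h1 h2 h3; move: (r ^+ 2 * a ^+ 2) (r ^+ 2 * _) (r' ^+ 2 * _) (r * r' * (a * b)) => z1 z2 z3 z4.
have -> : 2 * r * r' * C = 2 * (r * r' * C) by ring.
lra.
Qed.

End dual_potential.

Section T2_closure.
Context (R : realType) (n : nat).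
Implicit Types f : 'rV[R]_n -> R.

Definition hasT2 f := exists g, T2 f g.

Lemma hasT2_cst c : hasT2 (fun=> c).
Proof. by exists (fun _ _ => 0); exact: T2_cst. Qed.

Lemma hasT2D f1 f2 : hasT2 f1 -> hasT2 f2 -> hasT2 (fun v => f1 v + f2 v).
Proof. by move=> [g1 h1] [g2 h2]; eexists; exact: T2_D h1 h2. Qed.

Lemma hasT2M f1 f2 : hasT2 f1 -> hasT2 f2 -> hasT2 (fun v => f1 v * f2 v).
Proof. by move=> [g1 h1] [g2 h2]; eexists; exact: T2_M h1 h2. Qed.

Lemma hasT2N f : hasT2 f -> hasT2 (fun v => - f v).
Proof.
move=> h; have := hasT2M (hasT2_cst (-1)) h.
by under eq_fun do rewrite mulN1r.
Qed.

Lemma hasT2X f k : hasT2 f -> hasT2 (fun v => f v ^+ k).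
Proof.
move=> h; elim: k => [|k ih]; first by under eq_fun do rewrite expr0; exact: hasT2_cst.
by under eq_fun do rewrite exprS; exact: hasT2M.
Qed.

Lemma hasT2_sum (I : finType) (F : I -> 'rV[R]_n -> R) : (forall i, hasT2 (F i)) ->
  hasT2 (fun v => \sum_i F i v).
Proof.
move=> cF; suff H (r : seq I) : hasT2 (fun v => \sum_(i <- r) F i v) by exact: H.
elim: r => [|i r ih]; first by under eq_fun do rewrite big_nil; exact: hasT2_cst.
by under eq_fun do rewrite big_cons; exact: hasT2D.
Qed.

Lemma hasT2_bound f : hasT2 f -> exists K, forall v, `|f v| <= K.
Proof. by move=> [g [K _ h]]; exists K => v; case: (h v). Qed.

Lemma hasT2_continuous f : hasT2 f -> continuous f.
Proof. by move=> [g h]; exact: T2_continuous h. Qed.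

Lemma hasT2_mass f (f1 : 'I_n -> 'rV[R]_n -> R) s :
  hasT2 f -> (forall i, hasT2 (f1 i)) -> hasT2 (mass f f1 s).
Proof.
move=> hf hf1; rewrite /mass; apply: hasT2D.
  apply: hasT2X; apply: hasT2D; first exact: hasT2_cst.
  by apply: hasT2M; [exact: hasT2_cst|apply: hasT2M => //; exact: hasT2_cst].
under eq_fun do rewrite dotv_gradrow.
apply: hasT2M; first exact: hasT2_cst.
by apply: hasT2_sum => i; exact: hasT2X.
Qed.

Lemma hasT2_potential f1 f2 (f3 : 'I_n -> 'rV[R]_n -> R) s t :
  hasT2 f1 -> hasT2 f2 -> (forall i, hasT2 (f3 i)) -> hasT2 (potential f1 f2 f3 s t).
Proof.
move=> h1 h2 h3; have hc := hasT2_cst; rewrite /potential.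
have hZ c f : hasT2 f -> hasT2 (fun v => c * f v) by move=> hf; exact: hasT2M.
do 3 (apply: hasT2D; last by [apply: hZ; apply: hasT2X | apply: hasT2N; apply: hZ
  | apply: hZ; apply: hasT2_sum => i; apply: hasT2X]).
apply: hasT2D; first exact: hZ.
by apply: hasT2N; apply: hZ; exact: hasT2X.
Qed.

End T2_closure.

Section HK_expansion.
Context (R : realType) (n : nat).
Local Notation V := 'rV[R]_n.
Local Notation P := (torus_volume R n).
Context (phi : V -> R) (phi1 : 'I_n -> V -> R) (phi2 : 'I_n -> 'I_n -> V -> R).
Context (psi : V -> R) (psi1 : 'I_n -> V -> R) (psi2 : 'I_n -> 'I_n -> V -> R).
Context (psi3 : 'I_n -> 'I_n -> 'I_n -> V -> R).
Context (Tphi : T2 phi phi1) (Tphi1 : forall i, T2 (phi1 i) (phi2 i))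
  (Tpsi : T2 psi psi1) (Tpsi1 : forall i, T2 (psi1 i) (psi2 i))
  (Tpsi2 : forall i j, T2 (psi2 i j) (psi3 i j)).
Context (orth1 : forall i v, phi1 i v * psi1 i v = 0)
  (orth2 : forall i j v, phi2 i j v * psi1 j v = 0)
  (sym2 : forall i j v, psi2 i j v = psi2 j i v).
Context (pphi : periodic_rV phi) (pphi1 : forall i, periodic_rV (phi1 i))
  (ppsi : periodic_rV psi) (ppsi1 : forall i, periodic_rV (psi1 i)).
Context (F G : torus R n -> R) (FE : forall x, F x = phi (torus_lift x))
  (GE : forall x, G x = psi (torus_lift x)).

Let dotv_disp_le A (w : V) : dotv (disp A w) (disp A w) <= (pi / 2) ^+ 2.
Proof.
rewrite dotv_disp -real_normK ?num_real// lerXn2r ?nnegrE ?divr_ge0 ?pi_ge0//.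
by rewrite ler_norml; have := atan_gtNpi2 (normv w / A); have := atan_ltpi2 (normv w / A); lra.
Qed.

(** Each displacement is shorter than [pi / 2], being an arctangent, so by the parallelogram law the
    truncation of the angle at [pi] in [cone_dist] does not act on their difference. *)
Let normv_disp_le A A' (w w' : V) : normv (disp A w - disp A' w') <= pi.
Proof.
rewrite -ler_sqr ?nnegrE ?normv_ge0 ?pi_ge0// normv_sqr.
have := dotv_disp_le A w; have := dotv_disp_le A' w'.
have := dotvv_ge0 (disp A w + disp A' w').
move: (disp A w) (disp A' w') => a b.
rewrite !dotvDl !dotvDr !dotvNl !dotvNr opprK (dotvC b a).
move: (dotv a a) (dotv b b) (dotv a b) => x y z h1 h2 h3.
have -> : (pi ^+ 2 : R) = 4 * (pi / 2) ^+ 2 by field.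
lra.
Qed.

Let cone_dist_exp_point s t (x : torus R n) (v := torus_lift x) :
  (forall v, 0 < 1 + 2 * (s * phi v)) -> (forall v, 0 < 1 + 2 * (t * psi v)) ->
  cone_dist (exp_point phi phi1 s x) (exp_point psi psi1 t x) ^+ 2 <=
  mass phi phi1 s v + mass psi psi1 t v
  - 2 * (Num.sqrt (mass phi phi1 s v) * Num.sqrt (mass psi psi1 t v)
     * cos (normv (exp_shift psi psi1 t v - exp_shift phi phi1 s v))).
Proof.
move=> A0 B0; have m0 := mass_gt0 phi1 A0 v; have m1 := mass_gt0 psi1 B0 v.
rewrite cone_dist_sqr !cone_radius_to_cone !cone_base_to_cone ?gt_eqF ?sqrtr_gt0//.
rewrite !ger0_norm ?sqrtr_ge0// !sqr_sqrtr ?(ltW m0) ?(ltW m1)// -/v lerD2l lerN2 -!mulrA.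
rewrite !ler_wpM2l ?sqrtr_ge0//.
set N := normv _; have Np : N <= pi by exact: normv_disp_le.
rewrite -{1}(min_l Np); apply: cos_min_anti; first exact: torus_dist_ge0.
apply: le_trans (torus_dist_le _ _) _.
rewrite opprD addrACA subrr add0r.
by rewrite /N /normv -(opprB (exp_shift psi _ _ _)) dotvNl dotvNr opprK.
Qed.

Let exp_point_radius s f f1 : (forall v, 0 < 1 + 2 * (s * f v)) -> hasT2 f -> (forall i, hasT2 (f1 i)) ->
  exists2 K, 0 <= K & forall x : torus R n, cone_radius (exp_point f f1 s x) <= K.
Proof.
move=> A0 hf hf1; have [K hK] := hasT2_bound (hasT2_mass s hf hf1).
exists (Num.sqrt K) => // x; rewrite cone_radius_to_cone ger0_norm// ler_wsqrtr//.
exact: le_trans (ler_norm _) (hK _).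
Qed.

Lemma HK_expansion : exists C d : R, [/\ 0 <= C, 0 < d & forall s t, 0 < s -> 0 < t ->
  s + t <= d -> forall I,
  has_mean P (fun x => HK_density phi phi1 psi psi1 s t (torus_lift x)) I ->
  `|fine (HK (exp_measure P (fun x => s * F x)) (exp_measure P (fun x => t * G x))) ^+ 2 - I|
    <= C * (s + t) ^+ 5].
Proof.
have [C1 [d1 [C10 d10 up]]] := plan_cost_upper Tphi Tpsi orth1.
have [C2 [d2 [C20 d20 lo]]] := dual_upper Tphi Tphi1 Tpsi Tpsi1 Tpsi2 orth1 orth2 sym2.
have [Bf Bf0 hf] := Tphi; have [Bg Bg0 hg] := Tpsi.
have hphi : hasT2 phi by exists phi1.
have hpsi : hasT2 psi by exists psi1.
have hphi1 i : hasT2 (phi1 i) by exists (phi2 i).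
have hpsi1 i : hasT2 (psi1 i) by exists (psi2 i).
(* Chosen so that [s |phi|] and [t |psi|] stay below [1 / 4], which keeps [1 + 2 s phi] and
   [1 + 2 t psi] positive: the cone exponential is then in its proper range. *)
pose d3 := (4 * (Bf + Bg + 1))^-1.
have d30 : 0 < d3 by rewrite invr_gt0 mulr_gt0// ltr_wpDl// addr_ge0.
have d3E : d3 * (4 * (Bf + Bg + 1)) = 1 by rewrite mulVf// gt_eqF// -invr_gt0.
exists (C1 + C2), (Num.min d1 (Num.min d2 d3)); split; [by rewrite addr_ge0| |].
  by rewrite !lt_min d10 d20.
move=> s t s0 t0; rewrite !le_min => /and3P[h1 h2 h3] I hI.
have A0 v : 0 < 1 + 2 * (s * phi v).
  have [+ _ _ _] := hf v; rewrite ler_norml => /andP[fl _].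
  have : s * phi v >= s * - Bf by rewrite ler_wpM2l// ltW.
  have : s * Bf <= d3 * Bf by rewrite ler_wpM2r//; lra.
  have : 0 <= d3 * Bg by rewrite mulr_ge0// ltW.
  lra.
have B0 v : 0 < 1 + 2 * (t * psi v).
  have [+ _ _ _] := hg v; rewrite ler_norml => /andP[fl _].
  have : t * psi v >= t * - Bg by rewrite ler_wpM2l// ltW.
  have : t * Bg <= d3 * Bg by rewrite ler_wpM2r//; lra.
  have : 0 <= d3 * Bf by rewrite mulr_ge0// ltW.
  lra.
pose Phi0 := exp_point_mfun Tphi Tphi1 pphi pphi1 A0.
pose Phi1 := exp_point_mfun Tpsi Tpsi1 ppsi ppsi1 B0.
have mu0E A : measurable A -> exp_measure P (fun x => s * F x) A = Pr (pushforward P Phi0) A.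
  by move=> _; exact: (exp_measureE Tphi Tphi1 pphi pphi1 FE A0).
have mu1E A : measurable A -> exp_measure P (fun x => t * G x) A = Pr (pushforward P Phi1) A.
  by move=> _; exact: (exp_measureE Tpsi Tpsi1 ppsi ppsi1 GE B0).
have [K0 K00 rK0] := exp_point_radius A0 hphi hphi1.
have [K1 K10 rK1] := exp_point_radius B0 hpsi hpsi1.
have {}rK0 x : cone_radius (Phi0 x) <= K0 + K1 by rewrite (le_trans (rK0 x))// lerDl.
have {}rK1 x : cone_radius (Phi1 x) <= K0 + K1 by rewrite (le_trans (rK1 x))// lerDr.
pose e5 := (s + t) ^+ 5; have e50 : 0 <= e5 by rewrite exprn_ge0// addr_ge0// ltW.
rewrite -/e5; rewrite /HK; set X := ereal_inf _.
have Xup : (X <= (I + C1 * e5)%:E)%E.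
  have [|q qp qc] := HK_plan_cost_le mu0E mu1E rK0 rK1
    (f := fun x => HK_density phi phi1 psi psi1 s t (torus_lift x) + C1 * e5).
    move=> x; apply: le_trans (cone_dist_exp_point x A0 B0) _.
    exact: (up (Param (torus_lift x) s0 t0)).
  apply: ge_ereal_inf; exists (\int[q]_z (cone_dist z.1 z.2 ^+ 2)%:E)%E; first by exists q.
  by have [_ <-] := has_meanD hI (has_mean_cst P (C1 * e5)).
have Xlo : ((I - C2 * e5)%:E <= X)%E.
  apply: le_ereal_inf_tmp => _ [q qp <-].
  pose g := potential phi psi psi1 s t.
  have hg2 : hasT2 g by exact: hasT2_potential.
  have [K gK] := hasT2_bound hg2.
  have pg : periodic_rV g.
    move=> v m; rewrite /g /potential pphi ppsi; congr (_ + _ * _).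
    by apply: eq_bigr => i _; rewrite ppsi1.
  pose f0 x := dual_potential g (torus_lift x : V).
  pose f1 x := expR (g (torus_lift x : V)).
  have mf0 : measurable_fun setT f0 by exact: measurable_dual_potential gK pg.
  have mf1 : measurable_fun setT f1.
    apply: (measurableT_comp (f := @expR R)); first exact: measurable_expR.
    by apply: measurable_lift_continuous => //; exact: hasT2_continuous.
  have f00 x : 0 <= f0 x by exact: dual_potential_ge0 gK _.
  have f10 x : 0 <= f1 x by exact: expR_ge0.
  have f0K x : f0 x <= expR K by exact: dual_potential_bound gK _.
  have f1K x : f1 x <= expR K by rewrite ler_expR (le_trans (ler_norm _)).
  have [iD le] := HK_weak_duality mu0E mu1E rK0 rK1 qp mf0 mf1 f00 f10 f0K f1K
    (dual_potential_cone gK pg).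
  apply: le_trans le; have hI' := has_meanD hI (has_mean_cst P (- (C2 * e5))).
  have [iI <-] := hI'; apply: le_integral => //.
  move=> x _; rewrite lee_fin /dual_density /= !cone_radius_to_cone.
  have m0 := mass_gt0 phi1 A0 (torus_lift x); have m1 := mass_gt0 psi1 B0 (torus_lift x).
  rewrite !cone_base_to_cone ?gt_eqF ?sqrtr_gt0//.
  rewrite !ger0_norm ?sqrtr_ge0// !sqr_sqrtr ?(ltW m0) ?(ltW m1)//.
  (* The base points are [x + a] and [x + b]; their lifts are known only up to lattice vectors,
     which periodicity removes. *)
  rewrite /f0 /f1 (periodic_lift _ (dual_potential_periodic gK pg)) (periodic_lift _ pg).
  have := lo (Param (torus_lift x) s0 t0) h2 (dual_potential g _) (fun y => @dual_potential_le _ _ _ _ y).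
  rewrite /= -/e5 -/g /exp_shift; lra.
have X0 : (0 <= X)%E.
  apply: le_ereal_inf_tmp => _ [q qp <-]; apply: integral_ge0 => z _.
  by rewrite lee_fin sqr_ge0.
case: X X0 Xup Xlo => [r| |]//; rewrite !lee_fin => r0 rup rlo /=.
rewrite sqr_sqrtr// ler_norml; have := mulr_ge0 C10 e50; have := mulr_ge0 C20 e50; lra.
Qed.

End HK_expansion.

(** * The curvature of a pair of Fourier modes *)

Lemma int_norm_ge1 (R : realType) n (k : 'rV[int]_n) : k != 0 -> 1 <= int_norm R k ^+ 2.
Proof.
move=> k0; have [p kp] : exists p, k 0 p != 0.
  apply: contrapT => h; move/eqP: k0; apply; apply/rowP => p; rewrite mxE.
  by apply/eqP; apply: contrapT => /negP kp; apply: h; exists p.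
rewrite int_norm_sqr (bigD1 p)//=.
have : 1 <= ((k 0 p)%:~R : R) ^+ 2.
  rewrite -real_normK ?num_real// -intr_norm exprn_ege1// -[1]/(1%:~R) ler_int.
  by rewrite -gtz0_ge1 normr_gt0.
have : 0 <= \sum_(i | i != p) ((k 0 i)%:~R : R) ^+ 2 by apply: sumr_ge0 => i _; exact: sqr_ge0.
lra.
Qed.

Lemma HK_fourier_expansion (R : realType) n (k l : 'rV[int]_n) :
    k != 0 -> (forall p, k 0 p * l 0 p = 0) ->
  let mu := torus_volume R n in
  let a := int_norm R k ^+ 2 in let b := int_norm R l ^+ 2 in
  exists C d : R, [/\ 0 <= C, 0 < d & forall s t, 0 < s -> 0 < t -> s + t <= d ->
  `|fine (HK (exp_measure mu (fun x => s * fourier_basis k x))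
             (exp_measure mu (fun x => t * fourier_basis l x))) ^+ 2
    - (s ^+ 2 * (4 + a) + t ^+ 2 * (4 + b) + s ^+ 2 * t ^+ 2 * (a * b) / 3)| <= C * (s + t) ^+ 5].
Proof.
move=> k0 kl mu a b; pose al i : 'I_n -> nat := incr (fun=> 0%N) i.
have i1 i : (0 < al i i)%N by rewrite /al /incr eqxx.
have i2 i j : (0 < incr (al i) j j)%N by rewrite /incr eqxx addn1.
(* One more order of derivatives is supplied for [psi] than for [phi]: the potential contains
   [|grad psi|^2], whose gradient involves the Hessian of [psi], and this Hessian is compared at [v]
   and [v + b]. *)
have [C [d [C0 d0 h]]] := HK_expansion (phi := @trig_prod R n k (fun=> 0%N))
  (phi1 := fun i => trig_prod k (al i)) (phi2 := fun i j => trig_prod k (incr (al i) j))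
  (psi := trig_prod l (fun=> 0%N)) (psi1 := fun i => trig_prod l (al i))
  (psi2 := fun i j => trig_prod l (incr (al i) j))
  (psi3 := fun i j m => trig_prod l (incr (incr (al i) j) m))
  (T2_trig_prod _ _ _) (fun i => T2_trig_prod _ _ _) (T2_trig_prod _ _ _) (fun i => T2_trig_prod _ _ _)
  (fun i j => T2_trig_prod _ _ _)
  (fun i v => trig_prod_orth v kl (i1 i) (i1 i))
  (fun i j v => trig_prod_orth v kl (i2 i j) (i1 j))
  (fun i j v => congr1 (fun be => trig_prod l be v) (incrC _ i j))
  (@trig_prod_periodic _ _ _ _) (fun i => @trig_prod_periodic _ _ _ _)
  (@trig_prod_periodic _ _ _ _) (fun i => @trig_prod_periodic _ _ _ _)
  (@fourier_basisE _ _ k) (@fourier_basisE _ _ l).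
exists C, d; split => // s t s0 t0 std; apply: (h s t s0 t0 std).
exact: has_mean_HK_density.
Qed.


(** Since [s / t + t / s + 2 = (s + t)^2 / (s t)], the right-hand side is [M (s + t)^5 / (s^2 t^2)],
    a fifth-order error divided by [s^2 t^2]. Comparability of [s] and [t] bounds the first factor,
    and [s + t] tends to [0]. *)
Lemma lim_star_bound (R : realType) (G : R -> R -> R) (L M d : R) : 0 < d ->
    (forall s t, 0 < s -> 0 < t -> s + t <= d ->
      `|G s t - L| <= M * (s / t + t / s + 2) ^+ 2 * (s + t)) ->
  lim_star G L.
Proof.
move=> d0 h s t s0 t0 cs ct [K hK].
have K0 : 0 <= K by apply: le_trans (hK 0%N); rewrite addr_ge0// divr_ge0// ltW.
pose N := `|M| * (K + 2) ^+ 2 + 1.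
have N0 : 0 < N by rewrite ltr_wpDl// mulr_ge0// sqr_ge0.
apply/cvgrPdist_le => e e0.
have cst : (fun j => s j + t j) @ \oo --> (0 : R) by rewrite -[0 in X in _ --> X]addr0; exact: cvgD.
have m0 : 0 < Num.min d (e / N) by rewrite lt_min d0 divr_gt0.
have /cvgrPdist_le /(_ _ m0) := cst; apply: filterS => j.
have st0 : 0 < s j + t j by rewrite addr_gt0.
rewrite sub0r normrN gtr0_norm// le_min => /andP[st1 st2].
rewrite distrC; apply: le_trans (h _ _ (s0 j) (t0 j) st1) _.
apply: (@le_trans _ _ (N * (s j + t j))); last by rewrite mulrC -ler_pdivlMr.
rewrite ler_pM2r//; apply: (@le_trans _ _ (`|M| * (K + 2) ^+ 2)); last by rewrite lerDl.
have r0 : 0 <= s j / t j + t j / s j by rewrite addr_ge0// divr_ge0// ltW.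
apply: (@le_trans _ _ (`|M| * (s j / t j + t j / s j + 2) ^+ 2)).
  by rewrite ler_wpM2r ?sqr_ge0// ler_norm.
by rewrite ler_wpM2l//; apply: lerXn2r; rewrite ?nnegrE ?lerD2r// addr_ge0.
Qed.

Theorem proposition6p14 (R : realType) (n : nat) (k l : 'rV[int]_n)
  (hn : (2 <= n)%N) (hk : k != 0) (hl : l != 0)
  (hkl : forall p : 'I_n, k 0 p * l 0 p = 0) :
  let L : R := - ((int_norm R k ^+ 2 * int_norm R l ^+ 2) /
                  ((4 + int_norm R k ^+ 2) * (4 + int_norm R l ^+ 2))) in
  is_Sec (torus_volume R n) (@fourier_basis R n k) (@fourier_basis R n l) L /\
  - 1 < L <= - (1 / 25).
Proof.
move=> L; have a1 := int_norm_ge1 R hk; have b1 := int_norm_ge1 R hl.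
have [C [d [C0 d0 hHK]]] := HK_fourier_expansion R hk hkl.
have gramE : H1_gram (torus_volume R n) (@fourier_basis R n k) (@fourier_basis R n l) =
    (4 + int_norm R k ^+ 2) * (4 + int_norm R l ^+ 2).
  (* The norms of the two modes are read off from the norm of [s e_k - t e_l] at [(1, 0)] and
     [(0, -1)]. *)
  have := @H1_norm_fourier R n k l hkl hk 1 0; have := @H1_norm_fourier R n k l hkl hk 0 (-1).
  under eq_fun do rewrite mul0r sub0r mulN1r opprK.
  move=> e1; under eq_fun do rewrite mul1r mul0r subr0.
  move=> e2; rewrite /H1_gram e1 e2 H1_dot_fourier//; ring.
have normE := @H1_norm_fourier R n k l hkl hk.
move: a1 b1 hHK gramE normE @L.
move: (int_norm R k ^+ 2) (int_norm R l ^+ 2) => a b a1 b1 hHK gramE normE L.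
have D0 : 0 < (4 + a) * (4 + b) by rewrite mulr_gt0//; lra.
split; last first.
  (* With [a] and [b] at least [1], both [a / (4 + a)] and [b / (4 + b)] lie in [[1/5, 1[]. *)
  by rewrite /L ltrN2 lerN2 ltr_pdivrMr// ler_pdivlMr//; apply/andP; split; nra.
apply: (lim_star_bound (M := 3 * C / ((4 + a) * (4 + b))) d0) => s t s0 t0 std.
rewrite /Sec_quotient gramE normE.
have := hHK s t s0 t0 std; set X := fine _ ^+ 2 => hX.
set I := (X in `|_ - X|) in hX.
have st0 : 0 < (4 + a) * (4 + b) * s ^+ 2 * t ^+ 2 by do 2 (apply: mulr_gt0; last exact: exprn_gt0).
(* If [X] were equal to its expansion [I], the quotient would be exactly [L]; only the error [I - X]
   is left to estimate. *)
have -> : 3 / ((4 + a) * (4 + b) * s ^+ 2 * t ^+ 2)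
    * (s ^+ 2 * (4 + a) + t ^+ 2 * (4 + b) - X) - L =
  3 / ((4 + a) * (4 + b) * s ^+ 2 * t ^+ 2) * (I - X).
  by rewrite /L /I; field; rewrite !gt_eqF//; lra.
have c0 : 0 <= 3 / ((4 + a) * (4 + b) * s ^+ 2 * t ^+ 2) by rewrite divr_ge0// ltW.
rewrite normrM (ger0_norm c0) distrC.
apply: (le_trans (ler_wpM2l c0 hX)).
rewrite le_eqVlt; apply/orP; left; apply/eqP; field.
by rewrite !gt_eqF//; lra.
Qed.
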